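(* Let $\rho_0,\rho_1\in\mathcal D_+$ with $\rho_0-\rho_1\in\ker(\nabla_L)^\perp$. Then $$\min_{(\rho,m)}\int_0^1F(\rho(t),m(t))\,dt\;=\;\sup_{\lambda}\bigl\{\langle\lambda(1);\rho_1\rangle-\langle\lambda(0);\rho_0\rangle\bigr\},$$ where the minimum (which is attained) is over all pairs $(\rho,m)\in L^2(0,1;\mathcal H)\times L^2(0,1;\mathbb C^{nN\times n})$ with $\mathrm{tr}(\rho)\equiv1$ satisfying $$\rho(0)=\rho_0,\quad \rho(1)=\rho_1,\quad \dot\rho=\tfrac12\nabla_L^*(m-m_* )\ \text{ in the sense of distributions on }(0,1),$$ and the supremum is over all $\lambda\in W^{1,2}(0,1;\mathcal H)$ satisfying $$\dot\lambda+\tfrac12(\nabla_L\lambda)^*(\nabla_L\lambda)\le0\quad\text{a.e. on }(0,1).$$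
   Context: Fix integers $n,N\ge1$ and Hermitian matrices $L_1,\dots,L_N\in\mathbb C^{n\times n}$. $\mathcal H$ and $\mathcal S$ denote the real vector spaces of $n\times n$ complex Hermitian, respectively skew-Hermitian, matrices; $\mathcal H_+$ and $\mathcal H_{++}$ are the positive semidefinite, respectively positive definite, matrices in $\mathcal H$; $\mathcal D_+=\{\rho\in\mathcal H_{++}:\mathrm{tr}(\rho)=1\}$. $\langle X;Y\rangle=\mathrm{tr}(X^*Y)$ for matrices of the same size, $\|\cdot\|$ is the associated norm. A matrix $m\in\mathbb C^{nN\times n}$ is viewed as a block column with blocks $m_1,\dots,m_N\in\mathbb C^{n\times n}$, and $m_*$ is the block column with blocks $m_1^*,\dots,m_N^*$; $\mathcal S^N$ is the set of block columns with all blocks in $\mathcal S$ (so $m-m_*\in\mathcal S^N$). $\nabla_L:\mathcal H\to\mathcal S^N$ sends $X$ to the block column with blocks $L_kX-XL_k$; its dual $\nabla_L^*:\mathcal S^N\to\mathcal H$ is $\nabla_L^*Y=\sum_k(L_kY_k-Y_kL_k)$. $\ker(\nabla_L)^\perp$ is the orthogonal complement of $\ker(\nabla_L)$ in $\mathcal H$. The inequality $A\le0$ for $A\in\mathcal H$ means that $-A\in\mathcal H_+$. The function $F:\mathcal H\times\mathbb C^{nN\times n}\to[0,\infty]$ is defined by: $F(\rho,m)=\frac12\langle m;m\rho^{-1}\rangle$ if $\rho\in\mathcal H_{++}$; $F(\rho,m)=\infty$ if $\rho\notin\mathcal H_+$; and if $\rho\in\mathcal H_+\setminus\mathcal H_{++}$,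 $F(\rho,m)$ is the infimum of $\liminf_{\ell\to\infty}\frac12\langle m_\ell;m_\ell\rho_\ell^{-1}\rangle$ over all sequences $(\rho_\ell,m_\ell)\in\mathcal H_{++}\times\mathbb C^{nN\times n}$ converging to $(\rho,m)$. The differential constraint forces $\rho\in W^{1,2}(0,1;\mathcal H)$, and boundary values of $\rho$ and $\lambda$ are those of the continuous representatives. *)

(* Defs.v *)
From mathcomp Require Import all_boot all_order all_algebra.
From mathcomp Require Import sesquilinear spectral complex.
From mathcomp Require Import all_classical all_reals all_analysis.

Set Implicit Arguments.
Unset Strict Implicit.
Unset Printing Implicit Defensive.

Import Order.TTheory GRing.Theory Num.Theory.
Import numFieldNormedType.Exports.

Local Open Scope classical_set_scope.
Local Open Scope ring_scope.
Local Open Scope complex_scope.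
Local Open Scope sesquilinear_scope.

Section Matrices.
Variable R : realType.
Local Notation C := R[i].

Definition Herm n : set 'M[C]_n := [set A | A \is hermsymmx].

(* [0 <= z] and [0 < z] in R[i] include the assertion that z is real. *)
Definition Hpsd n : set 'M[C]_n :=
  [set A | Herm A /\ forall v : 'cV[C]_n, 0 <= ((v ^t*) *m A *m v) 0 0].

Definition Hpd n : set 'M[C]_n :=
  [set A | Herm A /\
    forall v : 'cV[C]_n, v != 0 -> 0 < ((v ^t*) *m A *m v) 0 0].

Definition Dpd n : set 'M[C]_n := [set rho | Hpd rho /\ \tr rho = 1].

Definition mxinner p q (X Y : 'M[C]_(p, q)) : C := \tr ((X ^t*) *m Y).

(* Real-valued version of [mxinner], for the pairs on which it is real: two
   Hermitian matrices, (X, X), or (m, m *m invmx rho) with rho in Hpd. *)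
Definition rinner p q (X Y : 'M[C]_(p, q)) : R := complex.Re (mxinner X Y).

Definition mxnorm p q (X : 'M[C]_(p, q)) : R := Num.sqrt (rinner X X).

End Matrices.

(* The nN x n complex matrices; the block m_k is [submxcol m k]. *)
Notation blockcol R n N := ('M[R[i]]_(\sum_(k < N) n, n)).

Section Operators.
Variables (R : realType) (n N : nat).
Local Notation C := R[i].

Definition blockstar (m : blockcol R n N) : blockcol R n N :=
  \mxcol_(k < N) ((submxcol m k) ^t*).

Variable L : 'I_N -> 'M[C]_n.

Definition nabla (X : 'M[C]_n) : blockcol R n N :=
  \mxcol_(k < N) (L k *m X - X *m L k).

(* The dual of [nabla] on columns Y with skew-Hermitian blocks, the L_k being
   Hermitian. *)
Definition nablaD (Y : blockcol R n N) : 'M[C]_n :=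
  \sum_(k < N) (L k *m submxcol Y k - submxcol Y k *m L k).

Definition ker_nabla : set 'M[C]_n := [set X | Herm X /\ nabla X = 0].

Definition ker_nabla_perp : set 'M[C]_n :=
  [set Z | Herm Z /\ forall X, ker_nabla X -> mxinner X Z = 0].

End Operators.

Section Action.
Variables (R : realType) (n N : nat).
Local Notation C := R[i].

Definition kinetic (rho : 'M[C]_n) (m : blockcol R n N) : R :=
  2^-1 * rinner m (m *m invmx rho).

Definition kinetic_liminfs (rho : 'M[C]_n) (m : blockcol R n N) :
    set (\bar R) :=
  [set x | exists (rho_ : nat -> 'M[C]_n) (m_ : nat -> blockcol R n N),
    [/\ forall l, Hpd (rho_ l),
        mxnorm (rho_ l - rho) @[l --> \oo] --> (0 : R),
        mxnorm (m_ l - m) @[l --> \oo] --> (0 : R) &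
        x = limn_einf (fun l => (kinetic (rho_ l) (m_ l))%:E)]].

Definition F (rho : 'M[C]_n) (m : blockcol R n N) : \bar R :=
  if `[< Hpd rho >] then (kinetic rho m)%:E
  else if `[< Hpsd rho >] then ereal_inf (kinetic_liminfs rho m)
  else +oo%E.

End Action.

(* Elements of L^2(0,1) are given by representatives R -> 'M, of which only
   the restriction to ]0, 1[ matters. *)
Section FunctionSpaces.
Variable R : realType.
Local Notation C := R[i].
Local Notation mu := (@lebesgue_measure R).
Local Notation I01 := (`]0, 1[%classic : set R).

Definition ae01 (P : R -> Prop) : Prop := {ae mu, forall t, I01 t -> P t}.

Definition L2 p q (f : R -> 'M[C]_(p, q)) : Prop :=
  (forall i j, measurable_fun I01 (fun t : R => complex.Re (f t i j)) /\
               measurable_fun I01 (fun t : R => complex.Im (f t i j))) /\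
  (\int[mu]_(t in I01) (mxnorm (f t) ^+ 2)%:E < +oo)%E.

Definition L2H n (f : R -> 'M[C]_n) : Prop :=
  L2 f /\ forall t, I01 t -> Herm (f t).

Definition test_function (phi : R -> R) : Prop :=
  [/\ forall k t, derivable (derive1n k phi) t 1,
      compact (closure [set t | phi t != 0]) &
      closure [set t | phi t != 0] `<=` I01].

(* g is the derivative of f in the sense of distributions on ]0, 1[; the
   integrals of matrix-valued functions are taken entrywise. *)
Definition weak_derivative p q (f g : R -> 'M[C]_(p, q)) : Prop :=
  forall phi, test_function phi -> forall i j,
    \int[mu]_(t in I01) (derive1 phi t * complex.Re (f t i j)) =
      - (\int[mu]_(t in I01) (phi t * complex.Re (g t i j))) /\
    \int[mu]_(t in I01) (derive1 phi t * complex.Im (f t i j)) =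
      - (\int[mu]_(t in I01) (phi t * complex.Im (g t i j))).

(* The representative of f that is continuous on [0, 1] takes the values a at
   0 and b at 1. *)
Definition boundary_values p q (f : R -> 'M[C]_(p, q)) (a b : 'M[C]_(p, q)) :
    Prop :=
  exists fc : R -> 'M[C]_(p, q),
    [/\ forall t, t \in `[0, 1] ->
          mxnorm (fc s - fc t) @[s --> within `[0, 1] (nbhs t)] --> (0 : R),
        ae01 (fun t => f t = fc t),
        fc 0 = a & fc 1 = b].

(* f belongs to W^{1,2}(0,1;H) and has derivative g. *)
Definition W12H n (f g : R -> 'M[C]_n) : Prop :=
  [/\ L2H f, L2H g & weak_derivative f g].

End FunctionSpaces.

Section Problem.
Variables (R : realType) (n N : nat) (L : 'I_N -> 'M[R[i]]_n).
Variables rho0 rho1 : 'M[R[i]]_n.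

Definition admissible (rho : R -> 'M[R[i]]_n) (m : R -> blockcol R n N) :
    Prop :=
  [/\ L2H rho, L2 m, ae01 (fun t => \tr (rho t) = 1),
      boundary_values rho rho0 rho1 &
      weak_derivative rho
        (fun t => 2^-1 *: nablaD L (m t - blockstar (m t)))].

Definition action (rho : R -> 'M[R[i]]_n) (m : R -> blockcol R n N) : \bar R :=
  (\int[@lebesgue_measure R]_(t in `]0%R, 1%R[) F (rho t) (m t))%E.

(* dlambda stands for the weak derivative of lambda, and l0, l1 for its
   boundary values. *)
Definition dual_values : set (\bar R) :=
  [set x | exists (lambda dlambda : R -> 'M[R[i]]_n) (l0 l1 : 'M[R[i]]_n),
    [/\ W12H lambda dlambda,
        boundary_values lambda l0 l1,
        ae01 (fun t => Hpsd (- (dlambda t +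
          2^-1 *: ((nabla L (lambda t) ^t*) *m nabla L (lambda t))))) &
        x = (rinner l1 rho1 - rinner l0 rho0)%:E]].

End Problem.

(* Main.v *)
Require Import Defs.
From HB Require Import structures.
From mathcomp Require Import all_boot all_order all_algebra.
From mathcomp Require Import sesquilinear spectral complex.
From mathcomp Require Import all_classical all_reals all_analysis.
From mathcomp Require Import measurable_realfun.
From mathcomp Require Import ring lra.

Set Implicit Arguments.
Unset Strict Implicit.
Unset Printing Implicit Defensive.

Import Order.TTheory GRing.Theory Num.Theory.
Import numFieldNormedType.Exports.

Local Open Scope classical_set_scope.
Local Open Scope ring_scope.
Local Open Scope complex_scope.
Local Open Scope sesquilinear_scope.

(** Write |X|^2 for [rinner X X].  Everything rests on the Fenchel form of the
    kinetic energy: for rho positive semidefinite, F(rho, m) is the supremum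
    over all columns b of <b, m> - 1/2 <b, b rho>.  That supremum is convex and
    lower semicontinuous in (rho, m) and needs no inverse of rho.

    One inequality is Fenchel-Young integrated in time.  If lambda is feasible,
    then taking b = nabla lambda gives <lambda', rho> + <lambda, rho'> <=
    F(rho, m) at almost every time, and the left side integrates to the
    boundary terms ([fenchel], [weak_duality]).

    The absence of a gap and the attainment come from a discretised dual
    problem.  The potential lambda is given by its values on a uniform time
    grid, and the Hamilton-Jacobi constraint is imposed with the quadratic term
    taken at both ends of every cell.  As the quadratic term is convex, the
    constraint then holds along the polygon through the grid values, up to a
    correction by multiples of the identity, which nabla does not see
    ([dual_candidate]).  A slack in the constraint and a small multiple of
    |lambda|^2 are penalised quadratically.  What remains is the minimisation
    of a strictly convex quadratic function over a closed convex set, whose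
    minimiser exists by completeness alone ([convex_quadratic_min]); its
    optimality conditions produce positive semidefinite multipliers r
    satisfying complementary slackness and a discrete continuity equation
    whose momentum is nabla lambda times r ([discrete_duality],
    [grid_duality]).  Read as step functions of time, these multipliers are an
    almost admissible curve, and by complementary slackness their action
    exceeds the supremum of the dual values by as little as desired
    ([discrete_energy], [primal_approximation]).

    The passage to the limit avoids weak compactness.  The set of approximate
    solutions with a given tolerance is convex and bounded in L^2, and these
    sets decrease with the tolerance.  Elements of almost minimal L^2 norm
    therefore form a Cauchy sequence by the parallelogram identity
    ([nested_min], [approx_fast]), and it can be chosen to converge so fast
    that it converges almost everywhere.  The linear constraint passes to the
    limit by dominated convergence ([limit_constraint]), and the action by
    Fatou's lemma and the lower semicontinuity of F ([limit_action]).

    Finiteness of the common value comes from the segment between rho0 and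
    rho1, driven by a constant momentum that exists because rho1 - rho0 is in
    the range of the flux ([ker_perp_range], [reference_path]). *)

(** * Matrices as a real inner product space *)

Section RealInner.
Variable R : realType.
Local Notation C := R[i].
Local Notation Re := (@complex.Re R).
Local Notation Im := (@complex.Im R).

Lemma Re_conj (z : C) : Re (z^*) = Re z. Proof. by case: z. Qed.
Lemma Im_conj (z : C) : Im (z^*) = - Im z. Proof. by case: z. Qed.
Lemma Re_mul (x y : C) : Re (x * y) = Re x * Re y - Im x * Im y.
Proof. by case: x y => [a b] [c d]. Qed.
Lemma Im_mul (x y : C) : Im (x * y) = Re x * Im y + Im x * Re y.
Proof. by case: x y => [a b] [c d]. Qed.
Lemma Re_add (x y : C) : Re (x + y) = Re x + Re y.
Proof. by case: x y => [a b] [c d]. Qed.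
Lemma Re_sum (I : Type) (r : seq I) (P : pred I) (f : I -> C) :
  Re (\sum_(i <- r | P i) f i) = \sum_(i <- r | P i) Re (f i).
Proof. exact: (big_morph _ Re_add (erefl _)). Qed.
Lemma complex_eqP (x y : C) : Re x = Re y -> Im x = Im y -> x = y.
Proof. by case: x y => [a b] [c d] /= -> ->. Qed.

Lemma rinnerE p q (X Y : 'M[C]_(p, q)) : rinner X Y =
  \sum_i \sum_j (Re (X i j) * Re (Y i j) + Im (X i j) * Im (Y i j)).
Proof.
rewrite /rinner /mxinner /mxtrace Re_sum exchange_big /=; apply: eq_bigr => j _.
rewrite mxE Re_sum; apply: eq_bigr => i _.
by rewrite !mxE Re_mul Re_conj Im_conj; ring.
Qed.

Lemma rinnerC p q (X Y : 'M[C]_(p, q)) : rinner X Y = rinner Y X.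
Proof.
rewrite !rinnerE; apply: eq_bigr => i _; apply: eq_bigr => j _.
by rewrite mulrC [X in _ + X]mulrC.
Qed.

Lemma rinnerDr p q (X Y Z : 'M[C]_(p, q)) :
  rinner X (Y + Z) = rinner X Y + rinner X Z.
Proof. by rewrite /rinner /mxinner mulmxDr mxtraceD Re_add. Qed.

Lemma rinnerZr p q (a : R) (X Y : 'M[C]_(p, q)) :
  rinner X (a%:C *: Y) = a * rinner X Y.
Proof.
by rewrite /rinner /mxinner -scalemxAr mxtraceZ Re_mul /= mul0r subr0.
Qed.

Lemma rinnerDl p q (X Y Z : 'M[C]_(p, q)) :
  rinner (Y + Z) X = rinner Y X + rinner Z X.
Proof. by rewrite rinnerC rinnerDr !(rinnerC X). Qed.
Lemma rinnerZl p q (a : R) (X Y : 'M[C]_(p, q)) :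
  rinner (a%:C *: X) Y = a * rinner X Y.
Proof. by rewrite rinnerC rinnerZr rinnerC. Qed.
Lemma rinnerNr p q (X Y : 'M[C]_(p, q)) : rinner X (- Y) = - rinner X Y.
Proof. by rewrite -scaleN1r -(rmorphN1 (real_complex R)) rinnerZr mulN1r. Qed.
Lemma rinnerNl p q (X Y : 'M[C]_(p, q)) : rinner (- X) Y = - rinner X Y.
Proof. by rewrite rinnerC rinnerNr rinnerC. Qed.
Lemma rinnerBr p q (X Y Z : 'M[C]_(p, q)) :
  rinner X (Y - Z) = rinner X Y - rinner X Z.
Proof. by rewrite rinnerDr rinnerNr. Qed.
Lemma rinnerBl p q (X Y Z : 'M[C]_(p, q)) :
  rinner (Y - Z) X = rinner Y X - rinner Z X.
Proof. by rewrite rinnerDl rinnerNl. Qed.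
Lemma rinner0r p q (X : 'M[C]_(p, q)) : rinner X 0 = 0.
Proof. by rewrite -(subrr X) rinnerBr subrr. Qed.
Lemma rinner0l p q (X : 'M[C]_(p, q)) : rinner 0 X = 0.
Proof. by rewrite rinnerC rinner0r. Qed.
Lemma rinner_sumr p q (I : Type) (r : seq I) (P : pred I)
    (X : 'M[C]_(p, q)) (f : I -> 'M[C]_(p, q)) :
  rinner X (\sum_(i <- r | P i) f i) = \sum_(i <- r | P i) rinner X (f i).
Proof. exact: (big_morph _ (rinnerDr X) (rinner0r X)). Qed.
(** The conjugate transpose under a name of its own, so that rewriting is not
    disturbed by the map and the transposition that it is made of. *)
Definition adj p q (X : 'M[C]_(p, q)) : 'M[C]_(q, p) := X ^t*.

Lemma adjE p q (X : 'M[C]_(p, q)) i j : adj X i j = (X j i)^*.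
Proof. by rewrite !mxE. Qed.

Lemma adjK p q (X : 'M[C]_(p, q)) : adj (adj X) = X.
Proof. exact: (@trmxCK _ _ _ X). Qed.
Lemma mxinnerE p q (X Y : 'M[C]_(p, q)) : mxinner X Y = \tr (adj X *m Y).
Proof. by []. Qed.
Lemma adjM p q r (X : 'M[C]_(p, q)) (Y : 'M[C]_(q, r)) :
  adj (X *m Y) = adj Y *m adj X.
Proof. by rewrite /adj trmx_mul map_mxM. Qed.
Lemma adjD p q (X Y : 'M[C]_(p, q)) : adj (X + Y) = adj X + adj Y.
Proof. by rewrite /adj linearD /= map_mxD. Qed.
Lemma adjN p q (X : 'M[C]_(p, q)) : adj (- X) = - adj X.
Proof. by rewrite /adj linearN /= map_mxN. Qed.
Lemma adjB p q (X Y : 'M[C]_(p, q)) : adj (X - Y) = adj X - adj Y.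
Proof. by rewrite adjD adjN. Qed.
Lemma adj0 p q : adj (0 : 'M[C]_(p, q)) = 0.
Proof. by rewrite /adj trmx0 map_mx0. Qed.
Lemma adjZ p q (a : R) (X : 'M[C]_(p, q)) : adj (a%:C *: X) = a%:C *: adj X.
Proof.
rewrite /adj linearZ /= map_mxZ; congr (_ *: _); apply: complex_eqP; rewrite /= ?oppr0 //.
Qed.
Lemma adj_sum p q (I : Type) (r : seq I) (P : pred I) (f : I -> 'M[C]_(p, q)) :
  adj (\sum_(i <- r | P i) f i) = \sum_(i <- r | P i) adj (f i).
Proof. exact: (big_morph _ (@adjD p q) (@adj0 p q)). Qed.

Lemma rinner_adj p q (X Y : 'M[C]_(p, q)) : rinner (adj X) (adj Y) = rinner X Y.
Proof.
rewrite !rinnerE exchange_big; apply: eq_bigr => i _; apply: eq_bigr => j _ /=.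
by rewrite !adjE !Re_conj !Im_conj mulrNN.
Qed.

Lemma rinner_mull p q r (A : 'M[C]_(r, p)) (X : 'M[C]_(p, q)) (Y : 'M[C]_(r, q)) :
  rinner (A *m X) Y = rinner X (adj A *m Y).
Proof. by rewrite /rinner !mxinnerE adjM -mulmxA. Qed.

Lemma rinner_mulr p q r (A : 'M[C]_(q, r)) (X : 'M[C]_(p, q)) (Y : 'M[C]_(p, r)) :
  rinner (X *m A) Y = rinner X (Y *m adj A).
Proof. by rewrite -rinner_adj adjM rinner_mull -rinner_adj adjM !adjK. Qed.

Lemma rinner_ge0 p q (X : 'M[C]_(p, q)) : 0 <= rinner X X.
Proof.
rewrite rinnerE; apply: sumr_ge0 => i _; apply: sumr_ge0 => j _.
by rewrite -!expr2 addr_ge0 ?sqr_ge0.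
Qed.

Lemma rinner_eq0 p q (X : 'M[C]_(p, q)) : rinner X X = 0 -> X = 0.
Proof.
rewrite rinnerE => /eqP; rewrite psumr_eq0; last first.
  by move=> i _; apply: sumr_ge0 => j _; rewrite -!expr2 addr_ge0 ?sqr_ge0.
move=> /allP h; apply/matrixP => i j.
have := h i; rewrite mem_index_enum => /(_ isT); rewrite psumr_eq0; last first.
  by move=> k _; rewrite -!expr2 addr_ge0 ?sqr_ge0.
move=> /allP /(_ j); rewrite mem_index_enum => /(_ isT).
rewrite -!expr2 paddr_eq0 ?sqr_ge0// !sqrf_eq0 => /andP[/eqP hr /eqP hi].
by apply: complex_eqP; rewrite ?hr ?hi mxE.
Qed.

(** Identities between matrices are proved below by pairing with an arbitrary
    matrix, which turns them into identities between real numbers. *)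
Lemma rinner_nondeg p q (X Y : 'M[C]_(p, q)) :
  (forall E, rinner E X = rinner E Y) -> X = Y.
Proof.
move=> h; apply/eqP; rewrite -subr_eq0; apply/eqP; apply: rinner_eq0.
by rewrite rinnerBr h subrr.
Qed.

Lemma normE p q (X : 'M[C]_(p, q)) : mxnorm X ^+ 2 = rinner X X.
Proof. by rewrite sqr_sqrtr// rinner_ge0. Qed.

Lemma norm_ge0 p q (X : 'M[C]_(p, q)) : 0 <= mxnorm X.
Proof. exact: sqrtr_ge0. Qed.

Lemma rinner_le p q (X Y : 'M[C]_(p, q)) : 2 * rinner X Y <= rinner X X + rinner Y Y.
Proof.
have := rinner_ge0 (X - Y).
rewrite rinnerBl !rinnerBr (rinnerC Y X); lra.
Qed.

Lemma rinner_CS2 p q (X Y : 'M[C]_(p, q)) :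
  rinner X Y ^+ 2 <= rinner X X * rinner Y Y.
Proof.
have [Y0|/negbTE Y0] := eqVneq (rinner Y Y) 0.
  by rewrite (rinner_eq0 Y0) rinner0r expr0n/= rinner0l mulr0.
have Yp : 0 < rinner Y Y by rewrite lt_def Y0 rinner_ge0.
have := rinner_ge0 ((rinner Y Y)%:C *: X - (rinner X Y)%:C *: Y).
rewrite rinnerBl !rinnerBr !rinnerZl !rinnerZr (rinnerC Y X).
move: (rinner X Y) (rinner Y Y) (rinner X X) Yp => a b c b0 h.
have : 0 <= b * (c * b - a ^+ 2) by move: h; congr (0 <= _); ring.
by rewrite (pmulr_rge0 _ b0) subr_ge0.
Qed.

Lemma rinner_CS p q (X Y : 'M[C]_(p, q)) :
  `|rinner X Y| <= mxnorm X * mxnorm Y.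
Proof.
rewrite -(@ler_pXn2r _ 2) ?nnegrE// ?mulr_ge0 ?norm_ge0//.
by rewrite exprMn !normE -normrX ger0_norm ?sqr_ge0// rinner_CS2.
Qed.

(** The orthonormal basis, over the reals, of the space of complex matrices:
    [b] selects the imaginary direction. *)
Definition unitv p q (b : bool) (i : 'I_p) (j : 'I_q) : 'M[C]_(p, q) :=
  (if b then 'i else 1) *: delta_mx i j.

Lemma rinner_unitv p q b i j (X : 'M[C]_(p, q)) :
  rinner (unitv b i j) X = if b then Im (X i j) else Re (X i j).
Proof.
rewrite rinnerE (bigD1 i)//= (bigD1 j)//= !mxE !eqxx big1 ?addr0.
  rewrite big1 ?addr0.
    by case: b; rewrite ?mulr1 /= ?mul0r ?mul1r ?add0r ?addr0.
  move=> i' ii'; rewrite big1// => j' _.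
  by rewrite !mxE (negbTE ii') /= mulr0 /= !mul0r addr0.
by move=> j' jj'; rewrite !mxE (negbTE jj') andbF mulr0 /= !mul0r addr0.
Qed.

Lemma Re_rinner p q i j (X : 'M[C]_(p, q)) : Re (X i j) = rinner (unitv false i j) X.
Proof. by rewrite rinner_unitv. Qed.
Lemma Im_rinner p q i j (X : 'M[C]_(p, q)) : Im (X i j) = rinner (unitv true i j) X.
Proof. by rewrite rinner_unitv. Qed.

Lemma rinner_coord p q (E X : 'M[C]_(p, q)) : rinner E X =
  \sum_(c : bool * 'I_p * 'I_q)
    rinner E (unitv c.1.1 c.1.2 c.2) * rinner (unitv c.1.1 c.1.2 c.2) X.
Proof.
transitivity (\sum_(b : bool) \sum_i \sum_j
    rinner E (unitv b i j) * rinner (unitv b i j) X); last first.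
  by rewrite pair_bigA /= pair_bigA /=.
rewrite big_bool /= -big_split rinnerE; apply: eq_bigr => i _ /=.
rewrite -big_split; apply: eq_bigr => j _ /=.
by rewrite !(rinnerC E) !rinner_unitv /= addrC.
Qed.

(** Submultiplicativity of the Frobenius norm: Cauchy-Schwarz for each entry of
    the product, then summation. *)
Lemma rinner_mul_le p q r (X : 'M[C]_(p, q)) (Y : 'M[C]_(q, r)) :
  rinner (X *m Y) (X *m Y) <= rinner X X * rinner Y Y.
Proof.
have cs (x : 'I_q -> C) (y : 'I_q -> C) :
  Re (\sum_k x k * y k) ^+ 2 + Im (\sum_k x k * y k) ^+ 2 <=
  (\sum_k (Re (x k) ^+ 2 + Im (x k) ^+ 2)) *
  (\sum_k (Re (y k) ^+ 2 + Im (y k) ^+ 2)).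
  pose z := \sum_k x k * y k.
  pose A : 'rV[C]_q := \row_k (x k * z^*); pose B : 'rV[C]_q := \row_k ((y k)^*).
  have := rinner_CS2 A B; rewrite !rinnerE !big_ord1.
  have -> : \sum_j (Re (A 0 j) * Re (B 0 j) + Im (A 0 j) * Im (B 0 j)) =
     Re z ^+ 2 + Im z ^+ 2.
    transitivity (Re (\sum_j x j * y j * z^*)).
      rewrite Re_sum; apply: eq_bigr => j _; rewrite !mxE.
      by rewrite !Re_mul !Im_mul !Re_conj !Im_conj; ring.
    by rewrite -mulr_suml Re_mul Re_conj Im_conj; ring.
  have -> : \sum_j (Re (A 0 j) * Re (A 0 j) + Im (A 0 j) * Im (A 0 j)) =
     (\sum_k (Re (x k) ^+ 2 + Im (x k) ^+ 2)) * (Re z ^+ 2 + Im z ^+ 2).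
    rewrite mulr_suml; apply: eq_bigr => j _; rewrite !mxE.
    by rewrite !Re_mul !Im_mul !Re_conj !Im_conj; ring.
  have -> : \sum_j (Re (B 0 j) * Re (B 0 j) + Im (B 0 j) * Im (B 0 j)) =
     \sum_k (Re (y k) ^+ 2 + Im (y k) ^+ 2).
    apply: eq_bigr => j _; rewrite !mxE !Re_conj !Im_conj; ring.
  rewrite -/z; set w := Re z ^+ 2 + Im z ^+ 2.
  set a := \sum_k _; set b := \sum_k _ => h.
  have w0 : 0 <= w by rewrite addr_ge0 ?sqr_ge0.
  have [w0'|wn] := eqVneq w 0.
    rewrite w0' mulr_ge0// sumr_ge0// => k _; by rewrite addr_ge0 ?sqr_ge0.
  have wp : 0 < w by rewrite lt_def wn.
  by rewrite -(ler_pM2l wp) -expr2 mulrA (mulrC w a).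
rewrite rinnerE.
apply: (@le_trans _ _ (\sum_i \sum_j (\sum_k (Re (X i k) ^+ 2 + Im (X i k) ^+ 2)) *
  (\sum_k (Re (Y k j) ^+ 2 + Im (Y k j) ^+ 2)))).
  by apply: ler_sum => i _; apply: ler_sum => j _; rewrite -!expr2 !mxE cs.
rewrite !rinnerE [X in _ <= _ * X]exchange_big mulr_suml.
apply: ler_sum => i _; rewrite mulr_sumr; apply: ler_sum => j _.
by rewrite le_eqVlt; apply/orP; left; apply/eqP; congr (_ * _);
  apply: eq_bigr => k _; rewrite !expr2.
Qed.

End RealInner.

(** * Hermitian and positive semidefinite matrices *)

Section Psd.
Variable R : realType.
Local Notation C := R[i].
Local Notation Re := (@complex.Re R).
Local Notation Im := (@complex.Im R).

Lemma HermP n (A : 'M[C]_n) : Herm A <-> adj A = A.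
Proof.
rewrite /Herm /=; split.
  by move=> /is_hermitianmxP; rewrite expr0 scale1r /adj => <-.
by move=> h; apply/is_hermitianmxP; rewrite expr0 scale1r -[in LHS]h.
Qed.

Lemma Herm0 n : Herm (0 : 'M[C]_n). Proof. by apply/HermP; rewrite adj0. Qed.
Lemma HermD n (A B : 'M[C]_n) : Herm A -> Herm B -> Herm (A + B).
Proof. by move=> /HermP a /HermP b; apply/HermP; rewrite adjD a b. Qed.
Lemma HermN n (A : 'M[C]_n) : Herm A -> Herm (- A).
Proof. by move=> /HermP a; apply/HermP; rewrite adjN a. Qed.
Lemma HermB n (A B : 'M[C]_n) : Herm A -> Herm B -> Herm (A - B).
Proof. by move=> a b; exact: HermD a (HermN b). Qed.
Lemma HermZ n (a : R) (A : 'M[C]_n) : Herm A -> Herm (a%:C *: A).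
Proof. by move=> /HermP h; apply/HermP; rewrite adjZ h. Qed.
Lemma Herm_sum n (I : Type) (r : seq I) (P : pred I) (f : I -> 'M[C]_n) :
  (forall i, P i -> Herm (f i)) -> Herm (\sum_(i <- r | P i) f i).
Proof. by move=> h; elim/big_ind: _; [exact: Herm0|move=> A B; exact: HermD|exact: h]. Qed.
Lemma Herm_mul p n (A : 'M[C]_(p, n)) : Herm (adj A *m A).
Proof. by apply/HermP; rewrite adjM adjK. Qed.
Lemma adj1 n : adj (1%:M : 'M[C]_n) = 1%:M.
Proof. by rewrite /adj trmx1 map_mx1. Qed.
Lemma Herm1 n : Herm (1%:M : 'M[C]_n).
Proof. by have := Herm_mul (1%:M : 'M[C]_n); rewrite mulmx1 adj1. Qed.

Lemma mx11_inner p (v : 'cV[C]_p) (A : 'M[C]_p) :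
  (adj v *m A *m v) 0 0 = mxinner v (A *m v).
Proof. by rewrite mxinnerE /mxtrace big_ord1 mulmxA. Qed.

Lemma tr_adj p (X : 'M[C]_p) : \tr (adj X) = (\tr X)^*.
Proof. by rewrite /mxtrace rmorph_sum; apply: eq_bigr => i _; rewrite adjE. Qed.

Lemma mxinner_conj p q (X Y : 'M[C]_(p, q)) : (mxinner X Y)^* = mxinner Y X.
Proof. by rewrite !mxinnerE -tr_adj adjM adjK. Qed.

Lemma Herm_quad_real n (A : 'M[C]_n) (v : 'cV[C]_n) :
  Herm A -> Im (mxinner v (A *m v)) = 0.
Proof.
move=> /HermP h; have : (mxinner v (A *m v))^* = mxinner v (A *m v).
  by rewrite mxinner_conj !mxinnerE adjM h mulmxA.
by case: (mxinner _ _) => a b /= [] /eqP; rewrite eqNr => /eqP.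
Qed.

Lemma psdP n (A : 'M[C]_n) :
  Hpsd A <-> Herm A /\ forall v : 'cV[C]_n, 0 <= rinner v (A *m v).
Proof.
rewrite /Hpsd /=; split => -[h k]; split => // v; have := k v.
  by rewrite mx11_inner lecE => /andP[].
by rewrite mx11_inner lecE/= Herm_quad_real// eqxx.
Qed.

Lemma pdP n (A : 'M[C]_n) :
  Hpd A <-> Herm A /\ forall v : 'cV[C]_n, v != 0 -> 0 < rinner v (A *m v).
Proof.
rewrite /Hpd /=; split => -[h k]; split => // v v0; have := k v v0.
  by rewrite mx11_inner ltcE => /andP[].
by rewrite mx11_inner ltcE/= Herm_quad_real// eqxx.
Qed.

Lemma pd_psd n (A : 'M[C]_n) : Hpd A -> Hpsd A.
Proof.
move=> /pdP[h k]; apply/psdP; split => // v.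
by have [->|/k/ltW//] := eqVneq v 0; rewrite mulmx0 rinner0r.
Qed.

Lemma psd_herm n (A : 'M[C]_n) : Hpsd A -> Herm A. Proof. by case. Qed.

Lemma psd0 n : Hpsd (0 : 'M[C]_n).
Proof. by apply/psdP; split=> [|v]; rewrite ?mul0mx ?rinner0r//; exact: Herm0. Qed.

Lemma psdD n (A B : 'M[C]_n) : Hpsd A -> Hpsd B -> Hpsd (A + B).
Proof.
move=> /psdP[a a'] /psdP[b b']; apply/psdP; split; first exact: HermD.
by move=> v; rewrite mulmxDl rinnerDr addr_ge0.
Qed.

Lemma psdZ n (a : R) (A : 'M[C]_n) : 0 <= a -> Hpsd A -> Hpsd (a%:C *: A).
Proof.
move=> a0 /psdP[h k]; apply/psdP; split; first exact: HermZ.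
by move=> v; rewrite -scalemxAl rinnerZr mulr_ge0.
Qed.

Lemma psd_sum n (I : Type) (r : seq I) (P : pred I) (f : I -> 'M[C]_n) :
  (forall i, P i -> Hpsd (f i)) -> Hpsd (\sum_(i <- r | P i) f i).
Proof. by move=> h; elim/big_ind: _; [exact: psd0|move=> A B; exact: psdD|exact: h]. Qed.

Lemma psd_gram p n (B : 'M[C]_(p, n)) : Hpsd (adj B *m B).
Proof.
apply/psdP; split; first exact: Herm_mul.
by move=> v; rewrite -mulmxA -rinner_mull rinner_ge0.
Qed.

Lemma psd1 n : Hpsd (1%:M : 'M[C]_n).
Proof. by have := psd_gram (1%:M : 'M[C]_n); rewrite mulmx1 adj1. Qed.

(** By the spectral theorem, with the square roots of the eigenvalues.  This
    factorisation replaces the square root of P in all estimates below. *)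
Lemma psd_factor n (P : 'M[C]_n) : Hpsd P -> exists B : 'M[C]_n, P = adj B *m B.
Proof.
move=> Ppsd; have Ph := psd_herm Ppsd.
have /orthomx_spectralP := hermitian_normalmx Ph.
have uU := spectral_unitarymx P.
set U := spectralmx P in uU *; set d := spectral_diag P => PE.
rewrite (invmx_unitary uU) -/(adj U) in PE.
have UU : U *m adj U = 1%:M by apply/unitarymxP.
have d_ge0 i : 0 <= d 0 i.
  case: Ppsd => _ /(_ (col i (adj U))).
  suff -> : ((adj (col i (adj U))) *m P *m col i (adj U)) 0 0 = d 0 i by [].
  rewrite (_ : col i (adj U) = adj U *m delta_mx i 0); last by rewrite colE.
  rewrite adjM adjK PE -!mulmxA (mulmxA U (adj U)) UU mul1mx.
  rewrite (mulmxA U (adj U)) UU mul1mx.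
  rewrite {1}/adj trmx_delta map_delta_mx -rowE mxE -colE !mxE eqxx.
  by rewrite mulr1n.
exists (diag_mx (map_mx sqrtC d) *m U).
rewrite adjM PE -!mulmxA; congr (_ *m _); rewrite mulmxA; congr (_ *m _).
rewrite /adj tr_diag_mx map_diag_mx mulmx_diag; congr diag_mx.
have e (x : C) : 0 <= x -> (sqrtC x)^* * sqrtC x = x.
  move=> x0; transitivity (sqrtC x * sqrtC x); last by rewrite -expr2 sqrtCK.
  by congr (_ * _); apply/CrealP/ger0_real; rewrite sqrtC_ge0.
by apply/rowP => i; rewrite !mxE; apply/esym/e.
Qed.

Lemma psd_rinner_ge0 n (P Q : 'M[C]_n) : Hpsd P -> Hpsd Q -> 0 <= rinner P Q.
Proof.
move=> /psd_factor[B ->] /psd_factor[D ->].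
have -> : rinner (adj B *m B) (adj D *m D) = rinner (B *m adj D) (B *m adj D).
  by rewrite rinner_mull adjK mulmxA rinner_mulr adjK.
exact: rinner_ge0.
Qed.

(** The cone of positive semidefinite matrices is self-dual. *)
Lemma psd_of_rinner n (A : 'M[C]_n) : Herm A ->
  (forall P, Hpsd P -> 0 <= rinner A P) -> Hpsd A.
Proof.
move=> h k; apply/psdP; split=> // v.
have := k _ (psd_gram (adj v)); rewrite adjK.
have -> : rinner A (v *m adj v) = rinner v (A *m v) by rewrite rinnerC rinner_mulr adjK.
by [].
Qed.

(** The real part of the trace; on Hermitian matrices, the trace. *)
Definition rtr n (A : 'M[C]_n) : R := rinner 1%:M A.

Lemma rtrE n (A : 'M[C]_n) : rtr A = Re (\tr A).
Proof. by rewrite /rtr /rinner mxinnerE adj1 mul1mx. Qed.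

Lemma Herm_tr_real n (A : 'M[C]_n) : Herm A -> \tr A = (rtr A)%:C.
Proof.
move=> /HermP h; rewrite rtrE; apply: complex_eqP => //=.
have : (\tr A)^* = \tr A.
  by rewrite -tr_adj h.
by case: (\tr A) => a b /= [] /eqP; rewrite eqNr => /eqP.
Qed.

Lemma rtr_ge0 n (A : 'M[C]_n) : Hpsd A -> 0 <= rtr A.
Proof. exact/psd_rinner_ge0/psd1. Qed.

Lemma quad_gram p q n (b : 'M[C]_(p, n)) (B : 'M[C]_(q, n)) :
  rinner b (b *m (adj B *m B)) = rinner (b *m adj B) (b *m adj B).
Proof. by rewrite [in RHS]rinner_mulr adjK mulmxA. Qed.

Lemma rtr_gram q n (B : 'M[C]_(q, n)) : rtr (adj B *m B) = rinner B B.
Proof. by rewrite /rtr rinnerC rinner_mull adjK mulmx1. Qed.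

Lemma psd_quad_ge0 p n (b : 'M[C]_(p, n)) (rho : 'M[C]_n) :
  Hpsd rho -> 0 <= rinner b (b *m rho).
Proof.
by move=> /psd_factor[B ->]; rewrite quad_gram rinner_ge0.
Qed.

Lemma psd_quad_le p n (b : 'M[C]_(p, n)) (rho : 'M[C]_n) :
  Hpsd rho -> rinner b (b *m rho) <= rinner b b * rtr rho.
Proof.
move=> /psd_factor[B ->]; rewrite quad_gram (le_trans (rinner_mul_le _ _))//.
by rewrite rinner_adj rtr_gram.
Qed.

(** The eigenvalues being nonnegative, the sum of their squares is at most the
    square of their sum. *)
Lemma psd_norm_le n (rho : 'M[C]_n) : Hpsd rho -> rinner rho rho <= rtr rho ^+ 2.
Proof.
move=> /psd_factor[B ->]; rewrite (le_trans (rinner_mul_le _ _))//.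
by rewrite rinner_adj rtr_gram expr2.
Qed.

End Psd.

(** * Convergence of matrices *)

Section Convergence.
Variable R : realType.
Local Notation C := R[i].

Lemma cvg_bigsum (T I : Type) (G : set_system T) {FF : Filter G} (r : seq I)
    (P : pred I) (f : I -> T -> R) (a : I -> R) :
  (forall i, f i x @[x --> G] --> a i) ->
  \sum_(i <- r | P i) f i x @[x --> G] --> \sum_(i <- r | P i) a i.
Proof. by move=> h; apply: (cvg_big add_continuous) => i _; exact: h. Qed.

Lemma cvg_ge_lim (u : nat -> R) (l a : R) :
  u k @[k --> \oo] --> l -> (forall k, a <= u k) -> a <= l.
Proof.
move=> h ge; rewrite -(cvg_lim _ h)//; apply: limr_ge; last exact: nearW.
by apply/cvg_ex; exists l.
Qed.

Lemma limn_einf_le (u v : nat -> \bar R) :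
  (forall k, u k <= v k)%E -> (limn_einf u <= limn_einf v)%E.
Proof.
move=> uv; rewrite !limn_einf_lim; apply: lee_lim; try exact: is_cvg_einfs.
apply: nearW => k; apply: le_ereal_inf_tmp => _ [j kj <-].
by apply: le_trans (uv j); apply: ereal_inf_lbound; exists j.
Qed.

(** Convergence tested against all matrices: it reduces limits to limits of real
    sequences, and in finite dimension it is convergence in norm. *)
Definition mxcvg p q (u : nat -> 'M[C]_(p, q)) (X : 'M[C]_(p, q)) : Prop :=
  forall E, rinner E (u k) @[k --> \oo] --> rinner E X.

Lemma norm_cvg0_rinner p q (T : Type) (G : set_system T) {FF : Filter G}
    (f : T -> 'M[C]_(p, q)) (X E : 'M[C]_(p, q)) :
  mxnorm (f k - X) @[k --> G] --> (0 : R) -> rinner E (f k) @[k --> G] --> rinner E X.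
Proof.
move=> h; apply/cvgrPdist_le => e e0.
have E1 : 0 < mxnorm E + 1 by rewrite ltr_wpDl ?norm_ge0.
have e1 : 0 < e / (mxnorm E + 1) by rewrite divr_gt0.
move/cvgr0_norm_le : h => /(_ _ e1); apply: filterS => k.
rewrite ger0_norm ?norm_ge0// ler_pdivlMr// => hk.
rewrite -rinnerBr (le_trans (rinner_CS _ _))// -opprB.
have -> : mxnorm (- (f k - X)) = mxnorm (f k - X).
  by rewrite /mxnorm rinnerNl rinnerNr opprK.
by rewrite (le_trans _ hk)// mulrC ler_wpM2l ?norm_ge0// lerDl.
Qed.

Lemma rinner_cvg_norm0 p q (T : Type) (G : set_system T) {FF : Filter G}
    (f : T -> 'M[C]_(p, q)) (X : 'M[C]_(p, q)) :
  (forall E, rinner E (f k) @[k --> G] --> rinner E X) ->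
  mxnorm (f k - X) @[k --> G] --> (0 : R).
Proof.
move=> h.
have -> : (fun k => mxnorm (f k - X)) = fun k => Num.sqrt
   (\sum_(c : bool * 'I_p * 'I_q) (rinner (unitv R c.1.1 c.1.2 c.2) (f k) -
         rinner (unitv R c.1.1 c.1.2 c.2) X) ^+ 2).
  apply/funext => k; rewrite /mxnorm rinner_coord; congr Num.sqrt.
  by apply: eq_bigr => c _; rewrite rinnerC -expr2 rinnerBr.
rewrite [X in _ --> X](_ : 0 = Num.sqrt (\sum_(c : bool * 'I_p * 'I_q) 0)).
  2: by rewrite big1// sqrtr0.
apply: (@continuous_cvg _ _ _ G); first exact: sqrt_continuous.
apply: cvg_bigsum => c.
rewrite [X in _ --> X](_ : 0 = (rinner (unitv R c.1.1 c.1.2 c.2) X -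
   rinner (unitv R c.1.1 c.1.2 c.2) X) ^+ 2); last by rewrite subrr expr0n.
by apply: (continuous_cvg _ (@exprn_continuous _ 2 _)); apply: cvgB; [exact: h|exact: cvg_cst].
Qed.

Lemma mxcvg_psd n (u : nat -> 'M[C]_n) (X : 'M[C]_n) :
  mxcvg u X -> (forall k, Hpsd (u k)) -> Hpsd X.
Proof.
move=> uX pu; have hX : Herm X.
  apply/HermP/rinner_nondeg => E.
  rewrite -(adjK E) rinner_adj; have cE := uX (adj E).
  have cE' : rinner (adj E) (u k) @[k --> \oo] --> rinner E X.
    have -> : (fun k => rinner (adj E) (u k)) = fun k => rinner E (u k).
      apply/funext => k; have /HermP <- := psd_herm (pu k).
      by rewrite rinner_adj; have /HermP -> := psd_herm (pu k).
    exact: uX.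
  by rewrite adjK; exact: (cvg_unique _ cE cE').
apply: (psd_of_rinner hX) => P Pp.
by rewrite rinnerC; apply: (cvg_ge_lim (uX P)) => k; exact: psd_rinner_ge0 Pp (pu k).
Qed.

End Convergence.

(** * The kinetic energy and its Fenchel form *)

Section Energy.
Variables (R : realType) (n N : nat).
Local Notation C := R[i].
Implicit Types (rho : 'M[C]_n) (m b q : blockcol R n N) (e : R).

(** This is F(rho, m) <= e for rho positive semidefinite: the Fenchel form of
    the kinetic energy.  It is jointly convex and closed in (rho, m, e), which
    is why approximate solutions carry a bound e and not the value of F. *)
Definition energy_bound rho m e : Prop :=
  forall b, rinner b m - 2^-1 * rinner b (b *m rho) <= e.

Lemma pd_unit rho : Hpd rho -> rho \in unitmx.
Proof.
move=> /pdP[h p]; rewrite -row_free_unit; apply/inj_row_free => v v0.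
apply/eqP; apply/negP => /negP vn.
have w0 : adj v != 0.
  by apply: contra vn => /eqP w; rewrite -(adjK v) w adj0.
have := p _ w0; have /HermP {1}<- := h.
by rewrite -adjM v0 adj0 rinner0r ltxx.
Qed.

(** The supremum over b is attained at b = m rho^-1. *)
Lemma energy_bound_kinetic rho m e :
  Hpd rho -> energy_bound rho m e -> kinetic rho m <= e.
Proof.
move=> /pd_unit u /(_ (m *m invmx rho)); rewrite mulmxKV//.
by rewrite /kinetic (rinnerC m); move: (rinner _ _) => x; lra.
Qed.

(** For a momentum of the form q rho the energy is explicit even when rho is
    singular: the difference of the two sides is 1/2 <q - b, (q - b) rho>. *)
Lemma energy_bound_mul rho q :
  Hpsd rho -> energy_bound rho (q *m rho) (2^-1 * rinner q (q *m rho)).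
Proof.
move=> p b; have := psd_quad_ge0 (q - b) p.
rewrite mulmxBl rinnerBl !rinnerBr.
have -> : rinner q (b *m rho) = rinner b (q *m rho).
  have /HermP h := psd_herm p.
  by rewrite [in RHS]rinnerC rinner_mulr h.
move: (rinner q (q *m rho)) (rinner b (q *m rho)) (rinner b (b *m rho)) => x y z; lra.
Qed.

Lemma kinetic_energy_bound rho m : Hpd rho -> energy_bound rho m (kinetic rho m).
Proof.
move=> h; have := energy_bound_mul (m *m invmx rho) (pd_psd h).
by rewrite mulmxKV ?pd_unit// (rinnerC _ m).
Qed.

(** Adding a multiple of the identity makes rho invertible without increasing
    the energy; this regularises singular matrices in [F_le_liminf]. *)
Lemma energy_bound_pert rho m e (t : R) :
  0 <= t -> energy_bound rho m e -> energy_bound (rho + t%:C *: 1%:M) m e.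
Proof.
move=> t0 h b; apply: le_trans (h b).
rewrite mulmxDr -scalemxAr mulmx1 rinnerDr rinnerZr.
by rewrite lerD2l lerN2 ler_pM2l ?invr_gt0// lerDl mulr_ge0// rinner_ge0.
Qed.

Lemma psd_pert_pd rho (t : R) : 0 < t -> Hpsd rho -> Hpd (rho + t%:C *: 1%:M).
Proof.
move=> t0 /psdP[h p]; apply/pdP; split.
  exact: HermD h (HermZ t (Herm1 R n)).
move=> v v0; rewrite mulmxDl rinnerDr -scalemxAl mul1mx rinnerZr.
rewrite ltr_wpDl// mulr_gt0// lt_def rinner_ge0 andbT.
by apply: contra v0 => /eqP/rinner_eq0 ->.
Qed.

Lemma energy_boundD (rho rho' : 'M[C]_n) m m' (e e' : R) :
  energy_bound rho m e -> energy_bound rho' m' e' ->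
  energy_bound (rho + rho') (m + m') (e + e').
Proof.
move=> h h' b; have := h b; have := h' b.
rewrite mulmxDr !rinnerDr; lra.
Qed.

Lemma energy_boundZ rho m e (a : R) : 0 <= a ->
  energy_bound rho m e -> energy_bound (a%:C *: rho) (a%:C *: m) (a * e).
Proof.
move=> a0 h b; rewrite -scalemxAr !rinnerZr; have := ler_wpM2l a0 (h b); lra.
Qed.

Lemma energy_bound_ge0 rho m e : energy_bound rho m e -> 0 <= e.
Proof. by move=> /(_ 0); rewrite mul0mx !rinner0l mulr0 subr0. Qed.

(** The choice b = m. *)
Lemma energy_bound_norm rho m e : Hpsd rho -> energy_bound rho m e ->
  (1 - 2^-1 * rtr rho) * rinner m m <= e.
Proof.
move=> p /(_ m); apply: le_trans; have := psd_quad_le m p; lra.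
Qed.

Lemma energy_bound_abs rho m e b : Hpsd rho -> energy_bound rho m e ->
  `|rinner b m| <= e + 2^-1 * (rinner b b * rtr rho).
Proof.
move=> p h; have q := psd_quad_le b p.
rewrite ler_norml; apply/andP; split; last by have := h b; lra.
by have := h (- b); rewrite mulNmx rinnerNl rinnerNl rinnerNr opprK; lra.
Qed.

(** On singular matrices F is a lower semicontinuous envelope, and the left
    side, which is continuous in (rho, m), survives the passage to it. *)
Lemma F_ge rho m b : Hpsd rho ->
  ((rinner b m - 2^-1 * rinner b (b *m rho))%:E <= F rho m)%E.
Proof.
move=> p; rewrite /F; case: asboolP => [hpd|_].
  by rewrite lee_fin; exact: kinetic_energy_bound.
case: asboolP => // _; apply: le_ereal_inf_tmp => x [r_ [m_ [pr cr cm ->]]].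
set l := (X in X%:E); set u := (X in limn_einf X).
have cl : (rinner b (m_ k) - 2^-1 * rinner b (b *m r_ k)) @[k --> \oo] --> l.
  apply: cvgB; first exact: norm_cvg0_rinner.
  apply: cvgM; first exact: cvg_cst.
  have -> : (fun k => rinner b (b *m r_ k)) = fun k => rinner (adj b *m b) (r_ k).
    by apply/funext => k; rewrite rinner_mull adjK.
  rewrite [X in _ --> X](_ : _ = rinner (adj b *m b) rho).
    exact: norm_cvg0_rinner.
  by rewrite rinner_mull adjK.
pose v k := (rinner b (m_ k) - 2^-1 * rinner b (b *m r_ k))%:E.
have cv : v k @[k --> \oo] --> l%:E by apply: cvg_EFin => //; exact: nearW.
have <- : limn_einf v = l%:E by have [] := cvg_limn_einf_sup cv.
by apply: limn_einf_le => k; rewrite lee_fin; exact: kinetic_energy_bound.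
Qed.

Lemma F_ge0 rho m : (0 <= F rho m)%E.
Proof.
have [p|np] := pselect (Hpsd rho).
  by have := F_ge m 0 p; rewrite mul0mx !rinner0l mulr0 subr0.
rewrite /F; case: asboolP => [/pd_psd//|_].
by case: asboolP.
Qed.

(** Lower semicontinuity.  For singular rho, the definition of F asks for
    positive definite matrices near rho: perturb the given sequence by 1/(k+1)
    times the identity. *)
Lemma F_le_liminf (r_ : nat -> 'M[C]_n) (m_ : nat -> blockcol R n N)
    (e_ : nat -> R) rho m :
  (forall k, Hpsd (r_ k)) -> (forall k, energy_bound (r_ k) (m_ k) (e_ k)) ->
  mxcvg r_ rho -> mxcvg m_ m ->
  (F rho m <= limn_einf (fun k => (e_ k)%:E))%E.
Proof.
move=> pr he cr cm.
pose t k : R := k.+1%:R^-1.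
have t0 k : 0 < t k by rewrite invr_gt0.
have lb b : ((rinner b m - 2^-1 * rinner b (b *m rho))%:E <=
    limn_einf (fun k => (e_ k)%:E))%E.
  set l := (X in X%:E).
  pose v k := (rinner b (m_ k) - 2^-1 * rinner b (b *m r_ k))%:E.
  have cv : v k @[k --> \oo] --> l%:E.
    apply: cvg_EFin; first exact: nearW.
    apply: cvgB; first exact: cm.
    apply: cvgM; first exact: cvg_cst.
    have -> : (fun k => rinner b (b *m r_ k)) = fun k => rinner (adj b *m b) (r_ k).
      by apply/funext => k; rewrite rinner_mull adjK.
    rewrite [X in _ --> X](_ : _ = rinner (adj b *m b) rho); first exact: cr.
    by rewrite rinner_mull adjK.
  have <- : limn_einf v = l%:E by have [] := cvg_limn_einf_sup cv.
  by apply: limn_einf_le => k; rewrite lee_fin; exact: he.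
rewrite /F; case: asboolP => [hpd|_].
  rewrite /kinetic; have := lb (m *m invmx rho).
  rewrite mulmxKV ?pd_unit// (rinnerC _ m); congr (_%:E <= _)%E; lra.
case: asboolP => [p|np]; last by exfalso; apply: np; exact: mxcvg_psd pr.
apply: (@le_trans _ _ (limn_einf (fun k => (kinetic (r_ k + (t k)%:C *: 1%:M) (m_ k))%:E))).
  apply: ereal_inf_lbound; exists (fun k => r_ k + (t k)%:C *: 1%:M), m_; split => //.
  - by move=> k; exact: psd_pert_pd (t0 k) (pr k).
  - apply: rinner_cvg_norm0 => E.
    have -> : (fun k => rinner E (r_ k + (t k)%:C *: 1%:M)) =
       (fun k => rinner E (r_ k) + t k * rinner E 1%:M).
      by apply/funext => k; rewrite rinnerDr rinnerZr.
    rewrite -[X in _ --> X]addr0; apply: cvgD; first exact: cr.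
    rewrite -[X in _ --> X](mul0r (rinner E 1%:M)).
    by apply: cvgM; [exact: cvg_harmonic|exact: cvg_cst].
  - exact: rinner_cvg_norm0.
apply: limn_einf_le => k; rewrite lee_fin.
exact: energy_bound_kinetic (psd_pert_pd (t0 k) (pr k)) (energy_bound_pert (ltW (t0 k)) (he k)).
Qed.

End Energy.

(** * The commutator gradient and the flux *)

Section Nabla.
Variables (R : realType) (n N : nat).
Local Notation C := R[i].
Variable L : 'I_N -> 'M[C]_n.
Hypothesis hL : forall k, Herm (L k).
Implicit Types (X Y E Z : 'M[C]_n) (m : blockcol R n N).

Lemma adj_mxcol (A : 'I_N -> 'M[C]_n) :
  adj (\mxcol_k A k) = \mxrow_k adj (A k).
Proof. by apply/matrixP => i j; rewrite adjE !mxE. Qed.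

Lemma submxcolZ (a : C) (m : blockcol R n N) k :
  submxcol (a *: m) k = a *: submxcol m k.
Proof. by apply/matrixP => i j; rewrite !mxE. Qed.

Lemma rinner_blocks (m m' : blockcol R n N) :
  rinner m m' = \sum_k rinner (submxcol m k) (submxcol m' k).
Proof.
rewrite -{1}(submxcolK m) -{1}(submxcolK m') /rinner mxinnerE.
rewrite adj_mxcol mul_mxrow_mxcol -Re_sum; congr complex.Re.
exact: (big_morph _ (@mxtraceD _ _) (@mxtrace0 _ _)).
Qed.

Lemma nabla_is_additive X Y : nabla L (X + Y) = nabla L X + nabla L Y.
Proof.
apply/mxcolP => k; rewrite submxcolD !mxcolK.
by rewrite mulmxDr mulmxDl opprD addrACA.
Qed.

Lemma nabla_is_scalable (a : C) X : nabla L (a *: X) = a *: nabla L X.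
Proof.
apply/mxcolP => k; rewrite submxcolZ !mxcolK.
by rewrite -scalemxAr -scalemxAl scalerBr.
Qed.

Lemma nabla_is_linear : linear (nabla L).
Proof. by move=> a X Y; rewrite nabla_is_additive nabla_is_scalable. Qed.

HB.instance Definition _ := GRing.isLinear.Build C 'M[C]_n (blockcol R n N) _
  (nabla L) nabla_is_linear.

Lemma nabla1 : nabla L 1%:M = 0.
Proof. by apply/mxcolP => k; rewrite mxcolK mulmx1 mul1mx subrr submxcol0. Qed.

Lemma nabla_adj X : nabla L X = 0 -> nabla L (adj X) = 0.
Proof.
move=> h; apply/mxcolP => k; rewrite mxcolK submxcol0.
have /(congr1 (fun m => adj (submxcol m k))) := h.
rewrite mxcolK submxcol0 adj0 adjB !adjM; have /HermP -> := hL k.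
by move=> /(congr1 -%R); rewrite opprB oppr0.
Qed.

(** The right-hand side of the constraint.  It is the Hermitian part of
    [nablaD L m] ([fluxE]), so that on Hermitian matrices it is the adjoint of
    [nabla L]. *)
Definition flux m : 'M[C]_n := 2^-1 *: nablaD L (m - blockstar m).

Lemma flux_def m : flux m = 2^-1 *: nablaD L (m - blockstar m).
Proof. by []. Qed.

Lemma rinner_nabla X m : rinner (nabla L X) m = rinner X (nablaD L m).
Proof.
rewrite rinner_blocks rinner_sumr; apply: eq_bigr => k _.
rewrite mxcolK rinnerBl rinner_mull rinner_mulr rinnerBr.
by have /HermP -> := hL k.
Qed.

Lemma half_complex : (2^-1 : C) = (2^-1 : R)%:C.
Proof. by rewrite fmorphV /= rmorph_nat. Qed.

(** The orthogonal projection onto the Hermitian matrices. *)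
Definition hpart p (X : 'M[C]_p) : 'M[C]_p := (2^-1 : R)%:C *: (X + adj X).

Lemma hpart_herm p (X : 'M[C]_p) : Herm (hpart X).
Proof. by apply/HermP; rewrite adjZ adjD adjK addrC. Qed.

Lemma rinner_hpart p (X Y : 'M[C]_p) : Herm Y -> rinner (hpart X) Y = rinner X Y.
Proof.
move=> /HermP h; rewrite rinnerZl rinnerDl -{2}h rinner_adj; lra.
Qed.

Lemma fluxE m : flux m = hpart (nablaD L m).
Proof.
rewrite /flux /hpart half_complex; congr (_ *: _).
rewrite adj_sum -big_split; apply: eq_bigr => k _ /=.
rewrite submxcolB mxcolK adjB !adjM; have /HermP -> := hL k.
rewrite mulmxBr mulmxBl opprB -/(adj _).
set a := _ *m _; set b := _ *m _; set c := _ *m _; set d := _ *m _.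
by rewrite (addrC c) addrACA (addrC (- b)).
Qed.

(** The projection [hpart] allows arbitrary test matrices E. *)
Lemma rinner_flux E m : rinner E (flux m) = rinner (nabla L (hpart E)) m.
Proof.
rewrite rinner_nabla fluxE; set D := nablaD L m.
rewrite -(rinner_hpart E (hpart_herm D)) rinnerC.
by rewrite (rinner_hpart D (hpart_herm E)) rinnerC.
Qed.

Lemma rinner_flux_herm E m : Herm E -> rinner (nabla L E) m = rinner E (flux m).
Proof. by move=> h; rewrite rinner_nabla fluxE [RHS]rinnerC rinner_hpart// rinnerC. Qed.

Lemma mxinner_mxvec p q (X Y : 'M[C]_(p, q)) :
  mxinner X Y = (mxvec Y *m adj (mxvec X)) 0 0.
Proof.
rewrite mxE (reindex _ (curry_mxvec_bij p q)) /=.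
transitivity (\sum_(ij : 'I_p * 'I_q) (X ij.1 ij.2)^* * Y ij.1 ij.2); last first.
  by apply: eq_bigr => -[i j] _; rewrite adjE !mxvecE mulrC.
rewrite -(pair_bigA _ (fun i j => (X i j)^* * Y i j)) /= exchange_big /=.
by apply: eq_bigr => j _; rewrite mxE; apply: eq_bigr => i _; rewrite adjE.
Qed.

(** The orthogonal complement of the kernel is the range of the adjoint.  The
    proof represents nabla by a matrix acting on row vectors and uses the
    duality between its kernel and the row space of its conjugate transpose. *)
Lemma ker_perp_range Z : ker_nabla_perp L Z -> exists m, flux m = Z.
Proof.
move=> [Zh Zp].
have kerC X : nabla L X = 0 -> mxinner X Z = 0.
  move=> X0.
  have re0 X' : nabla L X' = 0 -> rinner X' Z = 0.
    move=> X'0; rewrite -rinner_hpart// /rinner (Zp (hpart X'))//.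
    split; first exact: hpart_herm.
    by rewrite linearZ linearD /= X'0 nabla_adj// addr0 scaler0.
  apply: complex_eqP; first exact: re0.
  have := re0 ('i *: X); rewrite linearZ /= X0 scaler0 => /(_ erefl).
  rewrite /rinner !mxinnerE.
  have -> : adj ('i *: X) = - 'i *: adj X.
    apply/matrixP => i j; rewrite !mxE rmorphM; congr (_ * _).
    by apply: complex_eqP; rewrite /= ?oppr0.
  rewrite -scalemxAl mxtraceZ Re_mul /= oppr0 mul0r sub0r mulN1r opprK.
  by [].
pose M := lin_mx (nabla L).
have ME X : mxvec X *m M = mxvec (nabla L X) by rewrite mul_vec_lin.
have zk : mxvec Z *m adj (kermx M) = 0.
  apply/matrixP => a b; rewrite ord1 mxE [RHS]mxE.
  have xk : nabla L (vec_mx (row b (kermx M))) = 0.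
    by rewrite -[LHS]mxvecK -ME vec_mxK -row_mul mulmx_ker row0 linear0.
  have := kerC _ xk; rewrite mxinner_mxvec vec_mxK => xz; apply: etrans xz; rewrite [RHS]mxE.
  by apply: eq_bigr => k _; rewrite !adjE [in RHS]mxE.
have : (mxvec Z <= adj M)%MS.
  rewrite submxE.
  have : adj (cokermx (adj M)) *m M = 0.
    by rewrite -{2}(adjK M) -adjM mulmx_coker adj0.
  move=> /sub_kermxP/submxP[D DE].
  by rewrite -(adjK (cokermx _)) DE adjM mulmxA zk mul0mx.
move=> /submxP[y yE].
exists (vec_mx y); apply: rinner_nondeg => E.
rewrite rinner_flux -[RHS]rinner_hpart// /rinner !mxinner_mxvec.
by rewrite vec_mxK yE -mulmxA -adjM ME.
Qed.

Definition gram X : 'M[C]_n := adj (nabla L X) *m nabla L X.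

Lemma gram_herm X : Herm (gram X). Proof. exact: Herm_mul. Qed.

Lemma gramZ (a : R) X : gram (a%:C *: X) = (a ^+ 2)%:C *: gram X.
Proof.
by rewrite /gram linearZ adjZ -scalemxAl -scalemxAr scalerA -rmorphM.
Qed.

Lemma gramD X Y : gram (X + Y) = gram X + gram Y +
  (adj (nabla L X) *m nabla L Y + adj (nabla L Y) *m nabla L X).
Proof.
rewrite /gram nabla_is_additive; move: (nabla L X) (nabla L Y) => u v.
rewrite adjD mulmxDl !mulmxDr.
by rewrite (addrC (adj v *m u)) addrACA.
Qed.

(** Convexity of X |-> |nabla X|^2 in the order of Hermitian matrices: the
    defect is s (1 - s) times the Gram matrix of nabla (X - Y). *)
Lemma gram_convex (s : R) X Y : 0 <= s <= 1 ->
  Hpsd ((1 - s)%:C *: gram X + s%:C *: gram Y -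
        gram ((1 - s)%:C *: X + s%:C *: Y)).
Proof.
move=> /andP[s0 s1].
suff -> : (1 - s)%:C *: gram X + s%:C *: gram Y -
        gram ((1 - s)%:C *: X + s%:C *: Y) =
   (s * (1 - s))%:C *: gram (X - Y).
  by apply: psdZ; rewrite ?mulr_ge0 ?subr_ge0//; exact: psd_gram.
apply: rinner_nondeg => E.
have nB : nabla L (X - Y) = nabla L X - nabla L Y by rewrite linearB.
have nZ (a : R) Z : nabla L (a%:C *: Z) = a%:C *: nabla L Z by rewrite linearZ.
rewrite /gram nB nabla_is_additive !nZ; move: (nabla L X) (nabla L Y) => u v.
rewrite !(adjD, adjN, adjZ) !(mulmxDl, mulmxDr).
rewrite -!scalemxAl -!scalemxAr !mulNmx !mulmxN.
move: (adj u *m u) (adj v *m v) (adj u *m v) (adj v *m u) => a b c d.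
rewrite !(rinnerDr, rinnerNr, rinnerZr).
move: (rinner E a) (rinner E b) (rinner E c) (rinner E d) => ea eb ec ed; ring.
Qed.

Lemma gram_rinner X (P : 'M[C]_n) :
  rinner P (gram X) = rinner (nabla L X) (nabla L X *m P).
Proof. by rewrite /gram rinnerC rinner_mull adjK. Qed.

(** A commutator with L k is bounded by twice the norm of L k. *)
Lemma nabla_bound : exists2 B : R, 0 <= B &
  forall X, rinner (nabla L X) (nabla L X) <= B * rinner X X.
Proof.
exists (\sum_k 4 * rinner (L k) (L k)).
  by apply: sumr_ge0 => k _; rewrite mulr_ge0 ?rinner_ge0.
move=> X; rewrite rinner_blocks mulr_suml; apply: ler_sum => k _.
rewrite /nabla mxcolK.
have := rinner_mul_le (L k) X; have := rinner_mul_le X (L k).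
move: (L k *m X) (X *m L k) => a b.
have := rinner_ge0 (a + b); rewrite !(rinnerDr, rinnerDl, rinnerNr, rinnerNl).
rewrite (rinnerC b a); move: (rinner a a) (rinner a b) (rinner b b) => x y z.
by move: (rinner X X) (rinner (L k) (L k)) => p q h1 h2 h3; rewrite (mulrC p) in h2; rewrite -mulrA; lra.
Qed.

Lemma hpart_norm (E : 'M[C]_n) : rinner (hpart E) (hpart E) <= rinner E E.
Proof.
have := rinner_le E (hpart E).
have := rinner_hpart E (hpart_herm E).
move: (rinner E E) (rinner E (hpart E)) (rinner (hpart E) (hpart E)) => a b c; lra.
Qed.

End Nabla.

Global Opaque flux nabla nablaD.

(** * Minimisation over nested convex sets *)

Section NestedMin.
Variable R : realType.

(** The common core of both existence proofs.  In decreasing sets that are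
    stable under midpoints, points that almost minimise q in sets of large
    index are close to one another by the parallelogram inequality, since the
    infimum over a later set is close to the limit of the infima.  The
    distances between consecutive points can be prescribed. *)
Lemma nested_min (T : Type) (Cs : nat -> set T) (mid : T -> T -> T) (q : T -> R)
    (d : T -> T -> R) (M : R) (r : nat -> R) :
  (forall k x, Cs k.+1 x -> Cs k x) ->
  (forall k x y, Cs k x -> Cs k y -> Cs k (mid x y)) ->
  (forall x y, Cs 0 x -> Cs 0 y ->
     q (mid x y) + 4^-1 * d x y <= 2^-1 * (q x + q y)) ->
  (forall x, Cs 0 x -> - M <= q x) ->
  (forall k, exists2 x, Cs k x & q x <= M) ->
  (forall k, 0 < r k) -> (forall k, r k.+1 <= r k) ->
  exists y : nat -> T,
    [/\ forall k, Cs k (y k), forall k, d (y k) (y k.+1) <= r k &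
        forall k z, (forall j, Cs j z) -> q (y k) <= q z + r k].
Proof.
move=> sub cmid qmid lb ub r0 rdec.
have subn j k : (j <= k)%N -> forall x, Cs k x -> Cs j x.
  move=> /subnK <-; elim: (k - j)%N => [//|i IH] x; rewrite addSn => /sub; exact: IH.
pose A k := [set q x | x in Cs k].
have hi k : has_inf (A k).
  split; first by have [x Cx _] := ub k; exists (q x), x.
  by exists (- M) => _ [x Cx <-]; apply/lb/(subn 0 k).
pose c k := inf (A k).
have c_le k x : Cs k x -> c k <= q x.
  by move=> Cx; apply: inf_lbound; [have [] := hi k|exists x].
have c_ge k x : (forall y, Cs k y -> x <= q y) -> x <= c k.
  by move=> h; apply: lb_le_inf; [have [] := hi k|move=> _ [y Cy <-]; exact: h].
have cM k : c k <= M by have [x Cx] := ub k; apply: le_trans; exact: c_le.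
have cmono j k : (j <= k)%N -> c j <= c k.
  by move=> jk; apply: c_ge => y Cy; apply/c_le/(subn j k).
pose S := [set c k | k in setT].
have hs : has_sup S.
  by split; [exists (c 0), 0|exists M => _ [k _ <-]].
pose cc := sup S.
have c_cc k : c k <= cc by apply: sup_upper_bound => //; exists k.
(* A point of a set so late in the sequence that its infimum is within r k / 8
   of the limit cc, and almost minimal there. *)
have pick k : exists py : nat * T, [/\ (k <= py.1)%N, cc - r k / 8 <= c py.1,
    Cs py.1 py.2 & q py.2 <= cc + r k / 8].
  have e0 : 0 < r k / 8 by rewrite divr_gt0.
  have [_ [p0 _ <-] hp0] := sup_adherent e0 hs.
  pose p := maxn k p0.
  have [_ [y Cy <-] hy] := inf_adherent e0 (hi p).
  exists (p, y); split => //=; first exact: leq_maxl.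
    by apply: (le_trans (ltW hp0)); apply: cmono; exact: leq_maxr.
  by apply: (le_trans (ltW hy)); rewrite lerD2r c_cc.
have [py hpy] := choice pick.
exists (fun k => (py k).2); split.
- by move=> k; have [kp _ Cy _] := hpy k; exact: subn kp _ Cy.
- move=> k; have [_ a1 C1 b1] := hpy k; have [_ a2 C2 b2] := hpy k.+1.
  set x := (py k).2 in C1 b1 *; set y := (py k.+1).2 in C2 b2 *.
  pose p := minn (py k).1 (py k.+1).1.
  have Cm : Cs p (mid x y).
    by apply: cmid; [apply: subn C1; exact: geq_minl|apply: subn C2; exact: geq_minr].
  have cp : cc - r k / 8 <= c p.
    rewrite /p /minn; case: ifP => // _; apply: le_trans a2.
    by rewrite lerB// ler_pM2r// rdec.
  have := c_le _ _ Cm; have := qmid x y (subn 0 _ (leq0n _) _ C1) (subn 0 _ (leq0n _) _ C2).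
  have := rdec k; lra.
- move=> k z Cz; have [_ _ _ b1] := hpy k; apply: (le_trans b1).
  have : cc <= q z.
    by apply: ge_sup; [case: hs|move=> _ [j _ <-]; exact: c_le].
  have := r0 k; lra.
Qed.

Lemma fast_cauchy_cvg (u : nat -> R) (a : R) :
  (forall k, `|u k - u k.+1| <= a * 2^-1 ^+ k) -> cvgn u.
Proof.
move=> h; have -> : u = fun k => u 0%N + series (fun k => u k.+1 - u k) k.
  by apply/funext => k; rewrite /series /= telescope_sumr// addrC subrK.
apply: is_cvgD; first exact: is_cvg_cst.
apply: normed_cvg; apply: (@series_le_cvg _ _ (fun k => a * 2^-1 ^+ k)).
- by move=> k /=.
- by move=> k; exact: le_trans (normr_ge0 _) (h k).
- by move=> k /=; rewrite distrC.
- by apply: is_cvg_geometric_series; rewrite ger0_norm// invf_lt1// ltr1n.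
Qed.

(** First variation: a nonnegative quadratic polynomial that vanishes at 0 has
    a nonnegative derivative there. *)
Lemma linear_part_ge0 (G Q : R) :
  (forall t, 0 < t <= 1 -> 0 <= G + t * Q) -> 0 <= G.
Proof.
move=> h; rewrite leNgt; apply/negP => G0.
have h1 := h 1; rewrite mul1r ltr01 lexx in h1.
have Q0 : 0 < Q by have := h1 isT; lra.
have t1 : 0 < - G / (2 * Q) <= 1.
  rewrite divr_gt0 ?oppr_gt0 ?mulr_gt0//= ler_pdivrMr ?mulr_gt0//.
  have := h1 isT; lra.
have := h _ t1.
have -> : - G / (2 * Q) * Q = - G / 2 by field; rewrite gt_eqF.
lra.
Qed.

End NestedMin.

Section MxLimits.
Variable R : realType.
Local Notation C := R[i].

Lemma mxcvg_exists p q (u : nat -> 'M[C]_(p, q)) :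
  (forall b i j, cvgn (fun k => rinner (unitv R b i j) (u k))) -> exists X, mxcvg u X.
Proof.
move=> h; pose e (c : bool * 'I_p * 'I_q) := unitv R c.1.1 c.1.2 c.2.
exists (\sum_c (lim (rinner (e c) (u k) @[k --> \oo]))%:C *: e c) => E.
rewrite rinner_sumr; under eq_bigr do rewrite rinnerZr.
have -> : (fun k => rinner E (u k)) =
    fun k => \sum_c rinner (e c) (u k) * rinner E (e c).
  by apply/funext => k; rewrite rinner_coord; apply: eq_bigr => c _; rewrite mulrC.
by apply: cvg_bigsum => c; apply: cvgM; [exact: h|exact: cvg_cst].
Qed.

(** The bilinearity of the product in coordinates, which makes its continuity a
    statement about finite sums of products of real sequences. *)
Lemma rinner_mul p q r (E : 'M[C]_(p, r)) (X : 'M[C]_(p, q)) (Y : 'M[C]_(q, r)) :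
  rinner E (X *m Y) = \sum_(c : bool * 'I_q * 'I_r)
    rinner (E *m adj (unitv R c.1.1 c.1.2 c.2)) X *
    rinner (unitv R c.1.1 c.1.2 c.2) Y.
Proof.
have -> : rinner E (X *m Y) = rinner (adj X *m E) Y by rewrite rinner_mull adjK.
rewrite rinner_coord; apply: eq_bigr => c _.
by rewrite rinner_mull adjK rinner_mulr adjK.
Qed.

Lemma mxcvgM p q r (u : nat -> 'M[C]_(p, q)) (v : nat -> 'M[C]_(q, r)) X Y :
  mxcvg u X -> mxcvg v Y -> mxcvg (fun k => u k *m v k) (X *m Y).
Proof.
move=> uX vY E; rewrite rinner_mul.
have -> : (fun k => rinner E (u k *m v k)) = fun k => \sum_(c : bool * 'I_q * 'I_r)
    rinner (E *m adj (unitv R c.1.1 c.1.2 c.2)) (u k) *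
    rinner (unitv R c.1.1 c.1.2 c.2) (v k).
  by apply/funext => k; rewrite rinner_mul.
by apply: cvg_bigsum => c; apply: cvgM.
Qed.

Lemma mxcvgD p q (u v : nat -> 'M[C]_(p, q)) X Y :
  mxcvg u X -> mxcvg v Y -> mxcvg (fun k => u k + v k) (X + Y).
Proof.
move=> uX vY E; rewrite rinnerDr; under eq_fun do rewrite rinnerDr.
by apply: cvgD.
Qed.

Lemma mxcvgZ p q (a : R) (u : nat -> 'M[C]_(p, q)) X :
  mxcvg u X -> mxcvg (fun k => a%:C *: u k) (a%:C *: X).
Proof.
move=> uX E; rewrite rinnerZr; under eq_fun do rewrite rinnerZr.
by apply: cvgM => //; exact: cvg_cst.
Qed.

Lemma mxcvg_adj p q (u : nat -> 'M[C]_(p, q)) X :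
  mxcvg u X -> mxcvg (fun k => adj (u k)) (adj X).
Proof.
move=> uX E; rewrite -(adjK E) rinner_adj.
under eq_fun do rewrite rinner_adj.
exact: uX.
Qed.

Lemma mxcvg_sum p q (I : Type) (r : seq I) (u : I -> nat -> 'M[C]_(p, q)) X :
  (forall i, mxcvg (u i) (X i)) ->
  mxcvg (fun k => \sum_(i <- r) u i k) (\sum_(i <- r) X i).
Proof.
move=> uX E; rewrite rinner_sumr; under eq_fun do rewrite rinner_sumr.
by apply: cvg_bigsum => i; exact: uX.
Qed.

Lemma mxcvgB p q (u v : nat -> 'M[C]_(p, q)) X Y :
  mxcvg u X -> mxcvg v Y -> mxcvg (fun k => u k - v k) (X - Y).
Proof.
move=> uX vY E; rewrite rinnerBr; under eq_fun do rewrite rinnerBr.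
by apply: cvgB.
Qed.

End MxLimits.

(** * Strictly convex quadratic functions on closed convex sets *)

Section Projection.
Variables (R : realType) (S : finType) (p q : nat).
Local Notation M := 'M[R[i]]_(p, q).
Implicit Types x y z : S -> M.

(** The projection theorem, in the form of a variational inequality.  The sets
    of [nested_min] are constant here. *)
Lemma convex_quadratic_min (K : set (S -> M)) (om : S -> R) (c : S -> M) :
  (forall s, 0 < om s) -> K !=set0 ->
  (forall x z t, K x -> K z -> 0 <= t <= 1 ->
     K (fun s => (1 - t)%:C *: x s + t%:C *: z s)) ->
  (forall (y : nat -> S -> M) x, (forall k, K (y k)) ->
     (forall s, mxcvg (fun k => y k s) (x s)) -> K x) ->
  exists2 x, K x & forall z, K z ->
    0 <= \sum_s rinner ((om s)%:C *: x s - c s) (z s - x s).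
Proof.
move=> om0 [x0 Kx0] Kconv Kcl.
pose J x := \sum_s (2^-1 * om s * rinner (x s) (x s) - rinner (c s) (x s)).
pose d x y := \sum_s (2^-1 * om s * rinner (x s - y s) (x s - y s)).
pose mid x y : S -> M := fun s => (1 - 2^-1 : R)%:C *: x s + (2^-1 : R)%:C *: y s.
pose B := \sum_s (2^-1 * (om s)^-1 * rinner (c s) (c s)).
have Jge x : - B <= J x.
  rewrite -subr_ge0 opprK -big_split; apply: sumr_ge0 => s _ /=.
  have := rinner_ge0 ((om s)%:C *: x s - c s).
  rewrite rinnerBl !rinnerBr !rinnerZl !rinnerZr (rinnerC (x s) (c s)).
  move: (rinner (x s) (x s)) (rinner (c s) (x s)) (rinner (c s) (c s)) => a b e h.
  have -> : 2^-1 * om s * a - b + 2^-1 / om s * e =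
     (om s)^-1 * 2^-1 * (om s * (om s * a) - om s * b - (om s * b - e)).
    by field; rewrite gt_eqF// om0.
  by rewrite !mulr_ge0// invr_ge0 ltW.
have B0 : 0 <= B.
  by apply: sumr_ge0 => s _; rewrite !mulr_ge0 ?rinner_ge0// invr_ge0 ltW.
pose r k : R := 4^-1 ^+ k.
have Jmid x y : J (mid x y) + 4^-1 * d x y = 2^-1 * (J x + J y).
  rewrite /J /d -big_split /= !mulr_sumr -big_split /=; apply: eq_bigr => s _.
  rewrite /mid rinnerBl !rinnerBr !(rinnerDl, rinnerDr) !rinnerZl !rinnerZr.
  rewrite (rinnerC (y s) (x s)).
  move: (rinner (x s) (x s)) (rinner (c s) (x s)) (rinner (c s) (y s)) (rinner (y s) (y s)) (rinner (x s) (y s)) => a b e f g.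
  by field.
have [y [Ky dy yinf]] : exists y : nat -> S -> M,
    [/\ forall k, K (y k), forall k, d (y k) (y k.+1) <= r k &
        forall k z, (forall j : nat, K z) -> J (y k) <= J z + r k].
  apply: (@nested_min R (S -> M) (fun=> K) mid J d (Num.max B (J x0))).
  - by [].
  - by move=> _ x y Kx Ky; apply: Kconv => //; lra.
  - by move=> x y _ _; rewrite Jmid.
  - by move=> x _; apply: le_trans (Jge x); rewrite lerN2 le_max lexx.
  - by move=> _; exists x0 => //; rewrite le_max lexx orbT.
  - by move=> k; rewrite exprn_gt0.
  - by move=> k; rewrite /r exprS ler_piMl ?exprn_ge0//; lra.
have cv s : exists X, mxcvg (fun k => y k s) X.
  apply: mxcvg_exists => bb ii jj; set E := unitv R bb ii jj.
  apply: (@fast_cauchy_cvg _ _ (mxnorm E * Num.sqrt (2 / om s))) => k.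
  rewrite -rinnerBr (le_trans (rinner_CS _ _))// -mulrA ler_wpM2l ?norm_ge0//.
  rewrite -(@ler_pXn2r _ 2) ?nnegrE ?norm_ge0 ?mulr_ge0 ?sqrtr_ge0 ?exprn_ge0//.
  rewrite normE exprMn sqr_sqrtr ?divr_ge0 ?(ltW (om0 _))// -exprM mulnC exprM.
  have -> : (2^-1 ^+ 2 : R) = 4^-1 by field.
  have h : 2^-1 * om s * rinner (y k s - y k.+1 s) (y k s - y k.+1 s) <= r k.
    apply: le_trans (dy k); rewrite /d (bigD1 s)//= lerDl.
    by apply: sumr_ge0 => i _; rewrite !mulr_ge0 ?rinner_ge0// ltW.
  rewrite -[X in _ <= _ * X]/(r k) mulrAC ler_pdivlMr//; lra.
have [x xP] := choice cv.
have Kx : K x by apply: Kcl xP.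
exists x => // z Kz.
have Jmin w : K w -> J x <= J w.
  move=> Kw.
  (* By convexity J (y k) is above its tangent at x, and the increment of the
     tangent along y tends to 0. *)
  have lin k : J x + \sum_s (om s * rinner (x s) (y k s - x s) - rinner (c s) (y k s - x s)) <= J w + r k.
    apply: le_trans (yinf k w (fun=> Kw)); rewrite -big_split; apply: ler_sum => s _ /=.
    have := rinner_ge0 (y k s - x s).
    rewrite !rinnerBl !rinnerBr (rinnerC (y k s) (x s)) => h.
    have := mulr_ge0 (ltW (om0 s)) h.
    move: (rinner (x s) (x s)) (rinner (x s) (y k s)) (rinner (y k s) (y k s)) => a e f.
    by move: (rinner (c s) (x s)) (rinner (c s) (y k s)) (om s) => g g' o; lra.
  have cl : (J w + r k - (J x + \sum_s (om s * rinner (x s) (y k s - x s) - rinner (c s) (y k s - x s)))) @[k --> \oo] --> J w - J x.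
    rewrite [X in _ --> X](_ : _ = J w + 0 - (J x + \sum_s (om s * 0 - 0))); last first.
      by rewrite big1 ?addr0// => s _; rewrite mulr0 subrr.
    have c0 E s : rinner E (y k s - x s) @[k --> \oo] --> (0 : R).
      under eq_fun do rewrite rinnerBr.
      rewrite -(subrr (rinner E (x s))); apply: cvgB; [exact: xP|exact: cvg_cst].
    apply: cvgB; apply: cvgD; try exact: cvg_cst.
      by apply: cvg_expr; rewrite ger0_norm//; lra.
    apply: cvg_bigsum => s; apply: cvgB => //.
    by apply: cvgM => //; exact: cvg_cst.
  rewrite -subr_ge0; apply: (cvg_ge_lim cl) => k; rewrite subr_ge0; exact: lin.
apply: (@linear_part_ge0 _ _ (2^-1 * \sum_s om s * rinner (z s - x s) (z s - x s))) => t /andP[t0 t1].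
have Kt : K (fun s => (1 - t)%:C *: x s + t%:C *: z s).
  by apply: Kconv => //; rewrite ltW.
have := Jmin _ Kt; rewrite -subr_ge0.
have -> : J (fun s => (1 - t)%:C *: x s + t%:C *: z s) - J x =
  t * (\sum_s rinner ((om s)%:C *: x s - c s) (z s - x s) +
   t * (2^-1 * \sum_s om s * rinner (z s - x s) (z s - x s))).
  rewrite !mulrDr !mulr_sumr -big_split -sumrB /=; apply: eq_bigr => s _.
  rewrite !rinnerBl !rinnerBr !(rinnerDl, rinnerDr) !rinnerZl !rinnerZr.
  rewrite (rinnerC (z s) (x s)).
  move: (rinner (x s) (x s)) (rinner (c s) (x s)) (rinner (c s) (z s)) (rinner (z s) (z s)) (rinner (x s) (z s)) => a b e f g.
  by field.
by rewrite pmulr_rge0.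
Qed.

End Projection.

(** * The penalised discrete dual problem *)

Section DiscreteDuality.
Variables (R : realType) (n N : nat).
Local Notation C := R[i].
Variable L : 'I_N -> 'M[C]_n.
Hypothesis hL : forall k, Herm (L k).
Variables (I J : finType) (b : J -> I -> R) (nu : J -> I).

(** The index i runs over the nodes of a time grid and j over the constraints;
    [b j] is the finite-difference stencil of the constraint j, and [nu j] the
    node at which its quadratic term is taken. *)
Definition velocity (lam : I -> 'M[C]_n) (j : J) : 'M[C]_n :=
  \sum_i (b j i)%:C *: lam i.

(** The left side of the Hamilton-Jacobi inequality. *)
Definition hjb (lam : I -> 'M[C]_n) (j : J) : 'M[C]_n :=
  velocity lam j + (2^-1 : R)%:C *: gram L (lam (nu j)).

Lemma velocity_herm lam j : (forall i, Herm (lam i)) -> Herm (velocity lam j).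
Proof. by move=> h; apply: Herm_sum => i _; apply: HermZ. Qed.

Lemma hjb_herm lam j : (forall i, Herm (lam i)) -> Herm (hjb lam j).
Proof.
by move=> h; apply: HermD; [exact: velocity_herm|apply/HermZ/gram_herm].
Qed.

Lemma velocityD lam eta j :
  velocity (fun i => lam i + eta i) j = velocity lam j + velocity eta j.
Proof. by rewrite /velocity -big_split; apply: eq_bigr => i _; rewrite scalerDr. Qed.

Lemma velocityZ (a : R) lam j :
  velocity (fun i => a%:C *: lam i) j = a%:C *: velocity lam j.
Proof.
rewrite /velocity scaler_sumr; apply: eq_bigr => i _.
by rewrite !scalerA mulrC.
Qed.

Lemma mxcvg_nabla (u : nat -> 'M[C]_n) X :
  mxcvg u X -> mxcvg (fun k => nabla L (u k)) (nabla L X).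
Proof.
move=> uX E; rewrite rinnerC rinner_nabla// rinnerC.
have -> : (fun k => rinner E (nabla L (u k))) = fun k => rinner (nablaD L E) (u k).
  by apply/funext => k; rewrite rinnerC rinner_nabla// rinnerC.
exact: uX.
Qed.

Lemma mxcvg_hjb (u : nat -> I -> 'M[C]_n) x j :
  (forall i, mxcvg (fun k => u k i) (x i)) ->
  mxcvg (fun k => hjb (u k) j) (hjb x j).
Proof.
move=> h; apply: mxcvgD; first by apply: mxcvg_sum => i; exact: mxcvgZ.
apply: mxcvgZ; apply: mxcvgM; last exact: mxcvg_nabla.
by apply: mxcvg_adj; exact: mxcvg_nabla.
Qed.


(** Relax the constraints [hjb lam j <= 0] to [hjb lam j <= T j] and minimise
    1/2 de |lam|^2 + 1/2 om |T|^2 - sum_i <c i, lam i>.  The multiplier of the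
    constraint j is [r j = om *: T j].  Its positivity and the complementary
    slackness come from variations of T j alone, and the discrete continuity
    equation from variations of lam along which T - hjb lam is constant. *)
Lemma discrete_duality (c : I -> 'M[C]_n) (om de : R) : 0 < om -> 0 < de ->
  exists (lam : I -> 'M[C]_n) (r : J -> 'M[C]_n),
  [/\ forall i, Herm (lam i), forall j, Hpsd (r j),
      forall j, Hpsd (om^-1%:C *: r j - hjb lam j),
      forall j, rinner (r j) (om^-1%:C *: r j - hjb lam j) = 0 &
      forall eta : I -> 'M[C]_n, (forall i, Herm (eta i)) ->
      \sum_i rinner (c i) (eta i) =
      \sum_j (rinner (r j) (velocity eta j) +
        rinner (nabla L (eta (nu j))) (nabla L (lam (nu j)) *m r j)) +
      de * \sum_i rinner (lam i) (eta i)].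
Proof.
move=> om0 de0.
pose S := (I + J)%type.
pose K : set (S -> 'M[C]_n) := [set x | (forall i, Herm (x (inl i))) /\
   forall j, Hpsd (x (inr j) - hjb (x \o inl) j)].
pose w (s : S) := if s is inl _ then de else om.
pose cc (s : S) := if s is inl i then c i else 0.
have [|||y x yK yx|x [xh xs] xmin] := @convex_quadratic_min R S n n K w cc.
- by case.
- exists (fun=> 0); split => [i|j] /=; first exact: Herm0.
  have h0 : hjb (fun=> 0) j = 0.
    rewrite /hjb [velocity _ _]big1 => [|i _]; last exact: scaler0.
    by rewrite add0r /gram linear0 mulmx0 scaler0.
  rewrite (_ : hjb _ j = 0); last exact: h0.
  by rewrite subr0; exact: psd0.
- move=> x z t [xh xs] [zh zs] t01; split => [i|j] /=.
    by apply: HermD; apply: HermZ.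
  have [t0 t1] := andP t01.
  set A := _ - _.
  have -> : A = (1 - t)%:C *: (x (inr j) - hjb (x \o inl) j) +
     t%:C *: (z (inr j) - hjb (z \o inl) j) + (2^-1 : R)%:C *:
     ((1 - t)%:C *: gram L (x (inl (nu j))) + t%:C *: gram L (z (inl (nu j))) -
        gram L ((1 - t)%:C *: x (inl (nu j)) + t%:C *: z (inl (nu j)))).
    apply: rinner_nondeg => E; rewrite /A /hjb /=.
    rewrite (velocityD (fun i => (1 - t)%:C *: x (inl i))) !velocityZ.
    move: (velocity _ _) (velocity _ _) (gram L _) (gram L _) (gram L _) => v1 v2 g1 g2 g3.
    rewrite !(rinnerDr, rinnerBr, rinnerZr, rinnerNr).
    move: (rinner E v1) (rinner E v2) (rinner E g1) (rinner E g2) (rinner E g3) (rinner E (x _)) (rinner E (z _)) => e1 e2 e3 e4 e5 e6 e7; ring.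
  apply: psdD; last by apply: psdZ; rewrite ?invr_ge0//; exact: gram_convex.
  by apply: psdD; apply: psdZ; rewrite ?subr_ge0.
- split => [i|j].
    have cv : mxcvg (fun k => y k (inl i)) (x (inl i)) by exact: yx.
    apply/HermP/rinner_nondeg => E.
    have c1 := @mxcvg_adj _ _ _ _ _ cv E; have c2 := cv E.
    have e : (fun k => rinner E (adj (y k (inl i)))) = fun k => rinner E (y k (inl i)).
      by apply/funext => k; have [/(_ i)/HermP -> _] := yK k.
    by rewrite e in c1; exact: (cvg_unique _ c1 c2).
  apply: (@mxcvg_psd _ _ (fun k => y k (inr j) - hjb (y k \o inl) j)).
    by apply: mxcvgB; [exact: yx|apply: mxcvg_hjb => i; exact: yx].
  by move=> k; have [_] := yK k.
pose lam := x \o inl; pose T := x \o inr.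
have vi (z : S -> 'M[C]_n) : K z -> 0 <=
    \sum_i rinner (de%:C *: lam i - c i) (z (inl i) - lam i) +
    \sum_j rinner (om%:C *: T j) (z (inr j) - T j).
  move=> /xmin; rewrite big_sumType /=; congr (0 <= _ + _).
  by apply: eq_bigr => j _; rewrite subr0.
have Th j : Herm (T j).
  have -> : T j = (T j - hjb lam j) + hjb lam j by rewrite subrK.
  by apply: HermD; [exact/psd_herm/xs|exact: hjb_herm].
(* Variations of the single slack T j. *)
have slack j (P : 'M[C]_n) : Hpsd (T j - hjb lam j + P) -> 0 <= rinner (T j) P.
  move=> hP.
  pose z (s : S) := match s with inl i => x (inl i)
    | inr j' => if j' == j then T j + P else T j' end.
  have Kz : K z.
    split => [i|j'] /=; first exact: xh.
    have -> : hjb (z \o inl) j' = hjb lam j' by [].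
    case: eqP => [->|_]; last exact: xs.
    by rewrite addrAC.
  have := vi z Kz; rewrite big1 ?add0r => [|i _]; last by rewrite subrr rinner0r.
  rewrite (bigD1 j)//= eqxx big1 => [|i /negbTE ->]; last by rewrite subrr rinner0r.
  by rewrite addr0 addrAC subrr add0r rinnerZl pmulr_rge0.
exists lam, (fun j => om%:C *: T j); split.
- exact: xh.
- move=> j; apply: psdZ; first exact: ltW.
  apply: (psd_of_rinner (Th j)) => P hP; apply: slack.
  by apply: psdD hP; exact: xs.
- move=> j; rewrite scalerA -rmorphM mulVf ?gt_eqF// scale1r; exact: xs.
- move=> j; rewrite scalerA -rmorphM mulVf ?gt_eqF// scale1r rinnerZl.
  suff -> : rinner (T j) (T j - hjb lam j) = 0 by rewrite mulr0.
  apply/eqP; rewrite eq_le; apply/andP; split.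
    rewrite -oppr_ge0 -rinnerNr; apply: slack; rewrite subrr; exact: psd0.
  by apply: slack; apply: psdD; exact: xs.
(* Stationarity in lam: as T moves along with hjb lam, the constraint stays
   satisfied for variations of either sign, up to the quadratic remainder Q. *)
move=> eta etah.
pose V (e : I -> 'M[C]_n) :=
  \sum_j (rinner (om%:C *: T j) (velocity e j) +
    rinner (nabla L (e (nu j))) (nabla L (lam (nu j)) *m (om%:C *: T j))) +
  de * \sum_i rinner (lam i) (e i) - \sum_i rinner (c i) (e i).
pose Q (e : I -> 'M[C]_n) := 2^-1 * \sum_j rinner (om%:C *: T j) (gram L (e (nu j))).
have VZ (a : R) e : V (fun i => a%:C *: e i) = a * V e.
  rewrite /V mulrBr mulrDr; congr (_ + _ - _).
  - rewrite mulr_sumr; apply: eq_bigr => j _; rewrite velocityZ rinnerZr.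
    have -> : nabla L (a%:C *: e (nu j)) = a%:C *: nabla L (e (nu j)) by rewrite linearZ.
    by rewrite mulrDr; congr (_ + _); exact: rinnerZl.
  - rewrite mulrCA; congr (_ * _); rewrite mulr_sumr.
    by apply: eq_bigr => i _; rewrite rinnerZr.
  - by rewrite mulr_sumr; apply: eq_bigr => i _; rewrite rinnerZr.
have QZ (a : R) e : Q (fun i => a%:C *: e i) = a ^+ 2 * Q e.
  rewrite /Q mulrCA !mulr_sumr; apply: eq_bigr => j _.
  by congr (_ * _); rewrite gramZ rinnerZr.
have VQ e : (forall i, Herm (e i)) -> 0 <= V e + Q e.
  move=> eh.
  pose D j := velocity e j +
     (2^-1 : R)%:C *: (adj (nabla L (lam (nu j))) *m nabla L (e (nu j)) +
        adj (nabla L (e (nu j))) *m nabla L (lam (nu j))) +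
     (2^-1 : R)%:C *: gram L (e (nu j)).
  pose z (s : S) := match s with inl i => lam i + e i | inr j => T j + D j end.
  have Kz : K z.
    split => [i|j] /=; first exact: (HermD (xh i) (eh i)).
    have -> : hjb (z \o inl) j = hjb lam j + D j.
      rewrite /hjb /D (velocityD lam e) /= gramD.
      move: (velocity _ _) (velocity _ _) (gram L _) (gram L _) => v1 v2 g1 g2.
      move: (_ *m _ + _) => X.
      rewrite !scalerDr; move: (_ *: g1) (_ *: g2) (_ *: X) => u1 u2 u3.
      by rewrite -(addrA u2) addrACA -(addrA v1) (addrC u1).
    by rewrite opprD addrACA subrr addr0; exact: xs.
  have := vi z Kz; congr (0 <= _).
  rewrite /V /Q /=.
  have -> : \sum_i rinner (de%:C *: lam i - c i) (lam i + e i - lam i) =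
     de * (\sum_i rinner (lam i) (e i)) - \sum_i rinner (c i) (e i).
    rewrite mulr_sumr -sumrB; apply: eq_bigr => i _.
    by rewrite addrAC subrr add0r rinnerBl rinnerZl.
  have -> : \sum_j rinner (om%:C *: T j) (T j + D j - T j) =
    \sum_j (rinner (om%:C *: T j) (velocity e j) +
    rinner (nabla L (e (nu j))) (nabla L (lam (nu j)) *m (om%:C *: T j))) +
    2^-1 * \sum_j rinner (om%:C *: T j) (gram L (e (nu j))).
    rewrite mulr_sumr -big_split; apply: eq_bigr => j _ /=.
    rewrite addrAC subrr add0r /D !rinnerDr !rinnerZr; congr (_ + _ + _).
    rewrite rinnerDr.
    have -> : rinner (om%:C *: T j) (adj (nabla L (lam (nu j))) *m nabla L (e (nu j))) =
      rinner (nabla L (e (nu j))) (nabla L (lam (nu j)) *m (om%:C *: T j)).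
      by rewrite -rinner_mull rinnerC.
    have -> : rinner (om%:C *: T j) (adj (nabla L (e (nu j))) *m nabla L (lam (nu j))) =
      rinner (nabla L (e (nu j))) (nabla L (lam (nu j)) *m (om%:C *: T j)).
      have /HermP h : Herm (om%:C *: T j) by exact: HermZ.
      by rewrite -rinner_mull rinner_mulr h.
    by lra.
  by lra.
have V0 e : (forall i, Herm (e i)) -> 0 <= V e.
  move=> eh; apply: (@linear_part_ge0 _ _ (Q e)) => t /andP[t0 t1].
  have := VQ (fun i => t%:C *: e i) (fun i => HermZ t (eh i)).
  by rewrite VZ QZ expr2 -mulrA -mulrDr pmulr_rge0.
have := V0 eta etah.
have := V0 (fun i => (-1)%:C *: eta i) (fun i => HermZ (-1) (etah i)).
rewrite VZ mulN1r => h1 h2.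
have : V eta = 0 by apply/eqP; rewrite eq_le h2 -oppr_ge0 h1.
rewrite /V => /eqP; rewrite subr_eq0 => /eqP <-.
by congr (_ + _ * _).
Qed.

End DiscreteDuality.

(** * Integration on the unit interval *)

Section UnitInterval.
Variable R : realType.
Local Notation mu := (@lebesgue_measure R).
Local Notation I01 := (`]0, 1[%classic : set R).
Implicit Types f g u v : R -> R.

Definition L1 f : Prop := mu.-integrable I01 (EFin \o f).
(** The integral over the open unit interval. *)
Definition It f : R := \int[mu]_(t in I01) f t.
(** The primitive that vanishes at 0. *)
Definition prim v t : R := \int[mu]_(s in `]0, t[) v s.

Lemma mI01 : measurable (I01 : set (measurableTypeR R)).
Proof. exact: measurable_itv. Qed.
Hint Resolve mI01 : core.

Lemma mu_I01 : mu I01 = 1%E.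
Proof. by rewrite lebesgue_measure_itv/= lte_fin ltr01 sube0. Qed.

Lemma mu_I01_fin : (mu I01 < +oo)%E.
Proof. by rewrite mu_I01 ltry. Qed.

Lemma I01P (t : R) : I01 t <-> (0 < t < 1).
Proof. by rewrite /= in_itv. Qed.

Lemma I01_le (t : R) : I01 t -> 0 <= t <= 1.
Proof. by rewrite /= in_itv/= => /andP[/ltW -> /ltW ->]. Qed.

Lemma L1_ext f g : (forall t, f t = g t) -> L1 f -> L1 g.
Proof. by move=> /funext ->. Qed.

Lemma L1_mfun f : L1 f -> measurable_fun I01 f.
Proof. by move=> /(measurable_int mu) /measurable_EFinP. Qed.

Lemma L1_bound f (M : R) : measurable_fun I01 f ->
  (forall t, I01 t -> `|f t| <= M) -> L1 f.
Proof.
move=> mf h; apply: measurable_bounded_integrable => //.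
  exact: mu_I01_fin.
exists M; split; first exact: num_real.
by move=> y My t It; apply: le_trans (h t It) (ltW My).
Qed.

Lemma L1_le f g : measurable_fun I01 f -> L1 g ->
  (forall t, I01 t -> `|f t| <= g t) -> L1 f.
Proof.
move=> mf ig h; apply: le_integrable ig => //; first exact/measurable_EFinP.
by move=> t It /=; rewrite lee_fin (le_trans (h t It))// ler_norm.
Qed.

Lemma L1D f g : L1 f -> L1 g -> L1 (fun t => f t + g t).
Proof.
move=> hf hg; have := integrableD mI01 hf hg.
by apply: eq_integrable.
Qed.

Lemma L1Z (a : R) f : L1 f -> L1 (fun t => a * f t).
Proof.
by move=> hf; have := integrableZl mI01 a hf; apply: eq_integrable.
Qed.

Lemma L1N f : L1 f -> L1 (fun t => - f t).
Proof.
by move=> hf; have := L1Z (-1) hf; apply: eq_integrable => // t _; rewrite /= mulN1r.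
Qed.

Lemma L1B f g : L1 f -> L1 g -> L1 (fun t => f t - g t).
Proof. by move=> hf hg; apply: L1D => //; exact: L1N. Qed.

Lemma L1_cst (a : R) : L1 (fun=> a).
Proof. by apply: (@L1_bound _ `|a|). Qed.

Lemma L1_sum (I : Type) (r : seq I) (P : pred I) (f : I -> R -> R) :
  (forall i, P i -> L1 (f i)) -> L1 (fun t => \sum_(i <- r | P i) f i t).
Proof.
move=> h; elim: r => [|i r IH].
  by under eq_fun do rewrite big_nil; exact: L1_cst.
have [Pi|nPi] := boolP (P i).
  by under eq_fun do rewrite big_cons Pi; apply: L1D => //; exact: h.
by under eq_fun do rewrite big_cons (negbTE nPi).
Qed.

Lemma L1M_bound f g (M : R) : measurable_fun I01 f ->
  (forall t, I01 t -> `|f t| <= M) -> L1 g -> L1 (fun t => f t * g t).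
Proof.
move=> mf h hg; apply: (@L1_le _ (fun t => M * `|g t|)).
- by apply: measurable_funM => //; exact: L1_mfun.
- by apply: L1Z; have := integrable_norm hg; apply: eq_integrable.
- by move=> t It; rewrite normrM ler_wpM2r// h.
Qed.

Lemma L1_norm f : L1 f -> L1 (fun t => `|f t|).
Proof. by move=> hf; have := integrable_norm hf; apply: eq_integrable. Qed.

Lemma ItD f g : L1 f -> L1 g -> It (fun t => f t + g t) = It f + It g.
Proof. by move=> hf hg; rewrite /It RintegralD. Qed.

Lemma ItB f g : L1 f -> L1 g -> It (fun t => f t - g t) = It f - It g.
Proof. by move=> hf hg; rewrite /It RintegralB. Qed.

Lemma ItZ (a : R) f : L1 f -> It (fun t => a * f t) = a * It f.
Proof. by move=> hf; rewrite /It RintegralZl. Qed.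

Lemma It_cst (a : R) : It (fun=> a) = a.
Proof.
transitivity (a * fine (mu I01)); first exact: Rintegral_cst.
by rewrite mu_I01 mulr1.
Qed.

Lemma It_sum (I : Type) (r : seq I) (P : pred I) (f : I -> R -> R) :
  (forall i, P i -> L1 (f i)) ->
  It (fun t => \sum_(i <- r | P i) f i t) = \sum_(i <- r | P i) It (f i).
Proof.
move=> h; elim: r => [|i r IH].
  by under eq_fun do rewrite big_nil; rewrite big_nil It_cst.
rewrite big_cons; have [Pi|nPi] := boolP (P i).
  under eq_fun do rewrite big_cons Pi.
  by rewrite ItD ?IH//; [exact: h|exact: L1_sum].
by under eq_fun do rewrite big_cons (negbTE nPi).
Qed.

Lemma It_le f g : L1 f -> L1 g -> (forall t, I01 t -> f t <= g t) ->
  It f <= It g.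
Proof. by move=> hf hg h; apply: le_Rintegral. Qed.

Lemma It_ge0 f : (forall t, I01 t -> 0 <= f t) -> 0 <= It f.
Proof. by move=> h; apply: Rintegral_ge0. Qed.

Lemma It_norm f : L1 f -> `|It f| <= It (fun t => `|f t|).
Proof. by move=> hf; apply: le_normr_Rintegral. Qed.

Lemma eq_It f g : (forall t, I01 t -> f t = g t) -> It f = It g.
Proof. by move=> h; apply: eq_Rintegral => t /set_mem; exact: h. Qed.

Lemma It_EFin f : L1 f -> (\int[mu]_(t in I01) (f t)%:E)%E = (It f)%:E.
Proof. by move=> hf; rewrite fineK//; exact: integrable_fin_num. Qed.

Lemma sub_I01 (a b : R) : 0 <= a -> b <= 1 -> `]a, b[%classic `<=` I01.
Proof.
move=> a0 b1 t; rewrite /= !in_itv/= => /andP[h1 h2].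
by rewrite (le_lt_trans a0 h1) (lt_le_trans h2 b1).
Qed.

Lemma prim0 v : prim v 0 = 0.
Proof. by rewrite /prim set_itv_ge ?Rintegral_set0// bnd_simp ltxx. Qed.

Lemma prim1 v : prim v 1 = It v. Proof. by []. Qed.

Lemma prim_cst (c t : R) : 0 <= t <= 1 -> prim (fun=> c) t = t * c.
Proof.
move=> /andP[t0 t1]; rewrite /prim Rintegral_cst//= lebesgue_measure_itv/=.
case: ifP => h; first by rewrite /= subr0 mulrC.
have -> : t = 0 by apply/eqP; rewrite eq_le t0 andbT leNgt; move: h; rewrite lte_fin => ->.
by rewrite mulr0 mul0r.
Qed.

Lemma L1_cc v : L1 v -> mu.-integrable (`[0, 1]%classic : set R) (EFin \o v).
Proof.
move=> hv; have mv : measurable_fun I01 (EFin \o v) by exact: (measurable_int mu).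
have m2 : measurable_fun (`[0, 1]%classic : set (measurableTypeR R)) (EFin \o v).
  rewrite -(@setU1itv _ _ (BRight 1) 0 false) ?bnd_simp//.
  rewrite -(@setUitv1 _ _ (BRight 0) 1 true) ?bnd_simp//.
  apply/measurable_funU => //; first exact: measurableU.
  split; first exact: measurable_fun_set1.
  by apply/measurable_funU => //; split => //; exact: measurable_fun_set1.
apply/integrableP; split => //; rewrite integral_itv_bndoo.
  by have /integrableP[] := hv.
exact: measurableT_comp.
Qed.

Lemma primE v t : L1 v -> 0 <= t <= 1 -> prim v t = parameterized_integral mu 0 t v.
Proof.
move=> hv /andP[t0 t1]; rewrite /prim /parameterized_integral.
have h : mu.-integrable `[0, t] (EFin \o v).
  by apply: integrableS (L1_cc hv) => //; apply: subset_itvl; rewrite bnd_simp.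
rewrite -Rintegral_itv_obnd_cbnd; last first.
  by apply: integrableS h => //; exact: subset_itv_oc_cc.
rewrite Rintegral_itv_bndo_bndc//.
by apply: integrableS h => //; exact: subset_itv_oo_cc.
Qed.

Lemma prim_continuous v : L1 v -> {within `[0, 1], continuous (prim v)}.
Proof.
move=> hv; have := parameterized_integral_continuous (@ler01 R) (L1_cc hv).
apply: subspace_eq_continuous => t /set_mem; rewrite /= in_itv /= => ht.
by apply/esym; exact: primE.
Qed.

Lemma prim_mfun v : L1 v -> measurable_fun I01 (prim v).
Proof.
move=> hv.
have m : measurable_fun (`[0, 1]%classic : set (measurableTypeR R)) (prim v).
  by apply: subspace_continuous_measurable_fun => //; exact: prim_continuous.
by apply: measurable_funS m => //; exact: subset_itv_oo_cc.
Qed.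

Lemma prim_le v t : L1 v -> 0 <= t <= 1 -> `|prim v t| <= It (fun s => `|v s|).
Proof.
move=> hv /andP[t0 t1]; have s : `]0, t[%classic `<=` I01 by exact: sub_I01.
have hvt : mu.-integrable `]0, t[ (EFin \o v) by apply: integrableS hv.
apply: (le_trans (le_normr_Rintegral _ hvt)) => //.
rewrite /It /Rintegral fine_le ?integrable_fin_num//.
- exact: integrable_norm.
- exact: L1_norm.
- apply: ge0_subset_integral => //; apply/measurable_EFinP.
  by apply: measurableT_comp => //; exact: L1_mfun.
Qed.

Lemma primD (u v : R -> R) t : L1 u -> L1 v -> 0 <= t <= 1 ->
  prim (fun s => u s + v s) t = prim u t + prim v t.
Proof.
move=> lu lv /andP[t0 t1]; rewrite /prim RintegralD//.
  by apply: integrableS lu => //; exact: sub_I01.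
by apply: integrableS lv => //; exact: sub_I01.
Qed.

Lemma primZ (a : R) (u : R -> R) t : L1 u -> 0 <= t <= 1 ->
  prim (fun s => a * u s) t = a * prim u t.
Proof.
move=> lu /andP[t0 t1]; rewrite /prim RintegralZl//.
by apply: integrableS lu => //; exact: sub_I01.
Qed.

Lemma prim_sum (I : Type) (r : seq I) (u : I -> R -> R) t :
  (forall i, L1 (u i)) -> 0 <= t <= 1 ->
  prim (fun s => \sum_(i <- r) u i s) t = \sum_(i <- r) prim (u i) t.
Proof.
move=> lu t01; elim: r => [|i r IH].
  rewrite big_nil; have -> : (fun s => \sum_(i <- [::]) u i s) = fun=> 0.
    by apply/funext => s; rewrite big_nil.
  by rewrite prim_cst// mulr0.
have -> : (fun s => \sum_(j <- i :: r) u j s) = fun s => u i s + \sum_(j <- r) u j s.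
  by apply/funext => s; rewrite big_cons.
by rewrite primD ?IH ?big_cons//; exact: L1_sum.
Qed.

Lemma It_prim_compl v t : L1 v -> 0 <= t <= 1 ->
  \int[mu]_(s in `]t, 1[) v s = It v - prim v t.
Proof.
move=> hv /andP[t0 t1]; rewrite /prim.
have [->|t0'] := eqVneq t 0.
  by rewrite (_ : \int[mu]_(s in `]0, 0[) v s = 0) ?subr0//; exact: prim0.
have [->|t1'] := eqVneq t 1.
  by rewrite subrr set_itv_ge ?Rintegral_set0// bnd_simp ltxx.
have ht : mu.-integrable `]0, t[ (EFin \o v).
  by apply: integrableS hv => //; exact: sub_I01.
rewrite (@Rintegral_itv_bndo_bndc _ (BRight 0) t)//.
rewrite -(@Rintegral_itvB _ _ (BRight 0) (BLeft 1) t)//.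
by rewrite bnd_simp lt_neqAle t1'.
Qed.

Lemma integrable_patch (D : set (measurableTypeR R)) v : measurable D ->
  mu.-integrable D (EFin \o v) -> mu.-integrable setT (EFin \o (v \_ D)).
Proof.
move=> mD h; have := (integrable_mkcond (mu := mu) (EFin \o v) mD).1 h.
by apply: eq_integrable => // x _; rewrite -restrict_EFin.
Qed.

Lemma prim_bound_L1M u v : L1 u -> L1 v -> L1 (fun t => u t * prim v t).
Proof.
move=> hu hv; apply: (@L1_ext (fun t => prim v t * u t)) => [t|]; first by rewrite mulrC.
apply: (@L1M_bound _ _ (It (fun s => `|v s|))) => //; first exact: prim_mfun.
by move=> t /I01_le; exact: prim_le.
Qed.

(** Integration by parts for absolutely continuous functions, by Fubini on the
    triangle s < t: the primitives need not be differentiable anywhere in the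
    classical sense. *)
Lemma ibp_prim u v : L1 u -> L1 v ->
  It (fun t => u t * prim v t) + It (fun t => prim u t * v t) = It u * It v.
Proof.
move=> hu hv.
pose U := u \_ I01; pose V := v \_ I01.
have iU : mu.-integrable setT (EFin \o U).
  exact: (integrable_patch mI01 hu).
have iV : mu.-integrable setT (EFin \o V).
  exact: (integrable_patch mI01 hv).
have mU : measurable_fun setT U.
  by apply/measurable_EFinP; exact: (measurable_int mu iU).
have mV : measurable_fun setT V.
  by apply/measurable_EFinP; exact: (measurable_int mu iV).
(* The function u(x) v(y) on the triangle y < x. *)
pose k (z : R * R) := if z.2 < z.1 then U z.1 * V z.2 else 0.
have mk : measurable_fun setT k.
  apply: measurable_fun_ifT => //.
    by apply: measurable_fun_ltr; [exact: measurable_snd|exact: measurable_fst].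
  by apply: measurable_funM; [exact: (measurableT_comp mU measurable_fst)|
    exact: (measurableT_comp mV measurable_snd)].
have iV' := integrable_norm iV; have iU' := integrable_norm iU.
have inner1 x (w : R -> R) : mu.-integrable setT (EFin \o w) ->
  (\int[mu]_y (x * w y)%:E)%E = (x * \int[mu]_y w y)%:E.
  move=> iw; rewrite EFinM /Rintegral fineK; last exact: integrable_fin_num.
  by rewrite -integralZl.
have ik : (mu \x mu)%E.-integrable setT (EFin \o k).
  apply/integrable12ltyP; first exact/measurable_EFinP.
  apply: (@le_lt_trans _ _ (\int[mu]_x (`|U x| * \int[mu]_y `|V y|)%:E)%E).
    apply: ge0_le_integral => //.
    - by move=> x _; exact: integral_ge0.
    - have mk' : measurable_fun setT (abse \o (EFin \o k)).
        by apply: measurableT_comp => //; exact/measurable_EFinP.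
      exact: (@measurable_fun_fubini_tonelli_F _ _ _ _ _ mu _ mk' (fun z => abse_ge0 _)).
    - apply/measurable_EFinP; apply: measurable_funM => //.
      exact: measurableT_comp.
    - move=> x _; rewrite -inner1//; apply: ge0_le_integral => //.
      + apply: measurableT_comp => //; apply/measurable_EFinP.
        exact: measurableT_comp mk (pair1_measurable x).
      + apply/measurable_EFinP; apply: measurable_funM => //.
        exact: measurableT_comp.
      + move=> y _; rewrite lee_fin /k /=.
        by case: ifP => _; rewrite ?normrM// normr0 mulr_ge0.
  under eq_integral do rewrite mulrC.
  by rewrite inner1// ltry.
have := Fubini ik.
have F1 x : (\int[mu]_y (EFin \o k) (x, y))%E = (((fun t => u t * prim v t) \_ I01) x)%:E.
  rewrite /=; transitivity (\int[mu]_y (U x * (v \_ `]0, x[) y)%:E)%E.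
    apply: eq_integral => y _; rewrite /k /=.
    have [/= xI|xI] := boolP (x \in I01); last first.
      by rewrite /U patchN// !mul0r; case: ifP.
    have {xI} : I01 x by exact/set_mem.
    rewrite /= in_itv/= => /andP[x0 x1].
    rewrite /V /patch !mem_setE !in_itv/=.
    have [yx|yx] := ltP y x; last by rewrite andbF mulr0.
    by rewrite andbT (lt_trans yx x1) andbT.
  have [xI|xI] := boolP (x \in I01); last first.
    rewrite patchN// /U patchN//.
    by under eq_integral do rewrite mul0r; rewrite integral0.
  have h : I01 x by exact/set_mem.
  rewrite inner1; last first.
    apply: integrable_patch => //; apply: integrableS hv => //; apply: sub_I01 => //.
    by move: h; rewrite /= in_itv/= => /andP[_ /ltW].
  by rewrite -Rintegral_mkcond /U !patchT.
have F2 y : (\int[mu]_x (EFin \o k) (x, y))%E =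
    (((fun t => (It u - prim u t) * v t) \_ I01) y)%:E.
  rewrite /=; transitivity (\int[mu]_x (V y * (u \_ `]y, 1[) x)%:E)%E.
    apply: eq_integral => x _; rewrite /k /=.
    have [/= yI|yI] := boolP (y \in I01); last first.
      by rewrite /V patchN// !(mul0r, mulr0); case: ifP.
    have {yI} : I01 y by exact/set_mem.
    rewrite /= in_itv/= => /andP[y0 y1].
    rewrite /U /patch !mem_setE !in_itv/=.
    have [yx|yx] := ltP y x; last by rewrite mulr0.
    by rewrite (lt_trans y0 yx) /= mulrC.
  have [yI|yI] := boolP (y \in I01); last first.
    rewrite patchN// /V patchN//.
    by under eq_integral do rewrite mul0r; rewrite integral0.
  have : I01 y by exact/set_mem.
  rewrite /= in_itv/= => /andP[y0 y1].
  rewrite inner1; last first.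
    by apply: integrable_patch => //; apply: integrableS hu => //; apply: sub_I01 => //; exact: ltW.
  by rewrite -Rintegral_mkcond It_prim_compl ?ltW ?y0// /V !patchT// mulrC.
under eq_integral do rewrite F1.
under [in X in _ = X -> _]eq_integral do rewrite F2.
have patchE (f : R -> R) :
    (\int[mu]_x ((f \_ I01) x)%:E = \int[mu]_(x in I01) (f x)%:E)%E.
  by rewrite [RHS]integral_mkcond; apply: eq_integral => x _; rewrite restrict_EFin.
rewrite !patchE.
have i1 := prim_bound_L1M hu hv.
have i2 : L1 (fun t => prim u t * v t).
  by apply: (L1_ext _ (prim_bound_L1M hv hu)) => t; rewrite mulrC.
under [X in _ = X -> _]eq_integral do rewrite mulrBl.
rewrite !It_EFin//; last by apply: L1B => //; exact: L1Z.
move=> [->]; rewrite ItB//; last exact: L1Z.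
by rewrite ItZ// subrK.
Qed.

End UnitInterval.

(** * Smooth steps *)

Section SmoothStep.
Variable R : realType.
Implicit Types (f g : R -> R) (P : {poly R}).

(** k-fold differentiability with the derivatives as witnesses, which makes the
    closure properties below inductions on k. *)
Fixpoint Dn (k : nat) f : Prop :=
  if k is k'.+1 then
    exists2 g, (forall t, is_derive t (1 : R) f (g t)) & Dn k' g
  else True.

Definition smooth f := forall k, Dn k f.

Lemma DnW k f : Dn k.+1 f -> Dn k f.
Proof.
elim: k f => [//|k IH] f /= [g fg [h gh Dh]].
by exists g => //; apply: IH; exists h.
Qed.

Lemma Dn_derivable k j f t : Dn k f -> (j < k)%N ->
  derivable (derive1n j f) t 1.
Proof.
elim: k j f => [//|k IH] [|j] f [g fg Dg] jk.
  by rewrite derive1n0; have [] := fg t.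
rewrite derive1Sn; have -> : derive1 f = g.
  by apply/funext => s; rewrite derive1E; have [] := fg s.
exact: IH.
Qed.

Lemma smooth_derivable f : smooth f -> forall k t, derivable (derive1n k f) t 1.
Proof. by move=> fs k t; apply: (@Dn_derivable k.+1) => //; exact: fs. Qed.

Lemma Dn_cst k (c : R) : Dn k (fun=> c).
Proof.
elim: k c => [//|k IH] c; exists (fun=> 0) => //.
by move=> t; exact: is_derive_cst.
Qed.

Lemma Dn_add k f g : Dn k f -> Dn k g -> Dn k (fun t => f t + g t).
Proof.
elim: k f g => [//|k IH] f g [f' ff' Df'] [g' gg' Dg'].
by exists (fun t => f' t + g' t); [move=> t; exact: is_deriveD|exact: IH].
Qed.

Lemma Dn_mul k f g : Dn k f -> Dn k g -> Dn k (fun t => f t * g t).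
Proof.
elim: k f g => [//|k IH] f g Df Dg.
have Df0 := DnW Df; have Dg0 := DnW Dg.
move: Df Dg => [f' ff' Df'] [g' gg' Dg'].
exists (fun t => f t * g' t + g t * f' t).
  by move=> t; exact: (is_deriveM (ff' t) (gg' t)).
by apply: Dn_add; apply: IH.
Qed.

Lemma Dn_opp k f : Dn k f -> Dn k (fun t => - f t).
Proof.
elim: k f => [//|k IH] f [f' ff' Df'].
by exists (fun t => - f' t); [move=> t; exact: is_deriveN|exact: IH].
Qed.

Lemma Dn_inv k f : (forall t, f t != 0) -> Dn k f -> Dn k (fun t => (f t)^-1).
Proof.
move=> f0; elim: k => [//|k IH] Df; have Df0 := IH (DnW Df).
move: Df => [f' ff' Df'].
exists (fun t => - ((f t)^-1 * (f t)^-1 * f' t)).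
  move=> t; apply: (is_derive_eq (is_deriveV (f0 t) (ff' t))).
  by rewrite scaleNr expr2 invfM.
by apply: Dn_opp; apply: Dn_mul => //; apply: Dn_mul.
Qed.

Lemma is_derive_affine (a b t : R) : is_derive t (1 : R) (fun x => a * x + b) a.
Proof.
have h1 : is_derive t (1 : R) (fun x => a *: (x : R)) (a *: (1 : R)) by exact: is_deriveZ.
apply: (is_derive_eq (is_deriveD h1 (is_derive_cst b t (1 : R)))).
by rewrite addr0 [LHS]mulr1.
Qed.

Lemma Dn_affine k (a b : R) f : Dn k f -> Dn k (fun t => f (a * t + b)).
Proof.
elim: k f => [//|k IH] f [f' ff' Df'].
exists (fun t => f' (a * t + b) * a).
  by move=> t; exact: (is_derive1_comp (ff' _) (is_derive_affine a b t)).
by apply: Dn_mul; [exact: IH|exact: Dn_cst].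
Qed.

(** P(1/x) exp(-1/x) for x > 0, and 0 otherwise.  This family is stable under
    differentiation, so each of its members is smooth. *)
Definition flat P (x : R) : R := if 0 < x then P.[x^-1] * expR (- x^-1) else 0.

Lemma poly_expR_bound P : exists2 c, 0 <= c &
  forall y, 0 <= y -> `|P.[y]| <= c * expR y.
Proof.
exists (\sum_(i < size P) `|P`_i| * i`!%:R).
  by apply: sumr_ge0 => i _; rewrite mulr_ge0.
move=> y y0; rewrite horner_coef mulr_suml.
apply: (le_trans (ler_norm_sum _ _ _)); apply: ler_sum => i _.
rewrite normrM -mulrA ler_wpM2l// normrX ger0_norm//.
have f0 : 0 < (i`!%:R : R) by rewrite ltr0n fact_gt0.
rewrite -ler_pdivrMl// mulrC; case: (i : nat) => [|k].
  rewrite expr0 fact0 divr1; have := expR_ge1Dx y; lra.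
have := expR_ge1Dxn k y0; lra.
Qed.

Lemma flat_cont0 P : {for 0, continuous (flat P)}.
Proof.
have [c c0 cP] := poly_expR_bound (P * 'X).
have f0 : flat P 0 = 0 by rewrite /flat ltxx.
have bound x : `|flat P x| <= c * `|x|.
  rewrite /flat; case: ifPn => [x0|_]; last by rewrite normr0 mulr_ge0.
  have y0 : 0 < x^-1 by rewrite invr_gt0.
  have := cP _ (ltW y0); rewrite hornerMX normrM (gtr0_norm y0) => h.
  rewrite normrM (gtr0_norm (expR_gt0 _)) (gtr0_norm x0) expRN ler_pdivrMr ?expR_gt0//.
  by rewrite mulrAC -ler_pdivrMr// .
suff h : flat P x @[x --> (0 : R)] --> (0 : R) by move: h; rewrite -{2}f0.
apply/cvgrPdist_le => e e0.
have d0 : 0 < e / (c + 1) by rewrite divr_gt0// ltr_wpDl.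
near=> x; rewrite sub0r normrN (le_trans (bound x))//.
have hx : `|x| <= e / (c + 1).
  near: x; have := @cvgr0_norm_le _ _ _ (nbhs (0:R)) _ id cvg_id _ d0.
  by apply.
rewrite ler_pdivlMr in hx; last by rewrite ltr_wpDl.
by rewrite mulrC (le_trans _ hx)// ler_wpM2l// lerDl.
Unshelve. all: by end_near. Qed.

(** At 0 by the criterion of Caratheodory: the difference quotient is the
    function attached to P * 'X, which is continuous at 0. *)
Lemma flat_derive P t :
  is_derive t (1 : R) (flat P) (flat ('X ^+ 2 * (P - P^`())) t).
Proof.
have [t0|t0|<-] := ltgtP 0 t.
- pose E (x : R) := P.[x^-1] * expR (- x^-1).
  apply: (@near_eq_is_derive _ _ _ E).
    near=> x; rewrite /flat; suff -> : 0 < x by [].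
    by near: x; exact: lt_nbhsr.
  have tn : t != 0 by rewrite gt_eqF.
  have iv : is_derive t (1 : R) (fun x : R => x^-1) (- t ^- 2).
    by apply: (is_derive_eq (is_deriveV tn (is_derive_id t (1 : R)))); rewrite [LHS]mulr1.
  have ni : is_derive t (1 : R) (fun x : R => - x^-1) (t ^- 2).
    by apply: (is_derive_eq (is_deriveN iv)); rewrite opprK.
  have d1 := is_derive1_comp (is_derive_poly P t^-1) iv.
  have d2 := @is_derive1_comp _ expR (fun x : R => - x^-1) t _ _ (is_derive_expR (- t^-1)) ni.
  apply: (is_derive_eq (is_deriveM d1 d2)).
  rewrite /flat t0 !hornerE /= /GRing.scale /= exprVn; ring.
- apply: (@near_eq_is_derive _ _ _ (cst 0)).
    near=> x; rewrite /flat ifF//; apply/negbTE; rewrite -leNgt.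
    by near: x; apply: filterS (lt_nbhsl t0) => x /ltW.
  apply: (is_derive_eq (is_derive_cst (0 : R) t (1 : R))).
  by rewrite /flat ifF//; apply/negbTE; rewrite -leNgt ltW.
- have -> : flat ('X^2 * (P - P^`())) 0 = 0 by rewrite /flat ltxx.
  apply/is_derive1_caratheodory; exists (flat (P * 'X)); split.
  + move=> z; rewrite {2}/flat ltxx !subr0 /flat; case: ifP => [z0|_]; last by rewrite mul0r.
    have zn : z != 0 by rewrite gt_eqF.
    rewrite hornerMX; move: (P.[_]) (expR _) => a b; field.
    by rewrite zn.
  + exact: flat_cont0.
  + by rewrite /flat ltxx.
Unshelve. all: by end_near. Qed.

Lemma Dn_flat k P : Dn k (flat P).
Proof.
elim: k P => [//|k IH] P; exists (flat ('X ^+ 2 * (P - P^`()))) => //.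
exact: flat_derive.
Qed.

Lemma flat1_gt0 x : 0 < x -> 0 < flat 1 x.
Proof. by move=> x0; rewrite /flat x0 hornerC mul1r expR_gt0. Qed.
Lemma flat1_le0 x : x <= 0 -> flat 1 x = 0.
Proof. by move=> x0; rewrite /flat ltNge x0. Qed.
Lemma flat1_ge0 x : 0 <= flat 1 x.
Proof. by have [/flat1_gt0/ltW//|/flat1_le0 ->] := ltP 0 x. Qed.

Section Step.
Variable d : R.
Hypothesis d0 : 0 < d.

Definition sden (x : R) : R := flat 1 (1 * x + d) + flat 1 (- 1 * x + d).
(** A smooth function that is 0 before - d and 1 after d.  A difference of two
    translates of it is a test function whose derivative is a difference of two
    bumps. *)
Definition step (x : R) : R := flat 1 (1 * x + d) * (sden x)^-1.
Definition dflat (x : R) : R := flat ('X ^+ 2) x.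
Definition dstep (x : R) : R :=
  (dflat (1 * x + d) * flat 1 (- 1 * x + d) + flat 1 (1 * x + d) * dflat (- 1 * x + d)) *
  ((sden x)^-1 * (sden x)^-1).

Lemma sden_gt0 x : 0 < sden x.
Proof.
rewrite /sden; have [h|h] := ltP 0 (1 * x + d).
  by rewrite ltr_pwDl ?flat1_gt0 ?flat1_ge0.
rewrite ltr_wpDl ?flat1_ge0//; apply: flat1_gt0; move: d0 h => d0' h; lra.
Qed.

Lemma smooth_step : smooth step.
Proof.
move=> k; apply: Dn_mul; first by apply: Dn_affine; exact: Dn_flat.
apply: Dn_inv => [t|]; first by rewrite gt_eqF ?sden_gt0.
by apply: Dn_add; apply: Dn_affine; exact: Dn_flat.
Qed.

Lemma step_derive x : is_derive x (1 : R) step (dstep x).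
Proof.
have f1 y : is_derive y (1 : R) (flat 1) (dflat y).
  apply: (is_derive_eq (flat_derive 1 y)).
  by rewrite derivC subr0 mulr1.
have dp := @is_derive1_comp _ (flat 1) (fun x => 1 * x + d) x _ _ (f1 _) (is_derive_affine 1 d x).
have dm := @is_derive1_comp _ (flat 1) (fun x => - 1 * x + d) x _ _ (f1 _) (is_derive_affine (- 1) d x).
have dd := is_deriveD dp dm.
have sn : sden x != 0 by rewrite gt_eqF ?sden_gt0.
have di := @is_deriveV _ sden x _ _ sn dd.
apply: (is_derive_eq (is_deriveM dp di)).
rewrite /dstep /GRing.scale /=.
have -> : sden x ^- 2 = (sden x)^-1 * (sden x)^-1 by rewrite expr2 invfM.
rewrite -[flat 1 (1 * x + d)](addrK (flat 1 (- 1 * x + d))) -/(sden x).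
set s := sden x; field.
by rewrite sn.
Qed.

Lemma dstep_ge0 x : 0 <= dstep x.
Proof.
have df y : 0 <= dflat y.
  rewrite /dflat /flat; case: ifP => // y0.
  by rewrite hornerXn mulr_ge0 ?expR_ge0// exprn_ge0// invr_ge0 ltW.
by rewrite mulr_ge0 ?addr_ge0 ?mulr_ge0 ?flat1_ge0 ?invr_ge0// ltW// sden_gt0.
Qed.

Lemma step_lo x : x <= - d -> step x = 0.
Proof. by move=> h; rewrite /step flat1_le0 ?mul0r//; lra. Qed.

Lemma step_hi x : d <= x -> step x = 1.
Proof.
move=> h; have e : sden x = flat 1 (1 * x + d).
  by rewrite /sden [X in _ + X]flat1_le0 ?addr0//; lra.
by rewrite /step -e divff// gt_eqF// sden_gt0.
Qed.

Lemma dstep_out x : d < `|x| -> dstep x = 0.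
Proof.
rewrite ltr_normr => /orP h.
have df y : y <= 0 -> dflat y = 0 by move=> y0; rewrite /dflat /flat ltNge y0.
case: h => h; rewrite /dstep.
  by rewrite (@flat1_le0 (- 1 * x + d)) ?(df (- 1 * x + d)) ?mulr0 ?addr0 ?mul0r//; lra.
by rewrite (@flat1_le0 (1 * x + d)) ?(df (1 * x + d)) ?mul0r ?addr0 ?mul0r//; lra.
Qed.

End Step.
End SmoothStep.

(** * Weak derivatives of scalar functions *)

Section WeakDerivatives.
Variable R : realType.
Local Notation C := R[i].
Local Notation mu := (@lebesgue_measure R).
Local Notation I01 := (`]0, 1[%classic : set R).
Local Notation It := (@It R).
Implicit Types f fc g u v phi : R -> R.

Lemma It_ae f g : measurable_fun I01 f -> measurable_fun I01 g ->
  ae01 (fun t => f t = g t) -> It f = It g.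
Proof.
move=> mf mg h; congr fine; apply: ae_eq_integral => //.
- exact/measurable_EFinP.
- exact/measurable_EFinP.
- move: h; apply: (@filterS _ (almost_everywhere mu) _) => t ft It_.
  by rewrite ft.
Qed.

Lemma ae01_and (P Q : R -> Prop) : ae01 P -> ae01 Q -> ae01 (fun t => P t /\ Q t).
Proof.
apply: (@filterS2 _ (almost_everywhere mu) _) => t p q It_.
by split; [exact: p|exact: q].
Qed.

Lemma ae01_imp (P Q : R -> Prop) :
  (forall t, I01 t -> P t -> Q t) -> ae01 P -> ae01 Q.
Proof.
move=> h; apply: (@filterS _ (almost_everywhere mu) _) => t p It_.
by apply: h => //; exact: p.
Qed.

Lemma ae01_T (P : R -> Prop) : (forall t, I01 t -> P t) -> ae01 P.
Proof. by move=> h; apply: aeW => t; exact: h. Qed.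

(** The fundamental theorem of calculus, for continuous derivatives. *)
Lemma C1_int (G : R -> R) : (forall t, derivable G t 1) ->
  continuous (derive1 G) ->
  L1 (derive1 G) /\ forall t, 0 <= t <= 1 -> prim (derive1 G) t = G t - G 0.
Proof.
move=> dG cG.
have i1 : L1 (derive1 G).
  have h : mu.-integrable (`[0, 1]%classic : set R) (EFin \o derive1 G).
    apply: continuous_compact_integrable; first exact: segment_compact.
    exact: continuous_subspaceT.
  by apply: integrableS h => //; exact: subset_itv_oo_cc.
split=> // t /andP[]; rewrite le_eqVlt => /orP[/eqP <- _|t0 t1].
  by rewrite prim0 subrr.
rewrite primE//; last by rewrite (ltW t0).
have Gc : continuous G.
  by move=> s; apply/differentiable_continuous/derivable1_diffP.
have cw : {within `[0, t], continuous (derive1 G)} by exact: continuous_subspaceT.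
have dw : derivable_oo_LRcontinuous G 0 t.
  split; first by move=> s _; exact: dG.
    by apply: cvg_at_right_filter; exact: Gc.
  by apply: cvg_at_left_filter; exact: Gc.
by rewrite /parameterized_integral /Rintegral (continuous_FTC2 t0 cw dw).
Qed.

Section Test.
Variable phi : R -> R.
Hypothesis tphi : test_function phi.
Let dphi := derive1 phi.

Lemma test_derivable t : derivable phi t 1.
Proof. by have [h _ _] := tphi; have := h 0%N t. Qed.

Lemma test_deriv_continuous : continuous dphi.
Proof.
move=> t; have [h _ _] := tphi; have := h 1%N t; rewrite derive1n1 => d.
exact/differentiable_continuous/derivable1_diffP.
Qed.

Lemma test_out t : ~ I01 t -> phi t = 0.
Proof.
move=> nt; apply/eqP/negP => /negP p0; apply: nt.
by have [_ _] := tphi; apply; apply: subset_closure.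
Qed.

Lemma test_dL1 : L1 dphi.
Proof. by have [] := C1_int test_derivable test_deriv_continuous. Qed.

Lemma test_prim t : 0 <= t <= 1 -> phi t = prim dphi t.
Proof.
have [_ h] := C1_int test_derivable test_deriv_continuous => /h ->.
by rewrite (test_out (t := 0)) ?subr0//= in_itv/= ltxx.
Qed.

Lemma test_int : It dphi = 0.
Proof. by rewrite -prim1 -test_prim ?ler01 ?lexx// test_out//= in_itv/= ltxx andbF. Qed.

End Test.

(** Integration by parts; the constant a disappears because the derivative of a
    test function has integral 0. *)
Lemma prim_weak (a : R) f g phi : L1 g -> measurable_fun I01 f ->
  ae01 (fun t => f t = a + prim g t) -> test_function phi ->
  It (fun t => derive1 phi t * f t) = - It (fun t => phi t * g t).
Proof.
move=> ig mf fE tp; have id := test_dL1 tp.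
have md := L1_mfun id.
have mp := prim_mfun ig.
have pg : It (fun t => phi t * g t) = It (fun t => prim (derive1 phi) t * g t).
  apply: eq_It => t; rewrite /= in_itv/= => /andP[t0 t1].
  by rewrite (test_prim tp) ?ltW.
have i1 := prim_bound_L1M id ig.
have := ibp_prim id ig; rewrite test_int// mul0r -pg => /eqP.
rewrite addr_eq0 => /eqP <-.
transitivity (It (fun t => a * derive1 phi t + derive1 phi t * prim g t)).
  apply: It_ae; first exact: measurable_funM.
  - by apply: measurable_funD; apply: measurable_funM.
  - by apply: ae01_imp fE => t _ ->; rewrite mulrDr (mulrC a).
by rewrite ItD ?ItZ ?test_int ?mulr0 ?add0r//; exact: L1Z.
Qed.

(** The difference w between fc and the primitive is continuous and orthogonal to
    the derivatives of all test functions.  A difference of two translated steps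
    has as its derivative two bumps, one near s and one near t, so the means of w
    near s and near t agree, and w is constant. *)
Lemma weak_prim f fc g : L1 g -> measurable_fun I01 f ->
  {within `[0, 1], continuous fc} -> ae01 (fun t => f t = fc t) ->
  (forall phi, test_function phi ->
     It (fun t => derive1 phi t * f t) = - It (fun t => phi t * g t)) ->
  forall t, 0 <= t <= 1 -> fc t = fc 0 + prim g t.
Proof.
move=> ig mf cfc ffc wd.
pose w t := fc t - prim g t.
have cw : {within `[0, 1], continuous w}.
  by move=> x; apply: cvgB; [exact: cfc|exact: prim_continuous].
suff wE : forall t, 0 <= t <= 1 -> w t = w (2^-1).
  move=> t t01; have := wE t t01; have := wE 0; rewrite lexx ler01 => /(_ isT).
  by rewrite /w prim0; lra.
have mw0 : measurable_fun (`[0, 1]%classic : set (measurableTypeR R)) w.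
  by apply: subspace_continuous_measurable_fun.
have mw : measurable_fun I01 w by apply: measurable_funS mw0 => //; exact: subset_itv_oo_cc.
have mfc0 : measurable_fun (`[0, 1]%classic : set (measurableTypeR R)) fc.
  by apply: subspace_continuous_measurable_fun.
have mfc : measurable_fun I01 fc by apply: measurable_funS mfc0 => //; exact: subset_itv_oo_cc.
have wbnd : exists M, forall t, I01 t -> `|w t| <= M.
  have [M MP] : bounded_set (w @` `[0, 1]).
    by apply: compact_bounded; apply: continuous_compact => //; exact: segment_compact.
  exists (M + 1) => t tI; apply: (MP.2 (M + 1)); first by rewrite ltrDl.
  by exists t => //; exact: subset_itv_oo_cc.
have [M wM] := wbnd.
have orth phi : test_function phi -> It (fun t => derive1 phi t * w t) = 0.
  move=> tp; have id := test_dL1 tp; have md := L1_mfun id.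
  have e1 := prim_weak (a := 0) ig (prim_mfun ig) (ae01_T (fun t _ => esym (add0r (prim g t)))) tp.
  have e2 := wd _ tp.
  have e3 : It (fun t => derive1 phi t * f t) = It (fun t => derive1 phi t * fc t).
    apply: It_ae; [exact: measurable_funM|exact: measurable_funM|].
    by apply: ae01_imp ffc => t _ ->.
  have i1 := prim_bound_L1M id ig.
  have i2 : L1 (fun t => derive1 phi t * w t).
    have : L1 (fun t => w t * derive1 phi t) by exact: (L1M_bound mw wM).
    by congr L1; apply/funext => t; rewrite mulrC.
  have : It (fun t => derive1 phi t * w t + derive1 phi t * prim g t) =
      It (fun t => derive1 phi t * fc t).
    by apply: eq_It => t _; rewrite /w; ring.
  rewrite ItD// e1 -e3 e2; lra.
have wconst s t : I01 s -> I01 t -> w s = w t.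
  move=> Is It_; apply/eqP; rewrite -subr_eq0 -normr_le0.
  apply/ler_addgt0Pr => e e0; rewrite add0r.
  have cws x : I01 x -> exists2 d : R, 0 < d &
      forall y, `|y - x| <= d -> I01 y /\ `|w y - w x| <= e / 2.
    move=> Ix.
    have cx : {for x, continuous w}.
      have [h _ _] := (continuous_within_itvP w (@ltr01 R)).1 cw.
      by apply: h; rewrite inE.
    have n1 : \forall y \near x, `|w x - w y| <= e / 2.
      by move/cvgrPdist_le : cx; apply; rewrite divr_gt0.
    have n2 : \forall y \near x, I01 y.
      by move: Ix; rewrite /= in_itv/= => h; apply: near_in_itvoo; rewrite inE.
    have [d /= d0 hd] := (nbhs_ballP _ _).1 (filterI n1 n2).
    exists (d / 2); first by rewrite divr_gt0.
    move=> y yd; have : ball x d y.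
      by rewrite /ball/= distrC (le_lt_trans yd)// ltr_pdivrMr// ltr_pMr// ltr1n.
    by move=> /hd[h1 h2]; rewrite distrC; split.
  have [d1 d10 h1] := cws s Is; have [d2 d20 h2] := cws t It_.
  pose d := Num.min d1 d2.
  have d0 : 0 < d by rewrite lt_min d10 d20.
  have dd1 : d <= d1 by rewrite ge_min lexx.
  have dd2 : d <= d2 by rewrite ge_min lexx orbT.
  pose h z x := step d (1 * x + (- z)).
  have hder z x : is_derive x (1 : R) (h z) (dstep d (1 * x + - z)).
    have := @is_derive1_comp _ (step d) (fun x => 1 * x + - z) x _ _
       (step_derive d0 _) (is_derive_affine 1 (- z) x).
    by rewrite mulr1.
  pose phi x := h s x - h t x.
  have phid : derive1 phi = fun x => dstep d (1 * x - s) - dstep d (1 * x - t).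
    apply/funext => x; rewrite derive1E.
    by have [] := is_deriveB (hder s x) (hder t x).
  have smh z : smooth (h z).
    by move=> k; apply: Dn_affine; exact: (smooth_step d0).
  have hdE z : derive1 (h z) = fun x => dstep d (1 * x - z).
    by apply/funext => x; rewrite derive1E; have [] := hder z x.
  have hd z x : derivable (h z) x 1 by have [] := hder z x.
  have hdc z : continuous (derive1 (h z)).
    move=> x; have := @smooth_derivable _ _ (smh z) 1%N x; rewrite derive1n1 => dd.
    exact/differentiable_continuous/derivable1_diffP.
  have nm z : `|z - d - z| <= d /\ `|z + d - z| <= d.
    have -> : z - d - z = - d by ring.
    have -> : z + d - z = d by ring.
    by rewrite normrN gtr0_norm.
  pose a := Num.min s t - d; pose b := Num.max s t + d.
  have sI : I01 (s - d) /\ I01 (s + d).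
    by split; [exact: (h1 _ (le_trans (nm s).1 dd1)).1|exact: (h1 _ (le_trans (nm s).2 dd1)).1].
  have tI : I01 (t - d) /\ I01 (t + d).
    by split; [exact: (h2 _ (le_trans (nm t).1 dd2)).1|exact: (h2 _ (le_trans (nm t).2 dd2)).1].
  have abI : `[a, b]%classic `<=` I01.
    have a0 : 0 < a.
      rewrite /a subr_gt0 lt_min; move: sI.1 tI.1; rewrite /= !in_itv/= !subr_gt0.
      by move=> /andP[-> _] /andP[-> _].
    have b1 : b < 1.
      rewrite /b -ltrBrDr gt_max; move: sI.2 tI.2; rewrite /= !in_itv/= !ltrBrDr.
      by move=> /andP[_ ->] /andP[_ ->].
    move=> x; rewrite /= !in_itv/= => /andP[ax xb].
    by rewrite (lt_le_trans a0 ax) (le_lt_trans xb b1).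
  have supp : [set x | phi x != 0] `<=` `[a, b].
    move=> x /= px; rewrite in_itv/=; apply/andP; split; rewrite leNgt; apply/negP => xa; move: px; apply/negP; rewrite negbK /phi /h.
      move: xa; rewrite /a ltrBrDr lt_min => /andP[xs xt].
      by rewrite !(step_lo) ?subrr// mul1r; lra.
    move: xa; rewrite /b -ltrBrDr gt_max => /andP[xs xt].
    by rewrite !(step_hi d0) ?subrr// mul1r; lra.
  have clsupp : closure [set x | phi x != 0] `<=` `[a, b].
    rewrite [X in _ `<=` X](closure_id _).1; first exact: closure_subset.
    exact: itv_closed.
  have tp : test_function phi.
    split.
    - apply: smooth_derivable => k; apply: Dn_add; first exact: smh.
      by apply: Dn_opp; exact: smh.
    - apply: (subclosed_compact _ (@segment_compact _ a b)) => //.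
      exact: closed_closure.
    - by apply: subset_trans abI.
  have key z : I01 (z - d) -> I01 (z + d) ->
      (forall y, `|y - z| <= d -> `|w y - w z| <= e / 2) ->
      L1 (fun x => dstep d (1 * x - z) * w x) /\
      `|It (fun x => dstep d (1 * x - z) * w x) - w z| <= e / 2.
    rewrite /= !in_itv/= => /andP[z1 z2] /andP[z3 z4] wz.
    have [iz pz] := C1_int (hd z) (hdc z); rewrite hdE in iz pz.
    have I1 : It (fun x => dstep d (1 * x - z)) = 1.
      rewrite -prim1 pz ?lexx ?ler01// /h (step_hi d0) ?step_lo ?subr0//; lra.
    have iw : L1 (fun x => dstep d (1 * x - z) * w x).
      have : L1 (fun x => w x * dstep d (1 * x - z)) by exact: (L1M_bound mw wM).
      by congr L1; apply/funext => x; rewrite mulrC.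
    split=> //.
    have -> : w z = It (fun x => w z * dstep d (1 * x - z)).
      by rewrite ItZ// I1 mulr1.
    rewrite -ItB//; last exact: L1Z.
    have ib : L1 (fun x => dstep d (1 * x - z) * w x - w z * dstep d (1 * x - z)).
      by apply: L1B => //; exact: L1Z.
    apply: (le_trans (It_norm ib)).
    have -> : e / 2 = It (fun x => e / 2 * dstep d (1 * x - z)).
      by rewrite ItZ// I1 mulr1.
    apply: It_le; [exact: L1_norm|exact: L1Z|move=> x _].
    rewrite mulrC -mulrBl normrM (ger0_norm (dstep_ge0 d0 _)).
    have [xz|xz] := leP `|x - z| d.
      by rewrite ler_wpM2r ?(dstep_ge0 d0)// wz.
    by rewrite dstep_out ?mulr0// mul1r.
  have [i1 k1] := key s sI.1 sI.2 (fun y hy => (h1 y (le_trans hy dd1)).2).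
  have [i2 k2] := key t tI.1 tI.2 (fun y hy => (h2 y (le_trans hy dd2)).2).
  have := orth phi tp; rewrite phid.
  have -> : (fun x => (dstep d (1 * x - s) - dstep d (1 * x - t)) * w x) =
    fun x => dstep d (1 * x - s) * w x - dstep d (1 * x - t) * w x.
    by apply/funext => x; rewrite mulrBl.
  rewrite ItB//; move: k1 k2; rewrite !ler_norml.
  move: (It _) (It _) (w s) (w t) => A B ws wt.
  move=> /andP[? ?] /andP[? ?] ?; apply/andP; split; lra.
have half : I01 (2^-1 : R).
  by rewrite /= in_itv/=; apply/andP; split; lra.
have [_ c0 c1] := (continuous_within_itvP w (@ltr01 R)).1 cw.
move=> t /andP[]; rewrite le_eqVlt => /orP[/eqP <- _|t0].
  have c0' : w x @[x --> 0^'+] --> w 2^-1.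
    apply: cvg_near_cst; near=> x.
  by apply: wconst => //; rewrite /= in_itv/=; apply/andP; split;
     near: x; [exact: nbhs_right_gt|exact: nbhs_right_lt].
  exact: (cvg_unique _ c0 c0').
rewrite le_eqVlt => /orP[/eqP ->|t1].
  have c1' : w x @[x --> 1^'-] --> w 2^-1.
    apply: cvg_near_cst; near=> x.
  by apply: wconst => //; rewrite /= in_itv/=; apply/andP; split;
     near: x; [exact: nbhs_left_gt|exact: nbhs_left_lt].
  exact: (cvg_unique _ c1 c1').
by apply: wconst => //; rewrite /= in_itv/= t0.
Unshelve. all: by end_near. Qed.

End WeakDerivatives.

(** * Matrix-valued functions of time *)

Section MatrixFunctions.
Variable R : realType.
Local Notation C := R[i].
Local Notation mu := (@lebesgue_measure R).
Local Notation I01 := (`]0, 1[%classic : set R).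
Local Notation It := (@It R).

Lemma ibp_affine (a b : R) (u v : R -> R) : L1 u -> L1 v ->
  L1 (fun t => u t * (b + prim v t)) /\ L1 (fun t => (a + prim u t) * v t) /\
  It (fun t => u t * (b + prim v t)) + It (fun t => (a + prim u t) * v t) =
  (a + It u) * (b + It v) - a * b.
Proof.
move=> hu hv.
have e1 : (fun t => u t * (b + prim v t)) = fun t => b * u t + u t * prim v t.
  by apply/funext => t; ring.
have e2 : (fun t => (a + prim u t) * v t) = fun t => a * v t + prim u t * v t.
  by apply/funext => t; ring.
have l1 := prim_bound_L1M hu hv.
have l2 : L1 (fun t => prim u t * v t).
  by apply: (L1_ext _ (prim_bound_L1M hv hu)) => t; rewrite mulrC.
rewrite e1 e2; split; first by apply: L1D => //; exact: L1Z.
split; first by apply: L1D => //; exact: L1Z.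
rewrite !ItD ?ItZ//; try exact: L1Z.
have := ibp_prim hu hv; lra.
Qed.

(** Measurability and integrability are also tested by pairings; the entries are
    the pairings with the basis [unitv]. *)
Definition mxmeas p q (f : R -> 'M[C]_(p, q)) : Prop :=
  forall E, measurable_fun I01 (fun t => rinner E (f t)).

Definition mxL1 p q (f : R -> 'M[C]_(p, q)) : Prop :=
  forall E, L1 (fun t => rinner E (f t)).

Lemma mfun_ext (f g : R -> R) : (forall t, g t = f t) ->
  measurable_fun I01 f -> measurable_fun I01 g.
Proof. by move=> /funext ->. Qed.

Lemma mxmeasP p q (f : R -> 'M[C]_(p, q)) : mxmeas f <->
  forall i j, measurable_fun I01 (fun t => complex.Re (f t i j)) /\
              measurable_fun I01 (fun t => complex.Im (f t i j)).
Proof.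
split=> [h i j|h E].
  split.
    exact: (mfun_ext (fun t => Re_rinner i j (f t)) (h _)).
  exact: (mfun_ext (fun t => Im_rinner i j (f t)) (h _)).
apply: (mfun_ext (fun t => rinner_coord E (f t))).
apply: measurable_sum => -[[b i] j]; apply: measurable_funM => //=.
apply: (mfun_ext (fun t => rinner_unitv b i j (f t))).
by case: b; have [] := h i j.
Qed.

Lemma mxmeas_rinner p q (f g : R -> 'M[C]_(p, q)) : mxmeas f -> mxmeas g ->
  measurable_fun I01 (fun t => rinner (f t) (g t)).
Proof.
move=> mf mg; apply: (mfun_ext (fun t => rinner_coord (f t) (g t))).
apply: measurable_sum => c; apply: measurable_funM; last exact: mg.
exact: (mfun_ext (fun t => rinnerC (f t) _) (mf _)).
Qed.

Lemma mxmeasD p q (f g : R -> 'M[C]_(p, q)) : mxmeas f -> mxmeas g ->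
  mxmeas (fun t => f t + g t).
Proof.
move=> mf mg E; apply: (mfun_ext (fun t => rinnerDr E (f t) (g t))).
by apply: measurable_funD; [exact: mf|exact: mg].
Qed.

Lemma mxmeasZ p q (a : R) (f : R -> 'M[C]_(p, q)) : mxmeas f ->
  mxmeas (fun t => a%:C *: f t).
Proof.
move=> mf E; apply: (mfun_ext (fun t => rinnerZr a E (f t))).
by apply: measurable_funM => //; exact: mf.
Qed.

Lemma mxmeasB p q (f g : R -> 'M[C]_(p, q)) : mxmeas f -> mxmeas g ->
  mxmeas (fun t => f t - g t).
Proof.
move=> mf mg E; apply: (mfun_ext (fun t => rinnerBr E (f t) (g t))).
by apply: measurable_funB; [exact: mf|exact: mg].
Qed.

Lemma L2P p q (f : R -> 'M[C]_(p, q)) :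
  L2 f <-> mxmeas f /\ L1 (fun t => rinner (f t) (f t)).
Proof.
have e : (\int[mu]_(t in I01) (mxnorm (f t) ^+ 2)%:E =
     \int[mu]_(t in I01) `|(rinner (f t) (f t))%:E|)%E.
  by apply: eq_integral => t _; rewrite normE gee0_abs// lee_fin rinner_ge0.
split=> [[/mxmeasP mf fi]|[mf fi]].
  split=> //; apply/integrableP; split; last by rewrite -e.
  by apply/measurable_EFinP; exact: mxmeas_rinner.
split; first exact/mxmeasP.
by rewrite e; have /integrableP[] := fi.
Qed.

Lemma L2_coordL1 p q (f : R -> 'M[C]_(p, q)) : L2 f -> mxL1 f.
Proof.
move=> /L2P[mf fi] E; apply: (@L1_le _ _ (fun t => rinner E E + rinner (f t) (f t))).
- exact: mf.
- by apply: L1D => //; exact: L1_cst.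
- move=> t _; rewrite ler_norml; have := rinner_le E (f t).
  have := rinner_le (- E) (f t); rewrite !rinnerNl rinnerNr opprK.
  have := rinner_ge0 E; have := rinner_ge0 (f t).
  move: (rinner E E) (rinner (f t) (f t)) (rinner E (f t)) => a b c *.
  by apply/andP; split; lra.
Qed.

Lemma L1_rinner_L2 p q (f g : R -> 'M[C]_(p, q)) : L2 f -> L2 g ->
  L1 (fun t => rinner (f t) (g t)).
Proof.
move=> /L2P[mf fi] /L2P[mg gi].
apply: (@L1_le _ _ (fun t => rinner (f t) (f t) + rinner (g t) (g t))).
- exact: mxmeas_rinner.
- exact: L1D.
- move=> t _; rewrite ler_norml; have := rinner_le (f t) (g t).
  have := rinner_le (- f t) (g t); rewrite !rinnerNl rinnerNr opprK.
  have := rinner_ge0 (f t); have := rinner_ge0 (g t).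
  move: (rinner (f t) (f t)) (rinner (g t) (g t)) (rinner (f t) (g t)) => a b c *.
  by apply/andP; split; lra.
Qed.

Lemma L2_bound p q (f : R -> 'M[C]_(p, q)) (M : R) : mxmeas f ->
  (forall t, I01 t -> rinner (f t) (f t) <= M) -> L2 f.
Proof.
move=> mf h; apply/L2P; split=> //; apply: (@L1_bound _ _ M).
  exact: mxmeas_rinner.
by move=> t It_; rewrite ger0_norm ?rinner_ge0// h.
Qed.

Lemma weak_derivativeE p q (f g : R -> 'M[C]_(p, q)) :
  mxL1 f -> mxL1 g -> weak_derivative f g ->
  forall phi, test_function phi -> forall E,
  It (fun t => derive1 phi t * rinner E (f t)) =
  - It (fun t => phi t * rinner E (g t)).
Proof.
move=> lf lg wd phi tp E.
have id := test_dL1 tp.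
have [M phiM] : exists M, forall t, I01 t -> `|phi t| <= M.
  exists (It (fun s => `|derive1 phi s|)) => t /I01_le t01.
  by rewrite (test_prim tp)//; exact: prim_le.
have mphi : measurable_fun I01 phi.
  apply: (eq_measurable_fun (prim (derive1 phi))); last exact: prim_mfun.
  by move=> t /set_mem /I01_le t01; rewrite (test_prim tp).
have [M' dM] : exists M, forall t, I01 t -> `|derive1 phi t| <= M.
  have [K KP] : bounded_set (derive1 phi @` `[0, 1]).
    apply: compact_bounded; apply: continuous_compact; last exact: segment_compact.
    exact/continuous_subspaceT/(test_deriv_continuous tp).
  exists (K + 1) => t tI; apply: (KP.2 (K + 1)); first by rewrite ltrDl.
  by exists t => //; exact: subset_itv_oo_cc.
have md := L1_mfun id.
have Lf E' : L1 (fun t => derive1 phi t * rinner E' (f t)).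
  by apply: (L1M_bound md dM); exact: lf.
have Lg E' : L1 (fun t => phi t * rinner E' (g t)).
  by apply: (L1M_bound mphi phiM); exact: lg.
pose e (c : bool * 'I_p * 'I_q) := unitv R c.1.1 c.1.2 c.2.
have key c : It (fun t => derive1 phi t * rinner (e c) (f t)) =
    - It (fun t => phi t * rinner (e c) (g t)).
  case: c => [[b i] j]; have [h1 h2] := wd phi tp i j.
  rewrite /e /=; case: b.
    have -> : (fun t => derive1 phi t * rinner (unitv R true i j) (f t)) = (fun t => derive1 phi t * complex.Im (f t i j)).
      by apply/funext => t; rewrite Im_rinner.
    have -> : (fun t => phi t * rinner (unitv R true i j) (g t)) = (fun t => phi t * complex.Im (g t i j)).
      by apply/funext => t; rewrite Im_rinner.
    exact: h2.
  have -> : (fun t => derive1 phi t * rinner (unitv R false i j) (f t)) = (fun t => derive1 phi t * complex.Re (f t i j)).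
    by apply/funext => t; rewrite Re_rinner.
  have -> : (fun t => phi t * rinner (unitv R false i j) (g t)) = (fun t => phi t * complex.Re (g t i j)).
    by apply/funext => t; rewrite Re_rinner.
  exact: h1.
have -> : (fun t => derive1 phi t * rinner E (f t)) =
    fun t => \sum_c rinner E (e c) * (derive1 phi t * rinner (e c) (f t)).
  apply/funext => t; rewrite rinner_coord mulr_sumr; apply: eq_bigr => c _.
  by rewrite mulrCA.
have -> : (fun t => phi t * rinner E (g t)) =
    fun t => \sum_c rinner E (e c) * (phi t * rinner (e c) (g t)).
  apply/funext => t; rewrite rinner_coord mulr_sumr; apply: eq_bigr => c _.
  by rewrite mulrCA.
rewrite !It_sum; try by move=> c _; apply: L1Z.
rewrite -sumrN; apply: eq_bigr => c _.
by rewrite !ItZ// key mulrN.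
Qed.

(** f is absolutely continuous on [0, 1] with derivative g. *)
Definition primitive_mx p q (f g : R -> 'M[C]_(p, q)) : Prop :=
  forall E t, 0 <= t <= 1 ->
    rinner E (f t) = rinner E (f 0) + prim (fun s => rinner E (g s)) t.

Lemma weak_primitive p q (f g : R -> 'M[C]_(p, q)) a b :
  L2 f -> mxL1 g -> boundary_values f a b -> weak_derivative f g ->
  exists fc, [/\ ae01 (fun t => f t = fc t), fc 0 = a, fc 1 = b &
    primitive_mx fc g].
Proof.
move=> lf lg [fc [cfc ffc f0 f1]] wd; exists fc; split => // E t t01.
apply: (@weak_prim _ (fun t => rinner E (f t)) (fun t => rinner E (fc t)) _ (lg E)) => //.
- by have /L2P[] := lf.
- apply/subspace_continuousP => x x01.
  by apply: norm_cvg0_rinner; exact: cfc.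
- by apply: ae01_imp ffc => s _ ->.
- by move=> phi tp; apply: weak_derivativeE => //; exact: L2_coordL1.
Qed.

Lemma primitive_weak p q (f fc g : R -> 'M[C]_(p, q)) :
  mxmeas f -> mxL1 g -> ae01 (fun t => f t = fc t) -> primitive_mx fc g ->
  weak_derivative f g.
Proof.
move=> mf lg ffc pr phi tp i j.
have key E : It (fun t => derive1 phi t * rinner E (f t)) =
     - It (fun t => phi t * rinner E (g t)).
  apply: (prim_weak (a := rinner E (fc 0))); [exact: lg|exact: mf| |exact: tp].
  by apply: ae01_imp ffc => t /I01_le t01 ->; exact: pr.
split.
  apply: etrans (etrans (key (unitv R false i j)) _); last congr (- _).
    by apply: eq_It => t _; rewrite rinner_unitv.
  by apply: eq_It => t _; rewrite rinner_unitv.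
apply: etrans (etrans (key (unitv R true i j)) _); last congr (- _).
  by apply: eq_It => t _; rewrite rinner_unitv.
by apply: eq_It => t _; rewrite rinner_unitv.
Qed.

Lemma primitive_boundary p q (f fc g : R -> 'M[C]_(p, q)) :
  mxL1 g -> ae01 (fun t => f t = fc t) -> primitive_mx fc g ->
  boundary_values f (fc 0) (fc 1).
Proof.
move=> lg ffc pr; exists fc; split => // t t01.
apply: rinner_cvg_norm0 => E.
have := prim_continuous (lg E) => /subspace_continuousP /(_ t t01) h.
rewrite (pr _ _ t01).
have h' : (rinner E (fc 0) + prim (fun s => rinner E (g s)) s) @[s --> within `[0, 1] (nbhs t)]
   --> rinner E (fc 0) + prim (fun s => rinner E (g s)) t.
  by apply: cvgD => //; exact: cvg_cst.
apply: cvg_trans h'; apply: near_eq_cvg.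
have : \forall s \near within `[0, 1] (nbhs t), `[0, 1]%classic s by exact: withinT.
by apply: filterS => s; rewrite /= in_itv/= => s01; rewrite (pr E s s01).
Qed.

Lemma primitive_meas p q (f g : R -> 'M[C]_(p, q)) : mxL1 g -> primitive_mx f g -> mxmeas f.
Proof.
move=> lg pr E.
apply: (eq_measurable_fun (fun t => rinner E (f 0) + prim (fun s => rinner E (g s)) t)).
  by move=> t /set_mem /I01_le t01; rewrite -pr.
by apply: measurable_funD => //; exact: (prim_mfun (lg E)).
Qed.

Lemma primitive_coord_bound p q (f g : R -> 'M[C]_(p, q)) E : mxL1 g -> primitive_mx f g ->
  forall t, I01 t -> `|rinner E (f t)| <= `|rinner E (f 0)| + It (fun s => `|rinner E (g s)|).
Proof.
move=> lg pr t /I01_le t01; rewrite pr// (le_trans (ler_normD _ _))// lerD2l.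
exact: (prim_le (lg E)).
Qed.

Lemma primitive_L2 p q (f g : R -> 'M[C]_(p, q)) : mxL1 g -> primitive_mx f g -> L2 f.
Proof.
move=> lg pr; have mf := primitive_meas lg pr.
apply: (@L2_bound _ _ _ (\sum_(c : bool * 'I_p * 'I_q)
   (`|rinner (unitv R c.1.1 c.1.2 c.2) (f 0)| +
    It (fun s => `|rinner (unitv R c.1.1 c.1.2 c.2) (g s)|)) ^+ 2)) => // t tI.
rewrite rinner_coord; apply: ler_sum => c _.
rewrite rinnerC -expr2 -real_normK ?num_real// lerXn2r ?nnegrE//.
  by rewrite addr_ge0// It_ge0.
exact: primitive_coord_bound.
Qed.

(** Integration by parts for the pairing of two curves, coordinate by
    coordinate. *)
Lemma ibp_mx p q (f f' g g' : R -> 'M[C]_(p, q)) :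
  mxL1 f' -> mxL1 g' -> primitive_mx f f' -> primitive_mx g g' ->
  It (fun t => rinner (f' t) (g t) + rinner (f t) (g' t)) =
  rinner (f 1) (g 1) - rinner (f 0) (g 0).
Proof.
move=> lf lg pf pg.
pose e (c : bool * 'I_p * 'I_q) := unitv R c.1.1 c.1.2 c.2.
pose u c t := rinner (e c) (f' t); pose v c t := rinner (e c) (g' t).
pose a c := rinner (e c) (f 0); pose b c := rinner (e c) (g 0).
have fE c t : 0 <= t <= 1 -> rinner (e c) (f t) = a c + prim (u c) t by exact: pf.
have gE c t : 0 <= t <= 1 -> rinner (e c) (g t) = b c + prim (v c) t by exact: pg.
have ib c := ibp_affine (a c) (b c) (lf (e c)) (lg (e c)).
transitivity (It (fun t => \sum_c (u c t * (b c + prim (v c) t) + (a c + prim (u c) t) * v c t))).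
  apply: eq_It => t /I01_le t01.
  rewrite rinner_coord [X in _ + X]rinner_coord -big_split; apply: eq_bigr => c _ /=.
  by rewrite -/(e c) (rinnerC (f' t)) (rinnerC (f t)) fE// gE.
rewrite It_sum => [|c _]; last by have [h1 [h2 _]] := ib c; exact: L1D.
rewrite rinner_coord [X in _ - X]rinner_coord -sumrB; apply: eq_bigr => c _.
have [h1 [h2 h3]] := ib c.
have t1 : 0 <= (1 : R) <= 1 by rewrite ler01 lexx.
by rewrite ItD// h3 -/(e c) (rinnerC (f 1)) (rinnerC (f 0)) (fE c 1 t1) (gE c 1 t1).
Qed.

End MatrixFunctions.

(** * Weak duality *)

Section WeakDuality.
Variable R : realType.
Local Notation C := R[i].
Local Notation mu := (@lebesgue_measure R).
Local Notation I01 := (`]0, 1[%classic : set R).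
Local Notation It := (@It R).

(** The integral of a nonnegative function is a supremum over simple functions
    below it, so it is monotone without any measurability.  This matters for the
    action, because t |-> F (rho t) (m t) is not known to be measurable. *)
Lemma le_lower_integral (f g : R -> \bar R) :
  (forall t, I01 t -> 0 <= f t)%E -> (forall t, I01 t -> f t <= g t)%E ->
  (\int[mu]_(t in I01) f t <= \int[mu]_(t in I01) g t)%E.
Proof.
move=> f0 fg.
have g0 t : I01 t -> (0 <= g t)%E by move=> tI; exact: le_trans (f0 t tI) (fg t tI).
rewrite !ge0_integralE//; apply: ge_ereal_sup => _ [h /= hf <-].
apply: ereal_sup_ubound; exists h => // t /=.
apply: (le_trans (hf t)); rewrite /patch; case: ifPn => // /set_mem; exact: fg.
Qed.

(** The integrand G need not be measurable: h is set to 0 on a null set outside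
    which it is below G, and its negative part is dropped. *)
Lemma It_le_lower (h : R -> R) (G : R -> \bar R) : L1 h ->
  (forall t, 0 <= G t)%E -> ae01 (fun t => (h t)%:E <= G t)%E ->
  ((It h)%:E <= \int[mu]_(t in I01) G t)%E.
Proof.
move=> lh G0 [N [mN muN0 bad]].
pose h0 t := Num.max (h t) 0 * \1_(~` N) t.
have mmax : measurable_fun I01 (fun t => Num.max (h t) 0).
  by apply: measurable_maxr => //; exact: L1_mfun.
have mh0 : measurable_fun I01 h0.
  apply: measurable_funM => //; apply: measurable_funTS.
  by apply: measurable_indic; exact: measurableC.
have lmax : L1 (fun t => Num.max (h t) 0).
  apply: (@L1_le _ _ (fun t => `|h t|)) => //; first exact: L1_norm.
  move=> t _; rewrite ger0_norm ?le_max ?lexx ?orbT//.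
  by rewrite ge_max ler_norm /=.
have l0 : L1 h0.
  apply: (L1_le mh0 lmax) => t _; rewrite /h0.
  have m0 : 0 <= Num.max (h t) 0 by rewrite le_max lexx orbT.
  rewrite ger0_norm ?mulr_ge0// indicE; case: (_ \in _); rewrite ?mulr1// mulr0//.
have e1 : It (fun t => Num.max (h t) 0) = It h0.
  apply: It_ae => //; exists N; split => //.
  move=> t /= nt; apply: contrapT => tN; apply: nt => _.
  by rewrite /h0 indicE mem_set ?mulr1.
have s1 : It h <= It h0.
  by rewrite -e1; apply: It_le => // t _; rewrite le_max lexx.
apply: (@le_trans _ _ (It h0)%:E); first by rewrite lee_fin.
rewrite -It_EFin//; apply: le_lower_integral.
  by move=> t _; rewrite lee_fin mulr_ge0// le_max lexx orbT.
move=> t tI; rewrite /h0 indicE; have [/set_mem tN|_] := boolP (t \in ~` N).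
  have hG : ((h t)%:E <= G t)%E.
    by apply: contrapT => ng; apply: tN; apply: bad => /= k; apply: ng; exact: k.
  rewrite mulr1 /Num.max; case: ifP => // _; exact: G0.
by rewrite mulr0; exact: G0.
Qed.

Variables (n N : nat) (L : 'I_N -> 'M[C]_n).
Hypothesis hL : forall k, Herm (L k).
Variables rho0 rho1 : 'M[C]_n.

Lemma flux_mxL1 (m : R -> blockcol R n N) : L2 m -> mxL1 (fun t => flux L (m t)).
Proof.
move=> lm E; apply: (L1_ext _ (L2_coordL1 lm (nabla L (hpart E)))) => t.
by rewrite rinner_flux.
Qed.

(** Pairing the Hamilton-Jacobi inequality with rho, together with the Fenchel
    form of F at b = nabla lam. *)
Lemma fenchel (rho A : 'M[C]_n) (lam : 'M[C]_n) (m : blockcol R n N) :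
  Herm lam -> Hpsd (- (A + (2^-1 : R)%:C *: gram L lam)) ->
  ((rinner A rho + rinner lam (flux L m))%:E <= F rho m)%E.
Proof.
move=> hlam hA; have [p|np] := pselect (Hpsd rho); last first.
  have -> : F rho m = +oo%E; last exact: leey.
  rewrite /F; case: asboolP => [/pd_psd//|_]; by case: asboolP.
apply: le_trans (F_ge m (nabla L lam) p); rewrite lee_fin.
have := psd_rinner_ge0 hA p.
rewrite rinnerNl rinnerDl rinnerZl (rinnerC _ rho) (rinnerC _ rho) gram_rinner.
rewrite -rinner_flux_herm//.
move: (rinner rho A) (rinner (nabla L lam) _) (rinner (nabla L lam) m) => a b c; lra.
Qed.

(** The integral of [fenchel]: along the continuous representatives, the left
    side is the derivative of <lam, rho>. *)
Lemma weak_duality (rho lam dlam : R -> 'M[C]_n) (m : R -> blockcol R n N)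
    (l0 l1 : 'M[C]_n) :
  admissible L rho0 rho1 rho m -> W12H lam dlam -> boundary_values lam l0 l1 ->
  ae01 (fun t => Hpsd (- (dlam t +
          2^-1 *: ((nabla L (lam t) ^t*) *m nabla L (lam t))))) ->
  ((rinner l1 rho1 - rinner l0 rho0)%:E <= action rho m)%E.
Proof.
move=> [[lrho hrho] lm tr1 bv wd] [[llam hlam] [ldl hdl] wdl] bvl con.
have lf := flux_mxL1 lm.
have {}wd : weak_derivative rho (fun t => flux L (m t)).
  by under eq_fun do rewrite flux_def.
have [rc [rrc rc0 rc1 prc]] := weak_primitive lrho lf bv wd.
have [lc [llc lc0 lc1 plc]] := weak_primitive llam (L2_coordL1 ldl) bvl wdl.
rewrite -lc1 -rc1 -lc0 -rc0 -(ibp_mx (L2_coordL1 ldl) lf plc prc).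
apply: It_le_lower.
- pose e (c : bool * 'I_n * 'I_n) := unitv R c.1.1 c.1.2 c.2.
  have L2lc := primitive_L2 (L2_coordL1 ldl) plc.
  have L2rc := primitive_L2 lf prc.
  apply: L1D; first exact: L1_rinner_L2.
  apply: (@L1_ext _ (fun t => \sum_c rinner (e c) (lc t) * rinner (e c) (flux L (m t)))).
    by move=> t; rewrite [RHS]rinner_coord; apply: eq_bigr => c _; rewrite (rinnerC (lc t)).
  apply: L1_sum => c _.
  apply: (L1M_bound _ (primitive_coord_bound (e c) (L2_coordL1 ldl) plc) (lf _)).
  exact: (primitive_meas (L2_coordL1 ldl) plc).
- by move=> t; exact: F_ge0.
- have := ae01_and (ae01_and rrc llc) con; apply: ae01_imp => t tI [[<- <-] c].
  apply: fenchel; first exact: hlam.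
  by rewrite -half_complex.
Qed.

End WeakDuality.

(** * A path of finite action *)

Section ReferencePath.
Variable R : realType.
Local Notation C := R[i].
Local Notation mu := (@lebesgue_measure R).
Local Notation I01 := (`]0, 1[%classic : set R).
Variables (n N : nat) (L : 'I_N -> 'M[C]_n).
Hypothesis hL : forall k, Herm (L k).
Variables rho0 rho1 : 'M[C]_n.

(** The segment from rho0 to rho1 stays positive definite, and by convexity of
    the kinetic energy its action is finite. *)
Lemma reference_path : Dpd rho0 -> Dpd rho1 -> ker_nabla_perp L (rho0 - rho1) ->
  exists (rho : R -> 'M[C]_n) (m : R -> blockcol R n N),
    admissible L rho0 rho1 rho m /\ (action rho m < +oo)%E.
Proof.
move=> [p0 t0] [p1 t1] perp.
have [m0 m0E] : exists m, flux L m = rho1 - rho0.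
  apply: ker_perp_range => //; have [h k] := perp; split.
    by rewrite -opprB; exact: HermN.
  move=> X /k; rewrite !mxinnerE => h'.
  by rewrite -opprB mulmxN linearN /= h' oppr0.
pose rho (t : R) := (1 - t)%:C *: rho0 + t%:C *: rho1.
have rE t : rho t = rho0 + t%:C *: (rho1 - rho0).
  by apply: rinner_nondeg => E; rewrite /rho !(rinnerDr, rinnerBr, rinnerZr, rinnerNr); ring.
have h0 := psd_herm (pd_psd p0); have h1 := psd_herm (pd_psd p1).
have pr : primitive_mx rho (fun=> flux L m0).
  move=> E t t01; rewrite prim_cst// m0E !rE rinnerDr rinnerZr [in RHS]rinnerDr rinnerZr.
  by rewrite mul0r addr0.
have lg : mxL1 (fun=> flux L m0 : 'M[C]_n) by move=> E; exact: L1_cst.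
have r0 : rho 0 = rho0 by rewrite rE scale0r addr0.
have r1 : rho 1 = rho1 by rewrite rE scale1r addrC subrK.
have rpd t : I01 t -> Hpd (rho t).
  rewrite /= in_itv/= => /andP[tp t1']; apply/pdP; split.
    by apply: HermD; apply: HermZ.
  move=> v v0; rewrite /rho mulmxDl -!scalemxAl rinnerDr !rinnerZr.
  have [_ /(_ v v0) q0] := (pdP rho0).1 p0.
  have [_ /(_ v v0) q1] := (pdP rho1).1 p1.
  apply: addr_gt0; first by apply: mulr_gt0 q0; rewrite subr_gt0.
  exact: mulr_gt0 tp q1.
have lrho := primitive_L2 lg pr.
exists rho, (fun=> m0); split.
  split.
  - by split=> [|t tI]; [exact: lrho|exact: psd_herm (pd_psd (rpd t tI))].
  - by apply: (@L2_bound _ _ _ _ (rinner m0 m0)) => // E; exact: measurable_cst.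
  - apply: ae01_T => t _; rewrite /rho mxtraceD !mxtraceZ t0 t1 !mulr1.
    by rewrite -rmorphD /= subrK.
  - by rewrite -r0 -r1; apply: (primitive_boundary lg _ pr); exact: ae01_T.
  - under eq_fun do rewrite -flux_def.
    apply: (primitive_weak _ lg (ae01_T _) pr) => //.
    exact: (primitive_meas lg pr).
pose K := kinetic rho0 m0 + kinetic rho1 m0.
apply: (@le_lt_trans _ _ (\int[mu]_(t in I01) K%:E)%E); last first.
  by rewrite (It_EFin (L1_cst K)) ltry.
have k0 := kinetic_energy_bound m0 p0; have k1 := kinetic_energy_bound m0 p1.
have k00 := energy_bound_ge0 k0; have k10 := energy_bound_ge0 k1.
apply: le_lower_integral => t tI; first exact: F_ge0.
have pt := rpd t tI; rewrite /F asboolT// lee_fin.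
move: tI; rewrite /= in_itv/= => /andP[/ltW tp /ltW t1'].
have t1'' : 0 <= 1 - t by rewrite subr_ge0.
apply: (@le_trans _ _ ((1 - t) * kinetic rho0 m0 + t * kinetic rho1 m0)).
  apply: (energy_bound_kinetic pt).
  have := energy_boundD (energy_boundZ t1'' k0) (energy_boundZ tp k1).
  by rewrite -scalerDl -rmorphD /= subrK scale1r.
have := mulr_ge0 tp k00; have := mulr_ge0 t1'' k10.
by rewrite /K; move: (kinetic rho0 m0) (kinetic rho1 m0) => x y; lra.
Qed.

End ReferencePath.

(** * Sequences that converge fast in mean *)

Section FastConvergence.
Variable R : realType.
Local Notation mu := (@lebesgue_measure R).
Local Notation I01 := (`]0, 1[%classic : set R).
Local Notation It := (@It R).

Section Fast.
Variables (u : nat -> R -> R) (a : R).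
Hypothesis lu : forall k, L1 (u k).
Hypothesis fast : forall k, It (fun t => `|u k t - u k.+1 t|) <= a * 2^-1 ^+ k.

(** A dominating function for the whole sequence u. *)
Definition variation (t : R) : \bar R :=
  (`|u 0 t|%:E + \sum_(k <oo) `|u k t - u k.+1 t|%:E)%E.

Lemma variation_ge (k : nat) t : (`|u k t|%:E <= variation t)%E.
Proof.
have h : `|u k t| <= `|u 0%N t| + \sum_(0 <= j < k) `|u j t - u j.+1 t|.
  elim: k => [|k IH]; first by rewrite big_geq// addr0.
  rewrite big_nat_recr//= addrA.
  apply: (@le_trans _ _ (`|u k t| + `|u k t - u k.+1 t|)); last by rewrite lerD2r.
  by rewrite -{1}(subKr (u k t) (u k.+1 t)) (le_trans (ler_normB _ _)).
apply: (@le_trans _ _ (`|u 0%N t| + \sum_(0 <= j < k) `|u j t - u j.+1 t|)%:E).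
  by rewrite lee_fin.
rewrite EFinD leeD2l// -sumEFin.
by apply: nneseries_lim_ge => j _; rewrite lee_fin.
Qed.

Lemma variation_integrable : mu.-integrable I01 variation.
Proof.
have mterm k : measurable_fun I01 (fun t => `|u k t - u k.+1 t|%:E).
  apply/measurable_EFinP; apply: measurableT_comp => //.
  by apply: measurable_funB; exact: L1_mfun.
apply: integrableD => //.
  by have := L1_norm (lu 0%N); apply: eq_integrable.
apply/integrableP; split.
  apply: ge0_emeasurable_sum; first by move=> k t *; rewrite lee_fin.
  by move=> k _; exact: mterm.
under eq_integral do rewrite gee0_abs ?nneseries_ge0//.
rewrite integral_nneseries//.
apply: (@le_lt_trans _ _ (2 * a)%:E); last exact: ltry.
apply: lime_le; first by apply: is_cvg_nneseries => k _ _; apply: integral_ge0 => t _; rewrite lee_fin.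
apply: nearW => n.
have a0 : 0 <= a.
  have := fast 0; rewrite expr0 mulr1; apply: le_trans.
  exact: It_ge0.
apply: (@le_trans _ _ (\sum_(0 <= k < n) (a * 2^-1 ^+ k)%:E)%E).
  apply: lee_sum => k _; rewrite It_EFin ?lee_fin//.
  by apply: L1_norm; apply: L1B.
rewrite sumEFin lee_fin.
suff -> : \sum_(0 <= k < n) a * 2^-1 ^+ k = 2 * a - 2 * a * 2^-1 ^+ n.
  by rewrite gerBl mulr_ge0 ?exprn_ge0 ?mulr_ge0.
elim: n => [|n IH]; first by rewrite big_geq// expr0; ring.
by rewrite big_nat_recr//= IH exprS; field.
Qed.

Lemma variation_cvg t : variation t \is a fin_num -> cvgn (u ^~ t).
Proof.
move=> fin.
have bnd n : \sum_(0 <= j < n) `|u j t - u j.+1 t| <= fine (variation t).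
  rewrite -lee_fin fineK// /variation -sumEFin.
  apply: (@le_trans _ _ (\sum_(k <oo) `|u k t - u k.+1 t|%:E)%E).
    by apply: nneseries_lim_ge => j _; rewrite lee_fin.
  by rewrite leeDr.
have -> : u ^~ t = fun k => u 0%N t + series (fun k => u k.+1 t - u k t) k.
  by apply/funext => k; rewrite /series /= telescope_sumr// addrC subrK.
apply: is_cvgD; first exact: is_cvg_cst.
apply: normed_cvg; apply: nondecreasing_is_cvgn.
  by apply: nondecreasing_series => k _ _ /=.
exists (fine (variation t)) => _ [n _ <-]; apply: le_trans (bnd n).
by rewrite /series /=; apply: ler_sum => j _; rewrite distrC.
Qed.

Lemma variation_ae : ae01 (fun t => variation t \is a fin_num).
Proof. exact: (integrable_ae _ variation_integrable). Qed.

(** Dominated convergence, with the variation as the dominating function. *)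
Lemma fast_limit (v w : R -> R) (M : R) : measurable_fun I01 v ->
  measurable_fun I01 w -> (forall t, I01 t -> `|w t| <= M) ->
  ae01 (fun t => u k t @[k --> \oo] --> v t) ->
  L1 v /\ It (fun t => w t * u k t) @[k --> \oo] --> It (fun t => w t * v t).
Proof.
move=> mv mw wM uv.
have dom (w' : R -> R) (M' : R) : measurable_fun I01 w' ->
   (forall t, I01 t -> `|w' t| <= M') ->
   L1 (fun t => w' t * v t) /\
   It (fun t => w' t * u k t) @[k --> \oo] --> It (fun t => w' t * v t).
  move=> mw' wM'.
  have ig : mu.-integrable I01 (fun t => M'%:E * variation t)%E.
    exact: integrableZl variation_integrable.
  have m1 k : measurable_fun I01 (fun t => (w' t * u k t)%:E).
    by apply/measurable_EFinP; apply: measurable_funM => //; exact: L1_mfun.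
  have m2 : measurable_fun I01 (fun t => (w' t * v t)%:E).
    by apply/measurable_EFinP; exact: measurable_funM.
  have cv : {ae mu, forall t, I01 t -> (w' t * u k t)%:E @[k --> \oo] --> (w' t * v t)%:E}.
    apply: ae01_imp uv => t _ h; apply: cvg_EFin; first exact: nearW.
    by apply: cvgM => //; exact: cvg_cst.
  have bd : {ae mu, forall t k, I01 t -> `|(w' t * u k t)%:E| <= M'%:E * variation t}%E.
    apply: aeW => t k tI; rewrite EFinM abseM; apply: lee_pmul => //.
      by rewrite lee_fin wM'.
    exact: variation_ge.
  have [i1 _ c1] := dominated_convergence (@mI01 R) m1 m2 cv ig bd.
  split=> //.
  have lk k : L1 (fun t => w' t * u k t) by exact: (L1M_bound mw' wM').
  move: c1; rewrite (It_EFin i1).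
  have -> : (fun n => \int[mu]_(x in I01) (w' x * u n x)%:E)%E =
     (fun n => (It (fun x => w' x * u n x))%:E).
    by apply/funext => k; rewrite It_EFin.
  by move=> /fine_cvg.
split; last by have [] := dom w M mw wM.
have [] := dom (fun=> 1) 1 (measurable_cst _) (fun t _ => _).
  by rewrite normr1.
by move=> h _; apply: (L1_ext _ h) => t; rewrite mul1r.
Qed.

End Fast.

(** The exceptional null sets depend on E, but finitely many matrices E, namely
    a basis, suffice to determine a continuous representative. *)
Lemma coordinates_primitive p q (r0 : 'M[R[i]]_(p, q)) (f g : R -> 'M[R[i]]_(p, q)) :
  mxL1 g ->
  (forall E, ae01 (fun t => rinner E (f t) = rinner E r0 + prim (fun s => rinner E (g s)) t)) ->
  exists fc, [/\ ae01 (fun t => f t = fc t), fc 0 = r0 & primitive_mx fc g].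
Proof.
move=> lg h; pose e (c : bool * 'I_p * 'I_q) := unitv R c.1.1 c.1.2 c.2.
pose x c t := rinner (e c) r0 + prim (fun s => rinner (e c) (g s)) t.
pose fc t := \sum_c (x c t)%:C *: e c.
have fcE E t : 0 <= t <= 1 ->
    rinner E (fc t) = rinner E r0 + prim (fun s => rinner E (g s)) t.
  move=> t01; rewrite /fc rinner_sumr.
  have -> : (fun s => rinner E (g s)) = fun s => \sum_c rinner E (e c) * rinner (e c) (g s).
    by apply/funext => s; rewrite rinner_coord.
  rewrite prim_sum//; last by move=> c; apply: L1Z; exact: lg.
  rewrite rinner_coord -big_split; apply: eq_bigr => c _ /=.
  by rewrite rinnerZr (primZ _ (lg (e c)))// /x; ring.
have fc0 : fc 0 = r0.
  by apply: rinner_nondeg => E; rewrite fcE ?lexx ?ler01// prim0 addr0.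
exists fc; split => //; last by move=> E t t01; rewrite fcE// fc0.
have all_ae : forall s : seq (bool * 'I_p * 'I_q),
    ae01 (fun t => forall c, c \in s -> rinner (e c) (f t) = x c t).
  elim=> [|c s IH]; first exact: ae01_T.
  apply: ae01_imp (ae01_and (h (e c)) IH) => t _ [h1 h2] c'.
  by rewrite inE => /orP[/eqP ->|/h2].
apply: ae01_imp (all_ae (enum {: bool * 'I_p * 'I_q})) => t /I01_le t01 ht.
apply: rinner_nondeg => E; rewrite rinner_coord [RHS]rinner_coord.
apply: eq_bigr => c _; congr (_ * _).
by rewrite ht ?mem_enum// fcE.
Qed.

End FastConvergence.

(** * Approximate solutions *)

Section ApproximateSolutions.
Variable R : realType.
Local Notation C := R[i].
Local Notation mu := (@lebesgue_measure R).
Local Notation I01 := (`]0, 1[%classic : set R).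
Local Notation It := (@It R).
Variables (n N : nat) (L : 'I_N -> 'M[C]_n).
Hypothesis hL : forall k, Herm (L k).
Variables (rho0 rho1 : 'M[C]_n) (D : R).

Definition constraint_integral (rho : R -> 'M[C]_n) (m : R -> blockcol R n N)
    (E : 'M[C]_n) (c : R) (om : R -> R) : R :=
  It (fun t => om t * rinner E (rho t) +
               (c + prim om t) * rinner E (flux L (m t))).

(** The error in the constraint, tested with the matrix-valued function
    W(t) E, where W is the primitive of om with W(0) = c: for a curve that
    satisfies the constraint, the total variation of <W E, rho> is the integral
    of <W' E, rho> + <W E, flux m>.  Using such W rather than test functions
    also records the boundary values. *)
Definition constraint_defect (rho : R -> 'M[C]_n) (m : R -> blockcol R n N)
    (E : 'M[C]_n) (c : R) (om : R -> R) : R :=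
  (c + It om) * rinner E rho1 - c * rinner E rho0 - constraint_integral rho m E c om.

(** Triples (rho, m, e).  Each condition is convex in the triple, so these sets
    are stable under midpoints.  The trace is only approximately 1, and the
    bound on the defect is uniform in bounded weights. *)
Record approx_solution (kap : R) (x : (R -> 'M[C]_n) * (R -> blockcol R n N) * (R -> R)) : Prop := {
  approx_psd : forall t, Hpsd (x.1.1 t);
  approx_tr : forall t, `|rtr (x.1.1 t) - 1| <= kap;
  approx_energy : forall t, energy_bound (x.1.1 t) (x.1.2 t) (x.2 t);
  approx_meas1 : mxmeas x.1.1;
  approx_meas2 : mxmeas x.1.2;
  approx_L1 : L1 x.2;
  approx_le : It x.2 <= D + kap;
  approx_defect : forall E c (om : R -> R), measurable_fun I01 om ->
    (forall t, I01 t -> `|om t| <= 1) -> `|c| <= 1 ->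
    `|constraint_defect x.1.1 x.1.2 E c om| <= kap * (1 + rinner E E) }.

Lemma approxW kap kap' x : kap <= kap' -> approx_solution kap x -> approx_solution kap' x.
Proof.
move=> kk [a1 a2 a3 a4 a5 a6 a7 a8]; split => //.
- by move=> t; apply: le_trans kk.
- by apply: (le_trans a7); rewrite lerD2l.
- move=> E c om mo bo bc; apply: (le_trans (a8 E c om mo bo bc)).
  by rewrite ler_wpM2r// addr_ge0// rinner_ge0.
Qed.

Definition midpoint (x y : (R -> 'M[C]_n) * (R -> blockcol R n N) * (R -> R)) :
    (R -> 'M[C]_n) * (R -> blockcol R n N) * (R -> R) :=
  ((fun t => (2^-1 : R)%:C *: x.1.1 t + (2^-1 : R)%:C *: y.1.1 t,
    fun t => (2^-1 : R)%:C *: x.1.2 t + (2^-1 : R)%:C *: y.1.2 t),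
   fun t => 2^-1 * x.2 t + 2^-1 * y.2 t).

(** The trace bounds rho, and the energy then bounds m. *)
Lemma approx_L2 kap x : kap <= 2^-1 -> approx_solution kap x ->
  [/\ forall t, rinner (x.1.1 t) (x.1.1 t) <= 9 / 4,
      forall t, rinner (x.1.2 t) (x.1.2 t) <= 4 * x.2 t,
      L2 x.1.1 & L2 x.1.2].
Proof.
move=> k2 [a1 a2 a3 a4 a5 a6 a7 a8].
have trb t : 0 <= rtr (x.1.1 t) <= 3 / 2.
  rewrite rtr_ge0//=; have := le_trans (a2 t) k2.
  by rewrite ler_norml => /andP[_]; lra.
have b1 t : rinner (x.1.1 t) (x.1.1 t) <= 9 / 4.
  apply: (le_trans (psd_norm_le (a1 t))); have /andP[t0 t1] := trb t.
  have := ler_pM t0 t0 t1 t1; rewrite -expr2; lra.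
have b2 t : rinner (x.1.2 t) (x.1.2 t) <= 4 * x.2 t.
  have := energy_bound_norm (a1 t) (a3 t); have /andP[t0 t1] := trb t.
  have := rinner_ge0 (x.1.2 t).
  move: (rinner _ _) (rtr _) (x.2 t) t0 t1 => a b c t0 t1 a0 h.
  have h' : a * (1 / 4) <= a * (1 - 2^-1 * b) by rewrite ler_wpM2l//; lra.
  by move: h h'; rewrite mulrC; lra.
split=> //; first exact: (L2_bound a4 (fun t _ => b1 t)).
apply/L2P; split=> //; apply: (@L1_le _ _ (fun t => 4 * x.2 t)).
- exact: mxmeas_rinner.
- exact: L1Z.
- by move=> t _; rewrite ger0_norm ?rinner_ge0.
Qed.

Lemma L1_bounded_mul (w f : R -> R) : measurable_fun I01 w ->
  (exists M, forall t, I01 t -> `|w t| <= M) -> L1 f -> L1 (fun t => w t * f t).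
Proof. by move=> mw [M wM]; exact: (L1M_bound mw wM). Qed.

Lemma affine_prim_bound (c : R) (om : R -> R) : L1 om ->
  measurable_fun I01 (fun t => c + prim om t) /\
  exists M, forall t, I01 t -> `|c + prim om t| <= M.
Proof.
move=> lo; split; first by apply: measurable_funD => //; exact: prim_mfun.
exists (`|c| + It (fun t => `|om t|)) => t /I01_le t01.
by rewrite (le_trans (ler_normD _ _))// lerD2l; exact: prim_le.
Qed.

Lemma defect_L1 (rho : R -> 'M[C]_n) (m : R -> blockcol R n N) E (c : R) (om : R -> R) :
  L2 rho -> L2 m -> measurable_fun I01 om -> (forall t, I01 t -> `|om t| <= 1) ->
  L1 (fun t => om t * rinner E (rho t)) /\
  L1 (fun t => (c + prim om t) * rinner E (flux L (m t))).
Proof.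
move=> lr lm mo bo; have lo := L1_bound mo bo.
have [mp bp] := affine_prim_bound c lo.
split; first by apply: (L1M_bound mo bo); exact: (L2_coordL1 lr).
by apply: L1_bounded_mul => //; exact: flux_mxL1.
Qed.

Lemma fluxD (m m' : blockcol R n N) : flux L (m + m') = flux L m + flux L m'.
Proof.
apply: rinner_nondeg => E; apply: etrans (rinner_flux hL E (m + m')) _.
apply: etrans (rinnerDr _ m m') _; apply/esym.
apply: etrans (rinnerDr E (flux L m) (flux L m')) _.
by congr (_ + _); exact: rinner_flux.
Qed.

Lemma fluxZ (a : R) (m : blockcol R n N) : flux L (a%:C *: m) = a%:C *: flux L m.
Proof.
apply: rinner_nondeg => E; apply: etrans (rinner_flux hL E (a%:C *: m)) _.
apply: etrans (rinnerZr a _ m) _; apply/esym.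
apply: etrans (rinnerZr a E (flux L m)) _.
by congr (_ * _); exact: rinner_flux.
Qed.

Lemma It_half (A B : R -> R) : L1 A -> L1 B ->
  It (fun t => 2^-1 * A t + 2^-1 * B t) = 2^-1 * It A + 2^-1 * It B.
Proof.
move=> lA lB; rewrite -(ItZ _ lA) -(ItZ _ lB) -(ItD (L1Z _ lA) (L1Z _ lB)).
by [].
Qed.

Lemma rinner_half p q (E x y : 'M[C]_(p, q)) :
  rinner E ((2^-1 : R)%:C *: x + (2^-1 : R)%:C *: y) =
  2^-1 * rinner E x + 2^-1 * rinner E y.
Proof. by rewrite (rinnerDr E (_ *: x)) (rinnerZr _ E x) (rinnerZr _ E y). Qed.

Lemma flux_half (x y : blockcol R n N) :
  flux L ((2^-1 : R)%:C *: x + (2^-1 : R)%:C *: y) =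
  (2^-1 : R)%:C *: flux L x + (2^-1 : R)%:C *: flux L y.
Proof. by rewrite (fluxD (_ *: x)) (fluxZ _ x) (fluxZ _ y). Qed.

Lemma defect_half (r r' : R -> 'M[C]_n) (m m' : R -> blockcol R n N) E (c : R)
    (om : R -> R) : L2 r -> L2 m -> L2 r' -> L2 m' ->
  measurable_fun I01 om -> (forall t, I01 t -> `|om t| <= 1) ->
  constraint_defect (fun t => (2^-1 : R)%:C *: r t + (2^-1 : R)%:C *: r' t)
    (fun t => (2^-1 : R)%:C *: m t + (2^-1 : R)%:C *: m' t) E c om =
  2^-1 * constraint_defect r m E c om + 2^-1 * constraint_defect r' m' E c om.
Proof.
move=> lr lm lr' lm' mo bo.
have [i1 i2] := defect_L1 E c lr lm mo bo; have [i3 i4] := defect_L1 E c lr' lm' mo bo.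
have e := It_half (L1D i1 i2) (L1D i3 i4).
have {e}e : constraint_integral (fun t => (2^-1 : R)%:C *: r t + (2^-1 : R)%:C *: r' t)
    (fun t => (2^-1 : R)%:C *: m t + (2^-1 : R)%:C *: m' t) E c om =
  2^-1 * constraint_integral r m E c om + 2^-1 * constraint_integral r' m' E c om.
  apply: etrans e; apply: eq_It => t _.
  have hring (a b x y z w : R) : a * (2^-1 * x + 2^-1 * y) + b * (2^-1 * z + 2^-1 * w) =
      2^-1 * (a * x + b * z) + 2^-1 * (a * y + b * w) by ring.
  apply: etrans (hring _ _ _ _ _ _).
  rewrite (flux_half (m t)); congr (_ * _ + _ * _); exact: rinner_half.
rewrite /constraint_defect e.
move: (constraint_integral _ _ _ _ _) (constraint_integral _ _ _ _ _) => p q.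
move: (It _) (rinner E rho0) (rinner E rho1) => s u v.
by field.
Qed.

Lemma approx_midpoint kap x y : kap <= 2^-1 -> approx_solution kap x -> approx_solution kap y ->
  approx_solution kap (midpoint x y).
Proof.
move=> k2 ax ay.
have [_ _ lx1 lx2] := approx_L2 k2 ax; have [_ _ ly1 ly2] := approx_L2 k2 ay.
move: ax ay => [a1 a2 a3 a4 a5 a6 a7 a8] [b1 b2 b3 b4 b5 b6 b7 b8].
have hf : 0 <= (2^-1 : R) by rewrite invr_ge0.
rewrite /midpoint; split => /=.
- by move=> t; apply: psdD; apply: psdZ.
- move=> t; move: (a2 t) (b2 t); rewrite /rtr (rinner_half 1%:M (x.1.1 t)).
  move: (rinner _ _) (rinner _ _) => p q.
  rewrite !ler_norml => /andP[? ?] /andP[? ?]; apply/andP; split; lra.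
- move=> t; exact: (energy_boundD (energy_boundZ hf (a3 t)) (energy_boundZ hf (b3 t))).
- by apply: mxmeasD; apply: mxmeasZ.
- by apply: mxmeasD; apply: mxmeasZ.
- by apply: L1D; apply: L1Z.
- by rewrite (It_half a6 b6); move: (It _) (It _) a7 b7 => p q; lra.
- move=> E c om mo bo bc.
  have := a8 E c om mo bo bc; have := b8 E c om mo bo bc.
  rewrite (defect_half E c lx1 lx2 ly1 ly2 mo bo).
  move: (constraint_defect _ _ _ _ _) (constraint_defect _ _ _ _ _) => p q.
  move: (rinner E E) => w; move: (kap * _) => z.
  rewrite !ler_norml => /andP[? ?] /andP[? ?]; apply/andP; split; lra.
Qed.

Definition sqnorm (x : (R -> 'M[C]_n) * (R -> blockcol R n N) * (R -> R)) : R :=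
  It (fun t => rinner (x.1.1 t) (x.1.1 t) + rinner (x.1.2 t) (x.1.2 t)).

Definition sqdist (x y : (R -> 'M[C]_n) * (R -> blockcol R n N) * (R -> R)) : R :=
  It (fun t => rinner (x.1.1 t - y.1.1 t) (x.1.1 t - y.1.1 t) +
               rinner (x.1.2 t - y.1.2 t) (x.1.2 t - y.1.2 t)).

Lemma L2B p q (f g : R -> 'M[C]_(p, q)) : L2 f -> L2 g -> L2 (fun t => f t - g t).
Proof.
move=> lf lg; have [mf f2] := (L2P f).1 lf; have [mg g2] := (L2P g).1 lg.
apply/L2P; split; first exact: mxmeasB.
apply: (@L1_ext _ (fun t => rinner (f t) (f t) + - 2 * rinner (f t) (g t) + rinner (g t) (g t))).
  by move=> t; rewrite !rinnerBr !rinnerBl (rinnerC (g t)); ring.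
by apply: L1D => //; apply: L1D => //; apply: L1Z; exact: L1_rinner_L2.
Qed.

Lemma parallelogram p q (x y : 'M[C]_(p, q)) :
  rinner ((2^-1 : R)%:C *: x + (2^-1 : R)%:C *: y) ((2^-1 : R)%:C *: x + (2^-1 : R)%:C *: y) =
  2^-1 * rinner x x + 2^-1 * rinner y y - 4^-1 * rinner (x - y) (x - y).
Proof.
rewrite (rinner_half _ x) !(rinnerC _ x) !(rinnerC _ y) (rinner_half x x) (rinner_half y x).
rewrite (rinnerBr _ x) !(rinnerC (x - y)) !rinnerBr (rinnerC y x).
by field.
Qed.

Lemma sqnorm_midpoint x y : L2 x.1.1 -> L2 x.1.2 -> L2 y.1.1 -> L2 y.1.2 ->
  sqnorm (midpoint x y) = 2^-1 * sqnorm x + 2^-1 * sqnorm y - 4^-1 * sqdist x y.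
Proof.
move=> lx1 lx2 ly1 ly2.
have ix := L1D ((L2P _).1 lx1).2 ((L2P _).1 lx2).2.
have iy := L1D ((L2P _).1 ly1).2 ((L2P _).1 ly2).2.
have id := L1D ((L2P _).1 (L2B lx1 ly1)).2 ((L2P _).1 (L2B lx2 ly2)).2.
have e := It_half ix iy.
have e' := ItB (L1D (L1Z 2^-1 ix) (L1Z 2^-1 iy)) (L1Z 4^-1 id).
apply: etrans (etrans e' _); last by congr (_ - _); [exact: e|exact: ItZ].
apply: eq_It => t _.
have hring (a b c d f g : R) : (2^-1 * a + 2^-1 * b - 4^-1 * c) + (2^-1 * d + 2^-1 * f - 4^-1 * g) =
   2^-1 * (a + d) + 2^-1 * (b + f) - 4^-1 * (c + g) by ring.
by apply: etrans (hring _ _ _ _ _ _); congr (_ + _); exact: parallelogram.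
Qed.

(** [nested_min] for the squared L^2 norm on the sets of approximate solutions
    of tolerance 1/(k+2). *)
Lemma approx_fast : (forall kap, 0 < kap -> exists x, approx_solution kap x) -> 0 <= D ->
  exists y, (forall k, approx_solution (k.+2%:R^-1) (y k)) /\
     (forall k : nat, sqdist (y k) (y k.+1) <= 16^-1 ^+ k).
Proof.
move=> ex D0.
pose kp (k : nat) : R := k.+2%:R^-1.
have kp0 k : 0 < kp k by rewrite invr_gt0.
have kp2 k : kp k <= 2^-1 by rewrite lef_pV2 ?posrE// ler_nat.
pose M := 9 / 4 + 4 * (D + 1).
have qge0 x : approx_solution (kp 0) x -> 0 <= sqnorm x.
  by move=> _; apply: It_ge0 => t _; rewrite addr_ge0 ?rinner_ge0.
have M0 : 0 <= M by rewrite /M; lra.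
suff [y [yC dy _]] : exists y, [/\ forall k, [set x | approx_solution (kp k) x] (y k),
    forall k, sqdist (y k) (y k.+1) <= 16^-1 ^+ k &
    forall k z, (forall j, [set x | approx_solution (kp j) x] z) -> sqnorm (y k) <= sqnorm z + 16^-1 ^+ k].
  by exists y.
apply: (@nested_min R _ (fun k => [set x | approx_solution (kp k) x]) midpoint sqnorm sqdist M).
- move=> k x; apply: approxW; rewrite lef_pV2 ?posrE// ler_nat//.
- by move=> k x y; exact: approx_midpoint.
- move=> x y ax ay /=.
  have [_ _ lx1 lx2] := approx_L2 (kp2 _) ax; have [_ _ ly1 ly2] := approx_L2 (kp2 _) ay.
  by rewrite (sqnorm_midpoint lx1 lx2 ly1 ly2); lra.
- by move=> x ax; apply: le_trans (qge0 x ax); rewrite oppr_le0.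
- move=> k; have [x ax] := ex _ (kp0 k); exists x => //.
  have [b1 b2 l1 l2] := approx_L2 (kp2 k) ax; have [_ i1] := (L2P _).1 l1; have [_ i2] := (L2P _).1 l2.
  have l2x := approx_L1 ax.
  apply: (@le_trans _ _ (It (fun t => 9 / 4 + 4 * x.2 t))).
    apply: It_le; first exact: L1D.
      by apply: L1D; [exact: L1_cst|exact: L1Z].
    by move=> t _; apply: lerD.
  rewrite ItD ?It_cst ?ItZ//; [|exact: L1_cst|exact: L1Z].
  have := approx_le ax; have := kp2 k; rewrite /M; lra.
- by move=> k; rewrite exprn_gt0.
- by move=> k; rewrite exprS ler_piMl ?exprn_ge0//; lra.
Qed.

End ApproximateSolutions.

(** * Fast convergence of matrix-valued functions *)

Section MatrixLimits.
Variable R : realType.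
Local Notation C := R[i].
Local Notation mu := (@lebesgue_measure R).
Local Notation I01 := (`]0, 1[%classic : set R).
Local Notation It := (@It R).

(** With s = 2^k this turns a bound 16^-k on squared distances into a bound of
    order 4^-k on the distances between coordinates, without square roots of
    integrals. *)
Lemma rinner_young p q (s : R) (E x : 'M[C]_(p, q)) : 0 < s ->
  2 * `|rinner E x| <= s ^- 2 * rinner E E + s ^+ 2 * rinner x x.
Proof.
move=> s0.
have key (y : 'M[C]_(p, q)) : 2 * rinner E y <= s ^- 2 * rinner E E + s ^+ 2 * rinner y y.
  have := rinner_le (s^-1%:C *: E) (s%:C *: y).
  rewrite (rinnerZr s _ y) (rinnerZl s^-1 E y) (rinnerZr s _ y) (rinnerZl s y y).
  rewrite (rinnerZr s^-1 _ E) (rinnerZl s^-1 E E).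
  move: (rinner E y) (rinner E E) (rinner y y) => a b c.
  have -> : 2 * (s * (s^-1 * a)) = 2 * a by field; rewrite gt_eqF.
  have -> : s^-1 * (s^-1 * b) = s ^- 2 * b by field; rewrite gt_eqF.
  by have -> : s * (s * c) = s ^+ 2 * c by ring.
have := key x; have := key (- x); rewrite (rinnerNr E x) (rinnerNr _ x) (rinnerNl x x).
move: (rinner E x) (rinner E E) (rinner x x) => a b c; rewrite opprK.
move=> h1 h2; case: (ger0P a) => _; lra.
Qed.

Variables (p q : nat) (u : nat -> R -> 'M[C]_(p, q)).
Hypothesis lu : forall k, L2 (u k).
Hypothesis fast : forall k : nat,
  It (fun t => rinner (u k t - u k.+1 t) (u k t - u k.+1 t)) <= 16^-1 ^+ k.

Lemma coordinate_fast E k :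
  It (fun t => `|rinner E (u k t) - rinner E (u k.+1 t)|) <= (1 + rinner E E) * 2^-1 ^+ k.
Proof.
have id := ((L2P _).1 (L2B (lu k) (lu k.+1))).2.
have lc j := L2_coordL1 (lu j) E.
have s0 : 0 < (2 : R) ^+ k by rewrite exprn_gt0.
apply: (@le_trans _ _ (2^-1 * ((2 ^+ k) ^- 2 * rinner E E + (2 ^+ k) ^+ 2 * 16^-1 ^+ k))); last first.
  have -> : ((2 : R) ^+ k) ^+ 2 * 16^-1 ^+ k = 4^-1 ^+ k.
    by rewrite -exprM mulnC exprM -exprMn; congr (_ ^+ _); field.
  have -> : ((2 : R) ^+ k) ^- 2 = 4^-1 ^+ k.
    by rewrite -exprM mulnC exprM -exprVn; congr (_ ^+ _); field.
  have E0 := rinner_ge0 E; have h4 : (4^-1 : R) ^+ k <= 2^-1 ^+ k.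
    by apply: lerXn2r; rewrite ?nnegrE; lra.
  have h0 : 0 <= (4^-1 : R) ^+ k by rewrite exprn_ge0.
  have : (1 + rinner E E) * 4^-1 ^+ k <= (1 + rinner E E) * 2^-1 ^+ k.
    by rewrite ler_wpM2l// addr_ge0.
  have : 0 <= (1 + rinner E E) * 4^-1 ^+ k by rewrite mulr_ge0// addr_ge0.
  move: (rinner E E) (_ ^+ k) (2^-1 ^+ k) => a b c; lra.
apply: (@le_trans _ _ (It (fun t => 2^-1 * ((2 ^+ k) ^- 2 * rinner E E) + 2^-1 * ((2 ^+ k) ^+ 2 *
    rinner (u k t - u k.+1 t) (u k t - u k.+1 t))))); last first.
  rewrite (ItD (L1_cst _) (L1Z _ (L1Z _ id))) It_cst (ItZ _ (L1Z _ id)) (ItZ _ id).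
  rewrite -mulrDr ler_wpM2l ?invr_ge0// lerD2l ler_wpM2l// exprn_ge0// ltW//.
apply: It_le; first by apply: L1_norm; apply: L1B.
  by apply: L1D; [exact: L1_cst|apply: L1Z; exact: L1Z].
move=> t _; rewrite -(rinnerBr E (u k t)).
have := rinner_young E (u k t - u k.+1 t) s0.
move: (rinner E _) (_ * rinner E E) (_ * rinner (_ - _) _) => a b c; lra.
Qed.

Lemma limit_ae : ae01 (fun t => exists X, mxcvg (u ^~ t) X).
Proof.
pose e (c : bool * 'I_p * 'I_q) := unitv R c.1.1 c.1.2 c.2.
have all_ae : forall s : seq (bool * 'I_p * 'I_q),
    ae01 (fun t => forall c, c \in s -> cvgn (fun k => rinner (e c) (u k t))).
  elim=> [|c s IH]; first exact: ae01_T.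
  have h := variation_ae (fun k => L2_coordL1 (lu k) (e c)) (coordinate_fast (e c)).
  apply: ae01_imp (ae01_and h IH) => t _ [/variation_cvg h1 h2] c'.
  by rewrite inE => /orP[/eqP ->|/h2].
apply: ae01_imp (all_ae (enum {: bool * 'I_p * 'I_q})) => t _ ht.
by apply: mxcvg_exists => b i j; apply: (ht (b, i, j)); rewrite mem_enum.
Qed.

Lemma limit_integral (v : R -> 'M[C]_(p, q)) E (w : R -> R) (M : R) : mxmeas v ->
  ae01 (fun t => mxcvg (u ^~ t) (v t)) ->
  measurable_fun I01 w -> (forall t, I01 t -> `|w t| <= M) ->
  It (fun t => w t * rinner E (u k t)) @[k --> \oo] --> It (fun t => w t * rinner E (v t)).
Proof.
move=> mv uv mw wM.
have [] := fast_limit (fun k => L2_coordL1 (lu k) E) (coordinate_fast E) (mv E) mw wM _ => //.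
by apply: ae01_imp uv => t _; apply.
Qed.

Lemma indic_mfun (S : set R) : measurable (S : set (measurableTypeR R)) ->
  measurable_fun I01 (fun t : R => \1_S t : R).
Proof. by move=> mS; apply: measurable_funTS; exact: measurable_indic. Qed.

(** The value v0 on the null set S makes the limit v a pointwise limit of
    measurable functions on all of the interval. *)
Lemma limit_meas (S : set R) (v : R -> 'M[C]_(p, q)) (v0 : 'M[C]_(p, q)) :
  measurable (S : set (measurableTypeR R)) ->
  (forall t, I01 t -> ~ S t -> mxcvg (u ^~ t) (v t)) ->
  (forall t, S t -> v t = v0) -> mxmeas v.
Proof.
move=> mS cS vS E.
pose h (k : nat) (t : R) : R := \1_(~` S) t * rinner E (u k t) + \1_S t * rinner E v0.
apply: (@measurable_fun_cvg _ _ _ _ h).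
  move=> k; apply: measurable_funD; apply: measurable_funM => //.
  - by apply: indic_mfun; exact: measurableC.
  - exact: ((L2P _).1 (lu k)).1.
rewrite /h => t tI; under eq_fun do rewrite !indicE in_setC.
have [/set_mem tS|tS] := boolP (t \in S).
  under eq_fun do rewrite mul0r mul1r add0r.
  by rewrite vS//; exact: cvg_cst.
under eq_fun do rewrite mul0r mul1r addr0.
by apply: cS => //; move=> tS'; move/negP: tS; apply; exact: mem_set.
Qed.

End MatrixLimits.

(** Test with the truncation of g to [-1, 1], whose product with g vanishes only
    where g does. *)
Lemma bounded_test_ae (R : realType) (g : R -> R) : L1 g ->
  (forall om : R -> R, measurable_fun (`]0, 1[%classic : set R) om ->
    (forall t, (`]0, 1[%classic : set R) t -> `|om t| <= 1) -> It (fun t => om t * g t) = 0) ->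
  ae01 (fun t => g t = 0).
Proof.
move=> lg h; have mg := L1_mfun lg.
pose om t := Num.max (-1) (Num.min (g t) 1).
have mom : measurable_fun (`]0, 1[%classic : set R) om.
  by apply: measurable_maxr => //; apply: measurable_minr.
have bom t : `|om t| <= 1.
  rewrite /om ler_norml le_max lexx /= ge_max ge_min lexx orbT andbT; lra.
have pos t : 0 <= om t * g t /\ (om t * g t = 0 -> g t = 0).
  rewrite /om /Num.max /Num.min; case: (ltP (g t) 1) => g1; case: ltP => g2.
  - by split; [rewrite -expr2 sqr_ge0|move/eqP; rewrite mulf_eq0 orbb => /eqP].
  - by split; lra.
  - by split; lra.
  - by exfalso; lra.
have l := L1M_bound mom (fun t _ => bom t) lg.
have e0 := h om mom (fun t _ => bom t).
have mog : measurable_fun (`]0, 1[%classic : set R) (fun t => (om t * g t)%:E).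
  by apply/measurable_EFinP; exact: (L1_mfun l).
have := (ae_eq_integral_abs lebesgue_measure (@mI01 R) mog).1.
have -> : (\int[lebesgue_measure]_(x in `]0%R, 1%R[) `|(om x * g x)%:E|)%E = 0%E.
  rewrite -[RHS](congr1 EFin e0) -(It_EFin l); apply: eq_integral => t _.
  by rewrite gee0_abs// lee_fin (pos t).1.
move=> /(_ erefl) hae; apply: (@filterS _ (almost_everywhere lebesgue_measure) _) hae.
by move=> t ht tI; apply: (pos t).2; have [] := ht tI.
Qed.

(** * The limit of approximate solutions *)

Section Limit.
Variable R : realType.
Local Notation C := R[i].
Local Notation mu := (@lebesgue_measure R).
Local Notation I01 := (`]0, 1[%classic : set R).
Local Notation It := (@It R).

Lemma small_limit (u : nat -> R) (l a K : R) :
  u k @[k --> \oo] --> l -> (forall k : nat, `|u k - a| <= k.+2%:R^-1 * K) -> l = a.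
Proof.
move=> ul h; apply/eqP; rewrite -subr_eq0 -normr_le0.
have c1 : `|u k - a| @[k --> \oo] --> `|l - a|.
  by apply: cvg_norm; apply: cvgB => //; exact: cvg_cst.
have c2 : (k.+2%:R^-1 * K : R) @[k --> \oo] --> (0 * K : R).
  apply: cvgM; last exact: cvg_cst.
  have := @cvg_harmonic R; rewrite -(cvg_shiftS (@harmonic R)); exact.
rewrite mul0r in c2.
by apply: (ler_cvg_to c1 c2); apply: nearW => k; exact: h.
Qed.

Lemma pointwise_limit p q (u : nat -> R -> 'M[C]_(p, q)) (S : set R) (v0 : 'M[C]_(p, q)) :
  (forall t, I01 t -> ~ S t -> exists X, mxcvg (u ^~ t) X) ->
  exists v, (forall t, I01 t -> ~ S t -> mxcvg (u ^~ t) (v t)) /\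
            (forall t, S t -> v t = v0).
Proof.
move=> h.
exists (fun t => if `[< S t >] then v0 else xget v0 [set X | mxcvg (u ^~ t) X]).
split=> [t tI tS|t tS]; last by rewrite asboolT.
by rewrite asboolF//; have [X hX] := h t tI tS; exact: (xgetPex v0 (ex_intro _ X hX)).
Qed.

Lemma rtr1 (n : nat) : rtr (1%:M : 'M[C]_n) = n%:R.
Proof. by rewrite rtrE mxtrace1 -(rmorph_nat (real_complex R) n). Qed.

Variables (n N : nat) (L : 'I_N -> 'M[C]_n).
Hypothesis n0 : (0 < n)%N.
Hypothesis hL : forall k, Herm (L k).
Variables (rho0 rho1 : 'M[C]_n) (D : R).
Variable y : nat -> (R -> 'M[C]_n) * (R -> blockcol R n N) * (R -> R).
Hypothesis ya : forall k, approx_solution L rho0 rho1 D k.+2%:R^-1 (y k).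
Hypothesis yf : forall k : nat, sqdist (y k) (y k.+1) <= 16^-1 ^+ k.

Lemma tolerance_le_half (k : nat) : (k.+2%:R^-1 : R) <= 2^-1.
Proof. by rewrite lef_pV2 ?posrE// ler_nat. Qed.

Lemma iterate_rho_L2 k : L2 (y k).1.1.
Proof. by have [] := approx_L2 (tolerance_le_half k) (ya k). Qed.

Lemma iterate_m_L2 k : L2 (y k).1.2.
Proof. by have [] := approx_L2 (tolerance_le_half k) (ya k). Qed.

Lemma iterate_rho_fast (k : nat) :
  It (fun t => rinner ((y k).1.1 t - (y k.+1).1.1 t) ((y k).1.1 t - (y k.+1).1.1 t)) <= 16^-1 ^+ k.
Proof.
have i1 := ((L2P _).1 (L2B (iterate_rho_L2 k) (iterate_rho_L2 k.+1))).2.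
have i2 := ((L2P _).1 (L2B (iterate_m_L2 k) (iterate_m_L2 k.+1))).2.
apply: le_trans (yf k); apply: It_le => //; first exact: L1D.
by move=> t _; rewrite lerDl rinner_ge0.
Qed.

Lemma iterate_m_fast (k : nat) :
  It (fun t => rinner ((y k).1.2 t - (y k.+1).1.2 t) ((y k).1.2 t - (y k.+1).1.2 t)) <= 16^-1 ^+ k.
Proof.
have i1 := ((L2P _).1 (L2B (iterate_rho_L2 k) (iterate_rho_L2 k.+1))).2.
have i2 := ((L2P _).1 (L2B (iterate_m_L2 k) (iterate_m_L2 k.+1))).2.
apply: le_trans (yf k); apply: It_le => //; first exact: L1D.
by move=> t _; rewrite lerDr rinner_ge0.
Qed.

(** On the null set where the sequence may diverge, rho is set to 1/n times the
    identity and m to 0: there F vanishes, so the last two properties hold at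
    every time. *)
Lemma limit_exists : exists (rho : R -> 'M[C]_n) (m : R -> blockcol R n N),
  [/\ mxmeas rho /\ mxmeas m,
      ae01 (fun t => mxcvg (fun k => (y k).1.1 t) (rho t)),
      ae01 (fun t => mxcvg (fun k => (y k).1.2 t) (m t)),
      forall t, I01 t -> Hpsd (rho t) /\ rtr (rho t) = 1 &
      forall t, I01 t -> (F (rho t) (m t) <= limn_einf (fun k => ((y k).2 t)%:E))%E].
Proof.
have aer := limit_ae iterate_rho_L2 iterate_rho_fast; have aem := limit_ae iterate_m_L2 iterate_m_fast.
have [S [mS muS0 bad]] := ae01_and aer aem.
have good t : I01 t -> ~ S t -> (exists X, mxcvg (fun k => (y k).1.1 t) X) /\
    (exists X, mxcvg (fun k => (y k).1.2 t) X).
  by move=> tI tS; apply: contrapT => h; apply: tS; apply: bad => /= k; apply: h; exact: k.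
have [rho [rc rS]] := @pointwise_limit _ _ (fun k => (y k).1.1) S
  ((n%:R^-1 : R)%:C *: 1%:M) (fun t tI tS => (good t tI tS).1).
have [m [mc mS0]] := @pointwise_limit _ _ (fun k => (y k).1.2) S 0
  (fun t tI tS => (good t tI tS).2).
have aeS : ae01 (fun t => ~ S t).
  by exists S; split => // t /= h; apply: contrapT => tS; apply: h => _.
exists rho, m; split.
- split; first exact: (limit_meas iterate_rho_L2 mS rc rS).
  exact: (limit_meas iterate_m_L2 mS mc mS0).
- by apply: ae01_imp aeS => t tI tS; exact: rc.
- by apply: ae01_imp aeS => t tI tS; exact: mc.
- move=> t tI; have [tS|tS] := pselect (S t).
    rewrite (rS t tS); split; first by apply: psdZ; [rewrite invr_ge0|exact: psd1].
    by rewrite /rtr (rinnerZr _ _ 1%:M) -/(rtr 1%:M) rtr1 mulVf// pnatr_eq0 -lt0n.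
  split; first by apply: (mxcvg_psd (rc t tI tS)) => k; exact: approx_psd (ya k) t.
  apply: (@small_limit _ _ _ 1 (rc t tI tS 1%:M)) => k.
  by rewrite mulr1; exact: (approx_tr (ya k)).
- move=> t tI; have [tS|tS] := pselect (S t); last first.
    exact: (F_le_liminf (fun k => approx_psd (ya k) t) (fun k => approx_energy (ya k) t)
      (rc t tI tS) (mc t tI tS)).
  have psd : Hpsd ((n%:R^-1 : R)%:C *: (1%:M : 'M[C]_n)).
    by apply: psdZ; [rewrite invr_ge0|exact: psd1].
  rewrite (rS t tS) (mS0 t tS).
  move: psd; set v := (_ *: _) => psd.
  have eb (k : nat) : energy_bound v (0 : blockcol R n N) 0.
    by move=> b; rewrite rinner0r sub0r oppr_le0 mulr_ge0//; exact: psd_quad_ge0.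
  have c1 : mxcvg (fun _ : nat => v) v by move=> E; exact: cvg_cst.
  have c2 : mxcvg (fun _ : nat => 0 : blockcol R n N) 0 by move=> E; exact: cvg_cst.
  have h := F_le_liminf (fun _ : nat => psd) eb c1 c2.
  apply: le_trans h _; apply: limn_einf_le => k; rewrite lee_fin.
  exact: energy_bound_ge0 (approx_energy (ya k) t).
Qed.

(** The primitive of a bounded weight is bounded, so both integrals are limits
    of integrals against bounded weights. *)
Lemma limit_constraint (rho : R -> 'M[C]_n) (m : R -> blockcol R n N) :
  mxmeas rho -> mxmeas m ->
  ae01 (fun t => mxcvg (fun k => (y k).1.1 t) (rho t)) ->
  ae01 (fun t => mxcvg (fun k => (y k).1.2 t) (m t)) ->
  forall E (c : R) (om : R -> R), measurable_fun I01 om ->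
    (forall t, I01 t -> `|om t| <= 1) -> `|c| <= 1 ->
  It (fun t => om t * rinner E (rho t)) + It (fun t => (c + prim om t) * rinner E (flux L (m t))) =
  (c + It om) * rinner E rho1 - c * rinner E rho0.
Proof.
move=> mr mm cr cm E c om mo bo bc.
have [mp [M bp]] := affine_prim_bound c (L1_bound mo bo).
have c1 := limit_integral iterate_rho_L2 iterate_rho_fast (E := E) mr cr mo bo.
have c2 := limit_integral iterate_m_L2 iterate_m_fast (E := nabla L (hpart E)) mm cm mp bp.
have e2 (f : R -> blockcol R n N) :
    It (fun t => (c + prim om t) * rinner (nabla L (hpart E)) (f t)) =
    It (fun t => (c + prim om t) * rinner E (flux L (f t))).
  by apply: eq_It => t _; congr (_ * _); exact/esym/rinner_flux.
rewrite (e2 m) in c2.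
apply: (@small_limit _ _ _ (1 + rinner E E) (cvgD c1 c2)) => k /=.
have := approx_defect (ya k) E mo bo bc; rewrite distrC; apply: le_trans.
rewrite (e2 (y k).1.2) /constraint_defect /constraint_integral.
have [i1 i2] := defect_L1 hL E c (iterate_rho_L2 k) (iterate_m_L2 k) mo bo.
by rewrite (ItD i1 i2).
Qed.

(** The weight om = 0, c = 1 yields the total flux.  With c = 0, integration by
    parts then shows that rho minus (rho0 + the primitive of the flux) is
    orthogonal to all bounded weights om. *)
Lemma limit_admissible (rho : R -> 'M[C]_n) (m : R -> blockcol R n N) :
  mxmeas rho -> mxmeas m -> L2 m ->
  ae01 (fun t => mxcvg (fun k => (y k).1.1 t) (rho t)) ->
  ae01 (fun t => mxcvg (fun k => (y k).1.2 t) (m t)) ->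
  (forall t, I01 t -> Hpsd (rho t) /\ rtr (rho t) = 1) ->
  admissible L rho0 rho1 rho m.
Proof.
move=> mr mm lm cr cm pr.
have con := limit_constraint mr mm cr cm.
have lr : L2 rho.
  apply: (@L2_bound _ _ _ _ 1 mr) => t tI; have [p t1] := pr t tI.
  by have := psd_norm_le p; rewrite t1 expr1n.
pose b E t := rinner E (flux L (m t)).
have lf := flux_mxL1 hL lm.
have lb E : L1 (b E) by exact: lf.
have one : `|1 : R| <= 1 by rewrite normr1.
have zero : `|0 : R| <= 1 by rewrite normr0.
have total E : It (b E) = rinner E rho1 - rinner E rho0.
  have := con E 1 (fun=> 0) (measurable_cst _) (fun _ _ => zero) one.
  rewrite It_cst addr0 !mul1r => <-.
  rewrite [X in X + _](_ : _ = 0) ?add0r; last first.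
    by rewrite (@eq_It _ _ (fun=> 0)) ?It_cst// => t _; rewrite mul0r.
  by apply: eq_It => t /I01_le t01; rewrite prim_cst// mulr0 addr0 mul1r.
have formula E : ae01 (fun t => rinner E (rho t) = rinner E rho0 + prim (b E) t).
  pose g t := rinner E (rho t) - (rinner E rho0 + prim (b E) t).
  have lp : L1 (prim (b E)).
    apply: (@L1_bound _ _ (It (fun s => `|b E s|))); first exact: prim_mfun.
    by move=> t /I01_le t01; exact: prim_le.
  have lrho : L1 (fun t => rinner E (rho t)) by exact: (L2_coordL1 lr).
  have lg : L1 g by apply: L1B => //; apply: L1D => //; exact: L1_cst.
  suff g0 : ae01 (fun t => g t = 0).
    by apply: ae01_imp g0 => t _ /eqP; rewrite subr_eq0 => /eqP.
  apply: bounded_test_ae => // om mo bo.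
  have lo := L1_bound mo bo.
  have h := con E 0 om mo bo zero; rewrite add0r mul0r subr0 in h.
  have h2 := ibp_prim lo (lb E).
  have l1 := L1M_bound mo bo lrho; have l2 := L1M_bound mo bo lp.
  have -> : It (fun t => om t * g t) = It (fun t => om t * rinner E (rho t)) -
      (rinner E rho0 * It om + It (fun t => om t * prim (b E) t)).
    rewrite -(ItZ _ lo) -(ItD (L1Z _ lo) l2) -(ItB l1 (L1D (L1Z _ lo) l2)).
    by apply: eq_It => t _; rewrite /g; ring.
  have e0 : It (fun t => (0 + prim om t) * rinner E (flux L (m t))) =
      It (fun t => prim om t * b E t).
    by apply: eq_It => t _; rewrite add0r.
  have hring (A P Q o r0 r1 : R) : A + Q = o * r1 -> P + Q = o * (r1 - r0) ->
    A - (r0 * o + P) = 0 by rewrite mulrBr (mulrC r0); lra.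
  apply: (hring _ _ (It (fun t => prim om t * b E t)) _ _ (rinner E rho1)).
    by rewrite -e0.
  by rewrite -total.
have [fc [rf f0 fp]] := coordinates_primitive lf formula.
have f1 : fc 1 = rho1.
  apply: rinner_nondeg => E; rewrite (fp E 1) ?lexx ?ler01// prim1 f0 (total E).
  by rewrite addrC subrK.
split => //.
- by split=> // t /pr[p _]; exact: psd_herm.
- by apply: ae01_T => t /pr[p t1]; rewrite (Herm_tr_real (psd_herm p)) t1.
- by rewrite -f0 -f1; exact: (primitive_boundary lf rf fp).
- under eq_fun do rewrite -flux_def.
  exact: (primitive_weak mr lf rf fp).
Qed.

(** Fatou's lemma for the energy bounds, which are measurable, in place of
    F (rho t) (m t). *)
Lemma limit_action (rho : R -> 'M[C]_n) (m : R -> blockcol R n N) :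
  (forall t, I01 t -> (F (rho t) (m t) <= limn_einf (fun k => ((y k).2 t)%:E))%E) ->
  (action rho m <= D%:E)%E.
Proof.
move=> h.
apply: (@le_trans _ _ (\int[mu]_(t in I01) limn_einf (fun k => ((y k).2 t)%:E))%E).
  by apply: le_lower_integral => // t _; exact: F_ge0.
apply: (@le_trans _ _ (limn_einf (fun k => (\int[mu]_(t in I01) ((y k).2 t)%:E)%E))).
  apply: fatou => //.
    by move=> k; apply/measurable_EFinP; exact: (L1_mfun (approx_L1 (ya k))).
  by move=> k t _; rewrite lee_fin; exact: energy_bound_ge0 (approx_energy (ya k) t).
have cv : ((D + k.+2%:R^-1)%:E : \bar R) @[k --> \oo] --> D%:E.
  apply: cvg_EFin; first exact: nearW.
  rewrite -[X in _ --> X]addr0; apply: cvgD; first exact: cvg_cst.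
  have := @cvg_harmonic R; rewrite -(cvg_shiftS (@harmonic R)); exact.
have [<- _] := cvg_limn_einf_sup cv; apply: limn_einf_le => k.
by rewrite (It_EFin (approx_L1 (ya k))) lee_fin; exact: approx_le (ya k).
Qed.

Lemma limit_L2m (rho : R -> 'M[C]_n) (m : R -> blockcol R n N) : mxmeas m ->
  (forall t, I01 t -> Hpsd (rho t) /\ rtr (rho t) = 1) ->
  (action rho m <= D%:E)%E -> L2 m.
Proof.
move=> mm pr ha; apply/L2P; split=> //.
have ms := mxmeas_rinner mm mm.
have mh : measurable_fun I01 (fun t => 2^-1 * rinner (m t) (m t)) by exact: measurable_funM.
suff lh : L1 (fun t => 2^-1 * rinner (m t) (m t)).
  by apply: L1_ext (L1Z 2 lh) => t; rewrite mulrA divff// mul1r.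
have nn t : 0 <= 2^-1 * rinner (m t) (m t) by rewrite mulr_ge0// rinner_ge0.
apply/integrableP; split; first exact/measurable_EFinP.
apply: (@le_lt_trans _ _ D%:E); last by rewrite ltry.
apply: le_trans ha; apply: le_lower_integral => [t _|t tI]; first exact: abse_ge0.
have [p t1] := pr t tI.
apply: le_trans (F_ge (m t) (m t) p).
rewrite /= ger0_norm// lee_fin.
by have := psd_quad_le (m t) p; rewrite t1; lra.
Qed.

End Limit.

Lemma approximate_to_exact (R : realType) (n N : nat) (L : 'I_N -> 'M[R[i]]_n)
    (n0 : (0 < n)%N) (hL : forall k, Herm (L k)) (rho0 rho1 : 'M[R[i]]_n) (D : R) :
  (forall kap, 0 < kap -> exists x, approx_solution L rho0 rho1 D kap x) -> 0 <= D ->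
  exists (rho : R -> 'M[R[i]]_n) (m : R -> blockcol R n N),
    admissible L rho0 rho1 rho m /\ (action rho m <= D%:E)%E.
Proof.
move=> ex D0; have [y [ya yf]] := approx_fast hL ex D0.
have [rho [m [[mr mm] cr cm pr hF]]] := limit_exists n0 ya yf.
have ha := limit_action ya hF; have lm := limit_L2m mm pr ha.
by exists rho, m; split=> //; exact: (limit_admissible hL ya yf mr mm lm cr cm pr).
Qed.

(** * Step functions on a uniform grid *)

Section Steps.
Variable R : realType.
Local Notation C := R[i].
Local Notation mu := (@lebesgue_measure R).
Local Notation I01 := (`]0, 1[%classic : set R).
Local Notation It := (@It R).

Lemma lt_mfun (b : R) : measurable_fun I01 (fun t : R => (t < b)%R%:R : R).
Proof.
apply: (mfun_ext (f := fun t => \1_(`]-oo, b[%classic : set R) t)).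
  by move=> t; rewrite indicE mem_setE in_itv.
apply: measurable_funTS; apply: measurable_indic; exact: measurable_itv.
Qed.

Lemma lt_bound (b t : R) : `|(t < b)%R%:R : R| <= 1.
Proof. by case: (t < b); rewrite ?normr1 ?normr0. Qed.

Lemma It_lt (g : R -> R) (b : R) : 0 <= b <= 1 ->
  It (fun t => (t < b)%R%:R * g t) = prim g b.
Proof.
move=> /andP[b0 b1]; rewrite /It /prim [LHS]Rintegral_mkcond [RHS]Rintegral_mkcond.
apply: eq_Rintegral => t _; rewrite /patch !mem_setE !in_itv /=.
case: (ltP 0 t) => //= t0; have [tb|tb] := ltP t b.
  by rewrite (lt_le_trans tb b1) mul1r.
by rewrite mul0r if_same.
Qed.

(** The primitive of a function bounded by 1 is 1-Lipschitz. *)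
Lemma prim_lip (om : R -> R) s t : measurable_fun I01 om ->
  (forall u, I01 u -> `|om u| <= 1) -> 0 <= s <= 1 -> 0 <= t <= 1 ->
  `|prim om t - prim om s| <= `|t - s|.
Proof.
move=> mo bo; wlog st : s t / s <= t.
  move=> h s01 t01; case: (leP s t) => [|/ltW] st; first exact: h.
  by rewrite distrC (distrC t); exact: h.
move=> s01 t01; have lo := L1_bound mo bo.
have l1 (b : R) : L1 (fun u => (u < b)%R%:R : R).
  by apply: (@L1_bound _ _ 1); [exact: lt_mfun|move=> u _; exact: lt_bound].
have l2 (b : R) : L1 (fun u => (u < b)%R%:R * om u).
  by apply: (@L1M_bound _ _ _ 1); [exact: lt_mfun|move=> u _; exact: lt_bound|].
have e (b : R) : 0 <= b <= 1 -> It (fun u => (u < b)%R%:R : R) = b.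
  move=> b01; rewrite -[RHS]mulr1 -(prim_cst 1 b01) -(It_lt _ b01).
  by apply: eq_It => u _; rewrite mulr1.
rewrite -(It_lt om t01) -(It_lt om s01) -(ItB (l2 t) (l2 s)).
apply: le_trans (It_norm _) _; first exact: L1B.
rewrite [leRHS]ger0_norm ?subr_ge0// -{2}(e _ t01) -{2}(e _ s01) -(ItB (l1 t) (l1 s)).
apply: It_le; [by apply: L1_norm; apply: L1B|exact: L1B|].
move=> u uI; rewrite -mulrBl normrM.
have : `|(u < t)%R%:R - (u < s)%R%:R : R| = (u < t)%R%:R - (u < s)%R%:R.
  rewrite ger0_norm// subr_ge0 ler_nat.
  by case: (ltP u s) => us; rewrite ?(lt_le_trans us st).
by move=> ->; rewrite ler_piMr ?bo// subr_ge0 ler_nat; case: (ltP u s) => us; rewrite ?(lt_le_trans us st).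
Qed.

Variable K : nat.
Local Notation Kr := (K.+1%:R : R).

Definition grid (k : nat) : R := k%:R / Kr.
(** The index of the cell that contains t, for t in the open unit interval. *)
Definition cell (t : R) : 'I_K.+1 := inord (Num.trunc (Kr * t)).

Lemma cells_gt0 : 0 < Kr. Proof. by rewrite ltr0n. Qed.

Lemma grid01 (k : nat) : (k <= K.+1)%N -> 0 <= grid k <= 1.
Proof.
move=> kK; rewrite /grid divr_ge0 ?ler0n//=.
by rewrite ler_pdivrMr ?cells_gt0// mul1r ler_nat.
Qed.

Lemma grid_le (j k : nat) : (j <= k)%N -> grid j <= grid k.
Proof. by move=> jk; rewrite /grid ler_pM2r ?invr_gt0 ?cells_gt0// ler_nat. Qed.

Lemma cellP t : I01 t -> grid (cell t) <= t < grid (cell t).+1.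
Proof.
move=> /I01P /andP[t0 t1].
have Kt0 : 0 <= Kr * t by rewrite mulr_ge0 ?ltW ?cells_gt0.
have /andP[h1 h2] := Num.Theory.truncn_itv Kt0.
have lt : (Num.trunc (Kr * t) < K.+1)%N.
  rewrite -(ltr_nat R); apply: (le_lt_trans h1).
  by rewrite -[ltRHS]mulr1 ltr_pM2l ?cells_gt0.
rewrite /cell inordK// /grid ler_pdivrMr ?cells_gt0// ltr_pdivlMr ?cells_gt0// (mulrC t).
by rewrite h1 h2.
Qed.

Lemma cell_lt t (k : nat) : I01 t -> (t < grid k) = (cell t < k)%N.
Proof.
move=> tI; have /andP[h1 h2] := cellP tI; apply/idP/idP => h.
  rewrite ltnNge; apply/negP => /grid_le h3.
  by have := lt_le_trans h (le_trans h3 h1); rewrite ltxx.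
by apply: lt_le_trans h2 _; exact: grid_le.
Qed.

Lemma cell_indicator t (k : nat) : I01 t ->
  (t < grid k.+1)%R%:R - (t < grid k)%R%:R = (k == cell t)%:R :> R.
Proof.
move=> tI; rewrite !cell_lt// ltnS leq_eqVlt eq_sym.
by case: (ltngtP (cell t) k); rewrite ?subrr ?subr0.
Qed.

Lemma step_sum (h : 'I_K.+1 -> R) t : I01 t ->
  h (cell t) = \sum_(k < K.+1) h k * ((t < grid k.+1)%R%:R - (t < grid k)%R%:R).
Proof.
move=> tI; rewrite (bigD1 (cell t))//= cell_indicator// eqxx mulr1 big1 ?addr0// => k kt.
by rewrite cell_indicator// (inj_eq val_inj) (negPf kt) mulr0.
Qed.

Lemma step_mfun (h : 'I_K.+1 -> R) : measurable_fun I01 (fun t => h (cell t)).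
Proof.
pose f (t : R) : R := \sum_(k < K.+1) h k * ((t < grid k.+1)%R%:R - (t < grid k)%R%:R).
apply: (eq_measurable_fun f).
  by move=> t /set_mem tI; rewrite (step_sum h tI).
apply: measurable_sum => k; apply: measurable_funM => //.
by apply: measurable_funB; exact: lt_mfun.
Qed.

Lemma step_bound (h : 'I_K.+1 -> R) t : `|h (cell t)| <= \sum_k `|h k|.
Proof. by rewrite (bigD1 (cell t))//= lerDl sumr_ge0. Qed.

Lemma step_L1M (h : 'I_K.+1 -> R) g : L1 g -> L1 (fun t => h (cell t) * g t).
Proof. by move=> lg; exact: (L1M_bound (step_mfun h) (fun t _ => step_bound h t) lg). Qed.

Lemma step_L1 (h : 'I_K.+1 -> R) : L1 (fun t => h (cell t)).
Proof. exact: (L1_bound (step_mfun h) (fun t _ => step_bound h t)). Qed.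

Lemma It_step (h : 'I_K.+1 -> R) g : L1 g ->
  It (fun t => h (cell t) * g t) =
  \sum_(k < K.+1) h k * (prim g (grid k.+1) - prim g (grid k)).
Proof.
move=> lg.
have l2 (b : R) : L1 (fun u => (u < b)%R%:R * g u).
  by apply: (@L1M_bound _ _ _ 1); [exact: lt_mfun|move=> u _; exact: lt_bound|].
rewrite (@eq_It _ _ (fun t => \sum_(k < K.+1) h k *
   ((t < grid k.+1)%R%:R * g t - (t < grid k)%R%:R * g t))); last first.
  move=> t tI; rewrite step_sum// mulr_suml; apply: eq_bigr => k _.
  by rewrite -mulrA mulrBl.
rewrite It_sum; last by move=> k _; apply: L1Z; exact: L1B.
apply: eq_bigr => k _; rewrite (ItZ _ (L1B (l2 _) (l2 _))) (ItB (l2 _) (l2 _)).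
by rewrite !It_lt// grid01// ltnW.
Qed.

Lemma It_step_cst (h : 'I_K.+1 -> R) :
  It (fun t => h (cell t)) = \sum_(k < K.+1) h k / Kr.
Proof.
rewrite (@eq_It _ _ (fun t => h (cell t) * 1)); last by move=> t _; rewrite mulr1.
rewrite It_step; last exact: L1_cst.
apply: eq_bigr => k _; rewrite !prim_cst ?grid01// 1?ltnW//; congr (_ * _).
by rewrite !mulr1 /grid -mulrBl -natrB// subSnn mul1r.
Qed.

(** By the Lipschitz bound, the mean of c + prim om over a cell is within the
    length of the cell of its values at the two ends. *)
Lemma cell_mean (c : R) (om : R -> R) (k : 'I_K.+1) (j : nat) :
  measurable_fun I01 om -> (forall u, I01 u -> `|om u| <= 1) ->
  (k <= j <= k.+1)%N ->
  `|prim (fun t => c + prim om t) (grid k.+1) - prim (fun t => c + prim om t) (grid k) -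
    (c + prim om (grid j)) / Kr| <= Kr^-1 / Kr.
Proof.
move=> mo bo /andP[kj jk]; have lo := L1_bound mo bo.
have [mW [M bW]] := affine_prim_bound c lo.
have lW := L1_bound mW bW.
have jK : (j <= K.+1)%N by apply: leq_trans jk _.
pose h (i : 'I_K.+1) : R := (i == k)%:R.
have sumh (f : 'I_K.+1 -> R) : \sum_(i < K.+1) h i * f i = f k.
  rewrite (bigD1 k)//= /h eqxx mul1r big1 ?addr0// => i /negPf ->.
  by rewrite mul0r.
have e1 := It_step h lW; rewrite sumh in e1.
have e2 := It_step_cst h; rewrite sumh in e2.
have lh := step_L1 h; have lhW := step_L1M h lW.
have -> : prim (fun t => c + prim om t) (grid k.+1) - prim (fun t => c + prim om t) (grid k) -
    (c + prim om (grid j)) / Kr =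
    It (fun t => h (cell t) * (c + prim om t) - (c + prim om (grid j)) * h (cell t)).
  by rewrite (ItB lhW (L1Z _ lh)) (ItZ _ lh) e1 e2.
apply: le_trans (It_norm _) _; first by apply: L1B => //; exact: L1Z.
have -> : Kr^-1 / Kr = It (fun t => Kr^-1 * h (cell t)) by rewrite (ItZ _ lh) e2.
apply: It_le; [|exact: L1Z|].
  by apply: L1_norm; apply: L1B => //; exact: L1Z.
move=> t tI; rewrite (mulrC (c + _) (h _)) -mulrBr normrM /h; case: eqP => [tk|_]; last first.
  by rewrite normr0 !(mul0r, mulr0).
rewrite normr1 mul1r mulr1.
have -> : (c + prim om t) - (c + prim om (grid j)) = prim om t - prim om (grid j) by ring.
apply: le_trans (prim_lip mo bo (grid01 jK) (I01_le tI)) _.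
have /andP[c1 c2] := cellP tI; rewrite tk in c1 c2.
have g1 := grid_le kj; have g2 := grid_le jk.
have : grid k.+1 = grid k + Kr^-1 by rewrite /grid -addn1 natrD mulrDl mul1r.
rewrite ler_norml; move: c1 c2 g1 g2; move: (grid k.+1) (grid k) (grid j) (Kr^-1) => p q r z.
by move=> *; apply/andP; split; lra.
Qed.

(** The primitive of the slopes interpolates linearly. *)
Lemma polygon (a : nat -> R) t : I01 t ->
  a 0%N + prim (fun s => Kr * (a (cell s).+1 - a (cell s))) t =
  (1 - (Kr * t - (cell t)%:R)) * a (cell t) + (Kr * t - (cell t)%:R) * a (cell t).+1.
Proof.
move=> tI; have t01 := I01_le tI.
pose h (k : 'I_K.+1) := Kr * (a k.+1 - a k).
have l1 : L1 (fun u => (u < t)%R%:R : R).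
  by apply: (@L1_bound _ _ 1); [exact: lt_mfun|move=> u _; exact: lt_bound].
rewrite -(It_lt _ t01) (@eq_It _ _ (fun s => h (cell s) * (s < t)%R%:R)); last first.
  by move=> s _; rewrite mulrC.
rewrite (It_step h l1).
have mn (b : R) : 0 <= b <= 1 -> prim (fun u => (u < t)%R%:R : R) b = Num.min b t.
  move=> b01; have m01 : 0 <= Num.min b t <= 1.
    by rewrite /Num.min; case: ifP.
  rewrite -[RHS]mulr1 -(prim_cst 1 m01) -(It_lt _ b01) -(It_lt _ m01).
  apply: eq_It => u _; rewrite lt_min mulr1.
  by case: (u < b); rewrite ?mul1r ?mul0r.
have key (m : nat) : (m <= K.+1)%N ->
  \sum_(0 <= k < m) Kr * (a k.+1 - a k) * (Num.min (grid k.+1) t - Num.min (grid k) t) =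
  if (m <= cell t)%N then a m - a 0%N else
  (1 - (Kr * t - (cell t)%:R)) * a (cell t) + (Kr * t - (cell t)%:R) * a (cell t).+1 - a 0%N.
  elim: m => [_|m IH mK]; first by rewrite big_geq// leq0n subrr.
  rewrite big_nat_recr//= IH ?(ltnW mK)//.
  have mnE (k : nat) : Num.min (grid k) t = if (k <= cell t)%N then grid k else t.
    by rewrite minC /Num.min cell_lt// ltnNge; case: leqP.
  rewrite !mnE; have Kn0 : Kr != 0 by rewrite gt_eqF ?cells_gt0.
  have sg : grid m.+1 = grid m + Kr^-1 by rewrite /grid -addn1 natrD mulrDl mul1r.
  case: (ltngtP m (cell t)) => h1.
  - by rewrite sg; field.
  - by rewrite subrr mulr0 addr0.
  - by rewrite /grid -h1; field.
have -> : \sum_(k < K.+1) h k * (prim (fun u => (u < t)%R%:R) (grid k.+1) -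
     prim (fun u => (u < t)%R%:R) (grid k)) =
  \sum_(0 <= k < K.+1) Kr * (a k.+1 - a k) * (Num.min (grid k.+1) t - Num.min (grid k) t).
  rewrite big_mkord; apply: eq_bigr => k _.
  by rewrite !mn ?grid01// ltnW.
by rewrite key// leqNgt ltn_ord /=; ring.
Qed.

End Steps.

(** * Discrete duality on a time grid *)

Section GridDuality.
Variable R : realType.
Local Notation C := R[i].
Variables (n N : nat) (L : 'I_N -> 'M[C]_n).
Hypothesis hL : forall k, Herm (L k).
Variables (rho0 rho1 : 'M[C]_n) (K : nat).
Local Notation Kr := (K.+1%:R : R).

Definition grid_hjb (l : nat -> 'M[C]_n) (k : nat) (b : bool) : 'M[C]_n :=
  Kr%:C *: (l k.+1 - l k) + (2^-1 : R)%:C *: gram L (l (k + b)%N).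

Lemma pick_sum p q (k m : nat) (f : 'I_m.+1 -> 'M[C]_(p, q)) : (k <= m)%N ->
  \sum_(i < m.+1) ((i == k :> nat)%:R : R)%:C *: f i = f (inord k).
Proof.
move=> km; rewrite (bigD1 (inord k))//= inordK// eqxx scale1r big1 ?addr0// => i ik.
suff -> : (i == k :> nat) = false by rewrite scale0r.
by apply: contraNF ik => /eqP ik; apply/eqP/val_inj; rewrite /= inordK.
Qed.

(** [discrete_duality] for the nodes 0, ..., K.+1 and two constraints on each of
    the K.+1 cells: the constraint (k, b) has the difference quotient over the
    cell k as its velocity, and its quadratic term is taken at the node k + b.
    The potential is indexed by nat to avoid ordinals of two sizes. *)
Lemma grid_duality (q de : R) : 0 < q -> 0 < de ->
  exists (l : nat -> 'M[C]_n) (r : 'I_K.+1 -> bool -> 'M[C]_n),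
  [/\ forall k, Herm (l k), forall k b, Hpsd (r k b),
      forall k b, Hpsd (q%:C *: r k b - grid_hjb l k b),
      forall k b, rinner (r k b) (q%:C *: r k b - grid_hjb l k b) = 0 &
      forall eta : nat -> 'M[C]_n, (forall k, Herm (eta k)) ->
      rinner rho1 (eta K.+1) - rinner rho0 (eta 0%N) =
      \sum_(k < K.+1) \sum_(b : bool)
        (Kr * (rinner (r k b) (eta k.+1) - rinner (r k b) (eta k)) +
         rinner (nabla L (eta (k + b)%N)) (nabla L (l (k + b)%N) *m r k b)) +
      de * \sum_(i < K.+2) rinner (l i) (eta i)].
Proof.
move=> q0 de0.
pose bb (j : 'I_K.+1 * bool) (i : 'I_K.+2) : R :=
  Kr * ((i == j.1.+1 :> nat)%:R - (i == j.1 :> nat)%:R).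
pose nu (j : 'I_K.+1 * bool) : 'I_K.+2 := inord (j.1 + j.2).
pose c (i : 'I_K.+2) : 'M[C]_n := ((i == K.+1 :> nat)%:R : R)%:C *: rho1 -
  ((i == 0%N :> nat)%:R : R)%:C *: rho0.
have velE (eta : 'I_K.+2 -> 'M[C]_n) j :
    velocity bb eta j = Kr%:C *: (eta (inord j.1.+1) - eta (inord j.1)).
  have k1 : (j.1.+1 <= K.+1)%N by rewrite ltnS -ltnS.
  rewrite -(pick_sum eta k1) -(pick_sum eta (ltnW k1)) -sumrB scaler_sumr.
  apply: eq_bigr => i _; rewrite -scalerBl -rmorphB scalerA -rmorphM; congr (_%:C *: _).
have cE (eta : 'I_K.+2 -> 'M[C]_n) :
    \sum_i rinner (c i) (eta i) = rinner rho1 (eta (inord K.+1)) - rinner rho0 (eta (inord 0)).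
  rewrite -(pick_sum eta (leqnn K.+1)) -(pick_sum eta (leq0n K.+1)) !rinner_sumr -sumrB.
  apply: eq_bigr => i _; rewrite (rinnerBl _ (_ *: rho1)).
  rewrite (rinnerZl _ rho1) (rinnerZl _ rho0) (rinnerZr _ rho1) (rinnerZr _ rho0).
  by [].
have qi0 : 0 < q^-1 by rewrite invr_gt0.
have [lam [r [h1 h2 h3 h4 h5]]] := discrete_duality hL bb nu c qi0 de0.
rewrite invrK in h3 h4.
have hjbE k b : hjb L bb nu lam (k, b) = grid_hjb (fun i => lam (inord i)) k b.
  by rewrite /hjb velE.
exists (fun k => lam (inord k)), (fun k b => r (k, b)); split.
- by move=> k; exact: h1.
- by move=> k b; exact: h2.
- by move=> k b; rewrite -hjbE; exact: h3.
- by move=> k b; rewrite -hjbE; exact: h4.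
move=> eta he; have := h5 (fun i : 'I_K.+2 => eta i) (fun i => he i).
have nuE (k : 'I_K.+1) (b : bool) : (nu (k, b) : nat) = (k + b)%N.
  rewrite /nu inordK// ltnS; apply: (@leq_trans (k + 1)); first by rewrite leq_add2l; case: b.
  by rewrite addn1.
have := cE (fun i : 'I_K.+2 => eta i).
rewrite (inordK (ltnSn K.+1)) (inordK (ltn0Sn K.+1)) => e0 h.
apply: etrans (esym e0) (etrans h _); apply: (congr2 +%R).
  pose T k b := Kr * (rinner (r (k, b)) (eta k.+1) - rinner (r (k, b)) (eta k)) +
    rinner (nabla L (eta (k + b)%N)) (nabla L (lam (inord (k + b))) *m r (k, b)).
  apply: etrans (esym (pair_bigA _ T)).
  apply: eq_bigr => -[k b] _; rewrite /T /= nuE.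
  have kk : (k.+1 < K.+2)%N by rewrite ltnS.
  rewrite (velE (fun i : 'I_K.+2 => eta i)) /= (inordK kk) (inordK (ltnW kk)).
  by rewrite rinnerZr (rinnerBr _ (eta k.+1)).
by apply: (congr1 ( *%R de)); apply: eq_bigr => i _; rewrite inord_val.
Qed.

End GridDuality.

(** * From a discrete to a continuous potential *)

Section DualCandidate.
Variable R : realType.
Local Notation C := R[i].
Local Notation I01 := (`]0, 1[%classic : set R).
Local Notation It := (@It R).
Variables (n N : nat) (L : 'I_N -> 'M[C]_n).
Hypothesis hL : forall k, Herm (L k).
Variables (rho0 rho1 : 'M[C]_n) (K : nat).
Hypothesis tr1 : rtr rho1 = 1.
Local Notation Kr := (K.+1%:R : R).
Local Notation cell := (@cell R K).

(** The slack at a point of a cell is the convex combination of the slacks at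
    its two ends plus a convexity defect. *)
Lemma convex_defect (s : R) (T A G0 G1 GP : 'M[C]_n) :
  - (A - T + (2^-1 : R)%:C *: GP) =
  (1 - s)%:C *: (T - (A + (2^-1 : R)%:C *: G0)) + s%:C *: (T - (A + (2^-1 : R)%:C *: G1)) +
  (2^-1 : R)%:C *: ((1 - s)%:C *: G0 + s%:C *: G1 - GP).
Proof.
apply: rinner_nondeg => E.
rewrite !(rinnerDr, rinnerNr, rinnerZr).
move: (rinner E T) (rinner E A) (rinner E G0) (rinner E G1) (rinner E GP) => t a x y z.
by field.
Qed.

Lemma gram_shift (X : 'M[C]_n) (a : R) : gram L (X - a%:C *: 1%:M) = gram L X.
Proof.
rewrite /gram; have -> : nabla L (X - a%:C *: 1%:M) = nabla L X; last by [].
by rewrite linearB linearZ /= nabla1 scaler0 subr0.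
Qed.

(** On the cell k the derivative of the potential is the slope of the polygon
    minus tau k times the identity.  The correction makes the inequality hold,
    and since nabla kills the identity and rho1 has trace 1, its only cost is the
    integral of tau. *)
Lemma dual_candidate (l : nat -> 'M[C]_n) (tau : 'I_K.+1 -> R) :
  (forall k, Herm (l k)) ->
  (forall (k : 'I_K.+1) b, Hpsd ((tau k)%:C *: 1%:M - grid_hjb L K l k b)) ->
  dual_values L rho0 rho1
    (rinner rho1 (l K.+1) - rinner rho0 (l 0%N) - \sum_k tau k / Kr)%:E.
Proof.
move=> hl ht.
pose v t := Kr%:C *: (l (cell t).+1 - l (cell t)) - (tau (cell t))%:C *: 1%:M.
pose s t : R := Kr * t - (cell t)%:R.
pose P t := (1 - s t)%:C *: l (cell t) + (s t)%:C *: l (cell t).+1.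
pose th t := prim (fun u => tau (cell u)) t.
pose f t := P t - (th t)%:C *: 1%:M.
pose al E (k : 'I_K.+1) : R := Kr * (rinner E (l k.+1) - rinner E (l k)).
have vE E t : rinner E (v t) = al E (cell t) + - rinner E 1%:M * tau (cell t).
  rewrite /v (rinnerBr E (_ *: _)) (rinnerZr _ E 1%:M) (rinnerZr _ E (_ - _)).
  by rewrite (rinnerBr E (l _)) /al; ring.
have lal E : L1 (fun t => al E (cell t)) by exact: step_L1.
have ltau : L1 (fun t => tau (cell t)) by exact: step_L1.
have lv : mxL1 v.
  by move=> E; apply: L1_ext (L1D (lal E) (L1Z (- rinner E 1%:M) ltau)) => t; rewrite vE.
have primv E t : 0 <= t <= 1 -> prim (fun u => rinner E (v u)) t =
    prim (fun u => al E (cell u)) t - rinner E 1%:M * th t.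
  move=> t01; rewrite -mulNr -(primZ _ ltau t01) -(primD (lal E) (L1Z _ ltau) t01).
  by congr prim; apply/funext => u; exact: vE.
have formula E t : I01 t -> rinner E (f t) = rinner E (l 0%N) + prim (fun u => rinner E (v u)) t.
  move=> tI; rewrite (primv E t (I01_le tI)) /f (rinnerBr E (P t)) (rinnerZr _ E 1%:M) addrA.
  rewrite mulrC; congr (_ - _); rewrite (polygon K (fun k => rinner E (l k)) tI).
  by rewrite /P (rinnerDr E (_ *: _)) (rinnerZr _ E (l _)) (rinnerZr _ E (l _.+1)).
have [fc [_ fc0 fcp]] := coordinates_primitive lv (fun E => ae01_T (formula E)).
have fcE t : I01 t -> fc t = f t.
  move=> tI; apply: rinner_nondeg => E; apply: etrans (fcp E t (I01_le tI)) _.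
  by rewrite fc0; exact/esym/formula.
have hv t : Herm (v t).
  by apply: HermB; apply: HermZ; [exact: HermB|exact: Herm1].
have hf t : Herm (f t).
  by apply: HermB; [apply: HermD; exact: HermZ|apply: HermZ; exact: Herm1].
exists fc, v, (fc 0), (fc 1); split.
- split.
  + split; first exact: (primitive_L2 lv fcp).
    by move=> t tI; rewrite (fcE t tI); exact: hf.
  + split; last by move=> t _.
    pose M := \sum_(k < K.+1) `|rinner (Kr%:C *: (l k.+1 - l k) - (tau k)%:C *: 1%:M)
                               (Kr%:C *: (l k.+1 - l k) - (tau k)%:C *: 1%:M)|.
    apply: (@L2_bound _ _ _ _ M) => [E|t _]; first exact: (L1_mfun (lv E)).
    apply: le_trans (ler_norm _) _; rewrite /M (bigD1 (cell t))//= lerDl.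
    by apply: sumr_ge0 => k _.
  + apply: (primitive_weak _ lv (ae01_T (fun t _ => erefl (fc t))) fcp).
    exact: (primitive_meas lv fcp).
- exact: (primitive_boundary lv (ae01_T (fun t _ => erefl (fc t))) fcp).
- apply: ae01_T => t tI; rewrite (fcE t tI) half_complex -/(adj _) -/(gram L _) /f gram_shift.
  rewrite /v (convex_defect (s t) _ _ (gram L (l (cell t))) (gram L (l (cell t).+1))).
  have /andP[c1 c2] := cellP K tI.
  have s01 : 0 <= s t <= 1.
    rewrite /s subr_ge0 lerBlDl.
    move: c1 c2; rewrite /grid ler_pdivrMr ?ltr0n// ltr_pdivlMr ?ltr0n// !(mulrC t) => -> /ltW.
    by rewrite natr1 => ->.
  have /andP[s0 s1] := s01.
  apply: psdD; first apply: psdD.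
  + apply: psdZ; first by rewrite subr_ge0.
    by have := ht (cell t) false; rewrite /grid_hjb addn0.
  + apply: psdZ => //.
    by have := ht (cell t) true; rewrite /grid_hjb addn1.
  + by apply: psdZ; [rewrite invr_ge0|exact: gram_convex].
- congr (_%:E); rewrite (rinnerC (fc 1)) (rinnerC (fc 0)) fc0.
  rewrite (fcp rho1 1) ?lexx ?ler01// fc0 primv ?lexx ?ler01//.
  rewrite prim1 (It_step_cst (al rho1)) /th prim1 (It_step_cst tau).
  rewrite -[rinner rho1 1%:M]rinnerC -/(rtr rho1) tr1 mul1r.
  have -> : \sum_(k < K.+1) al rho1 k / Kr = rinner rho1 (l K.+1) - rinner rho1 (l 0%N).
    rewrite -(telescope_sumr (fun k => rinner rho1 (l k)))// big_mkord; apply: eq_bigr => k _.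
    by rewrite /al mulrAC divff ?mul1r// pnatr_eq0.
  have hring (a b x z : R) : b - x - z = a + (b - a - z) - x by ring.
  exact: hring.
Qed.

End DualCandidate.

(** * The energy of the multipliers *)

Section EnergyEstimate.
Variable R : realType.
Local Notation C := R[i].
Variables (n N : nat) (L : 'I_N -> 'M[C]_n).
Hypothesis hL : forall k, Herm (L k).
Variables (rho0 rho1 : 'M[C]_n) (K : nat).
Hypothesis tr1 : rtr rho1 = 1.
Local Notation Kr := (K.+1%:R : R).

(** The largest eigenvalue is at most the trace. *)
Lemma psd_trace_bound (r : 'M[C]_n) : Hpsd r -> Hpsd ((rtr r)%:C *: 1%:M - r).
Proof.
move=> hr; apply: psd_of_rinner.
  by apply: HermB; [apply: HermZ; exact: Herm1|exact: psd_herm].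
move=> P hP; rewrite (rinnerBl P) (rinnerZl _ 1%:M) subr_ge0 -/(rtr P).
have r0 := rtr_ge0 hr; have P0 := rtr_ge0 hP.
apply: le_trans (ler_norm _) _; rewrite -(ler_pXn2r (n := 2))// ?nnegrE ?mulr_ge0//.
rewrite real_normK ?num_real//; apply: le_trans (rinner_CS2 _ _) _.
by rewrite exprMn ler_pM ?rinner_ge0// psd_norm_le.
Qed.

(** This pays for the cost 2 eps rtr r of the correction with the penalty
    2 Kr eps |r|^2, up to a remainder that sums to 2 eps n over the 2 Kr
    constraints. *)
Lemma penalty_young (r : 'M[C]_n) : 2 * rtr r <= n%:R / Kr + Kr * rinner r r.
Proof.
have := rinner_young 1%:M r (_ : 0 < Num.sqrt Kr).
rewrite sqrtr_gt0 ltr0n => /(_ isT); rewrite sqr_sqrtr ?ler0n// -/(rtr r) -/(rtr 1%:M) rtr1.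
rewrite (mulrC Kr^-1); have := ler_norm (rtr r).
by move: (rtr r) (rinner r r) (n%:R / Kr) => a b c; lra.
Qed.

Lemma sum_bool (f : bool -> R) b : \sum_(a : bool) f a = f b + f (~~ b).
Proof. by rewrite big_bool; case: b => //=; rewrite addrC. Qed.

Definition cell_energy (l : nat -> 'M[C]_n) (r : 'I_K.+1 -> bool -> 'M[C]_n) (k : 'I_K.+1) (b : bool) : R :=
  2^-1 * rinner (nabla L (l (k + b)%N)) (nabla L (l (k + b)%N) *m r k b).

Variables (D eps de : R) (l : nat -> 'M[C]_n) (r : 'I_K.+1 -> bool -> 'M[C]_n).
Hypothesis eps0 : 0 < eps.
Hypothesis Dub : forall x, dual_values L rho0 rho1 x -> (x <= D%:E)%E.
Let q := 2 * Kr * eps.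
Hypothesis hl : forall k, Herm (l k).
Hypothesis hr : forall k b, Hpsd (r k b).
Hypothesis hp : forall (k : 'I_K.+1) (b : bool), Hpsd (q%:C *: r k b - grid_hjb L K l k b).
Hypothesis hc : forall (k : 'I_K.+1) (b : bool), rinner (r k b) (q%:C *: r k b - grid_hjb L K l k b) = 0.
Hypothesis el : forall eta : nat -> 'M[C]_n, (forall k, Herm (eta k)) ->
      rinner rho1 (eta K.+1) - rinner rho0 (eta 0%N) =
      \sum_(k < K.+1) \sum_(b : bool)
        (Kr * (rinner (r k b) (eta k.+1) - rinner (r k b) (eta k)) +
         rinner (nabla L (eta (k + b)%N)) (nabla L (l (k + b)%N) *m r k b)) +
      de * \sum_(i < K.+2) rinner (l i) (eta i).

Lemma penalty_gt0 : 0 < q.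
Proof. by rewrite /q !mulr_gt0 ?ltr0n. Qed.

(** The discrete continuity equation tested with l itself; complementary slackness
    turns the terms with the velocity of l into the penalty minus the energy. *)
Lemma discrete_value : rinner rho1 (l K.+1) - rinner rho0 (l 0%N) =
  \sum_(k < K.+1) \sum_(b : bool) (q * rinner (r k b) (r k b) + cell_energy l r k b) +
  de * \sum_(i < K.+2) rinner (l i) (l i).
Proof.
rewrite (el hl); congr (_ + _); apply: eq_bigr => k _; apply: eq_bigr => b _.
have := hc k b; rewrite (rinnerBr (r k b) (_ *: r k b)) (rinnerZr _ (r k b) (r k b)).
rewrite /grid_hjb (rinnerDr (r k b) (_ *: (_ - _))) (rinnerZr _ (r k b) (_ - _)).
rewrite (rinnerZr _ (r k b) (gram L _)) (rinnerBr (r k b) (l k.+1)) gram_rinner /cell_energy.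
by move=> h; lra.
Qed.

(** The feasible potential of [dual_candidate], with tau k = q sum_b rtr (r k b),
    has at most the value D. *)
Lemma discrete_energy :
  \sum_(k < K.+1) \sum_(b : bool) cell_energy l r k b +
  de * \sum_(i < K.+2) rinner (l i) (l i) <= D + 2 * eps * n%:R.
Proof.
pose tau (k : 'I_K.+1) := q * \sum_(b : bool) rtr (r k b).
have feas (k : 'I_K.+1) b : Hpsd ((tau k)%:C *: 1%:M - grid_hjb L K l k b).
  have -> : (tau k)%:C *: 1%:M - grid_hjb L K l k b =
     (q%:C *: r k b - grid_hjb L K l k b) + q%:C *: ((rtr (r k b))%:C *: 1%:M - r k b) +
     (q * rtr (r k (~~ b)))%:C *: 1%:M.
    have -> : tau k = q * rtr (r k b) + q * rtr (r k (~~ b)).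
      by rewrite /tau (sum_bool (fun b => rtr (r k b)) b) mulrDr.
    move: (grid_hjb L K l k b) (r k b) (r k (~~ b)) => h x y; apply: rinner_nondeg => E.
    by rewrite !(rinnerDr, rinnerNr, rinnerZr); ring.
  apply: psdD; first apply: psdD => //.
    by apply: psdZ; [exact/ltW/penalty_gt0|exact: psd_trace_bound].
  by apply: psdZ; [rewrite mulr_ge0 ?(ltW penalty_gt0)// rtr_ge0|exact: psd1].
have := Dub (dual_candidate rho0 tr1 hl feas).
rewrite lee_fin discrete_value.
have Kn0 : Kr != 0 by rewrite pnatr_eq0.
have -> : \sum_k tau k / Kr = \sum_(k < K.+1) \sum_(b : bool) (eps * (2 * rtr (r k b))).
  apply: eq_bigr => k _; rewrite -!mulr_sumr /tau /q.
  by move: (\sum_b _) (Kr) Kn0 => S z z0; field.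
have -> : 2 * eps * n%:R = \sum_(k < K.+1) \sum_(b : bool) (eps * (n%:R / Kr)).
  rewrite (eq_bigr (fun=> eps * (n%:R / Kr) *+ 2)); last by move=> k _; rewrite big_bool.
  rewrite sumr_const card_ord -[RHS]mulr_natl.
  by move: (n%:R) (Kr) Kn0 => x z z0; field.
have key : \sum_(k < K.+1) \sum_(b : bool) cell_energy l r k b +
    \sum_(k < K.+1) \sum_(b : bool) (eps * (2 * rtr (r k b))) <=
    \sum_(k < K.+1) \sum_(b : bool) (q * rinner (r k b) (r k b) + cell_energy l r k b) +
    \sum_(k < K.+1) \sum_(b : bool) (eps * (n%:R / Kr)).
  rewrite -!big_split; apply: ler_sum => k _; rewrite -!big_split; apply: ler_sum => b _ /=.
  have := ler_wpM2l (ltW eps0) (penalty_young (r k b)).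
  have := mulr_ge0 (mulr_ge0 (ler0n R K.+1) (ltW eps0)) (rinner_ge0 (r k b)).
  rewrite /q mulrDr; move: (cell_energy _ _ _ _) (rtr _) (rinner _ _) => x y z.
  by move=> h1; rewrite !mulrA; move: (eps * n%:R / Kr) => w; nra.
move: key; move: (\sum_(k < K.+1) _) (\sum_(k < K.+1) _) (\sum_(k < K.+1) _) (\sum_(k < K.+1) _).
by move: (de * _) => S a b c d; lra.
Qed.

End EnergyEstimate.

(** * From multipliers to approximate solutions *)

Section PrimalCandidate.
Variable R : realType.
Local Notation C := R[i].
Local Notation I01 := (`]0, 1[%classic : set R).
Local Notation It := (@It R).
Variables (n N : nat) (L : 'I_N -> 'M[C]_n).
Hypothesis hL : forall k, Herm (L k).

Variables (rho0 rho1 : 'M[C]_n) (K : nat).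
Hypotheses (h0 : Herm rho0) (h1 : Herm rho1).
Hypotheses (tr0 : rtr rho0 = 1) (tr1 : rtr rho1 = 1).
Local Notation Kr := (K.+1%:R : R).
Local Notation cell := (@cell R K).
Local Notation grid := (@grid R K).

Variables (A del : R) (l : nat -> 'M[C]_n) (r : 'I_K.+1 -> bool -> 'M[C]_n).
Hypothesis del0 : 0 < del.
Let de := del ^+ 2 / K.+2%:R.
Hypothesis hr : forall k b, Hpsd (r k b).
Hypothesis el : forall eta : nat -> 'M[C]_n, (forall k, Herm (eta k)) ->
      rinner rho1 (eta K.+1) - rinner rho0 (eta 0%N) =
      \sum_(k < K.+1) \sum_(b : bool)
        (Kr * (rinner (r k b) (eta k.+1) - rinner (r k b) (eta k)) +
         rinner (nabla L (eta (k + b)%N)) (nabla L (l (k + b)%N) *m r k b)) +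
      de * \sum_(i < K.+2) rinner (l i) (eta i).
Hypothesis en : \sum_(k < K.+1) \sum_(b : bool) cell_energy L l r k b +
  de * \sum_(i < K.+2) rinner (l i) (l i) <= A.

Lemma cell_energy_ge0 k b : 0 <= cell_energy L l r k b.
Proof. by rewrite /cell_energy mulr_ge0// psd_quad_ge0. Qed.

Lemma sum_energy_le : \sum_(k < K.+1) \sum_(b : bool) cell_energy L l r k b <= A.
Proof.
apply: le_trans en; rewrite lerDl mulr_ge0 ?divr_ge0 ?sqr_ge0//.
by apply: sumr_ge0 => i _; exact: rinner_ge0.
Qed.

(** The equation satisfied by the multipliers contains an extra term, which comes
    from the penalty on |lambda|^2.  By Young's inequality with parameter del it
    is of order del, because de |l|^2 is at most A and de times the number of
    nodes is del^2. *)
Lemma regularisation_error (eta : nat -> 'M[C]_n) (B : R) :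
  (forall k : nat, (k <= K.+1)%N -> rinner (eta k) (eta k) <= B) ->
  `|de * \sum_(i < K.+2) rinner (l i) (eta i)| <= 2^-1 * del * (A + B).
Proof.
move=> hB; have de0 : 0 <= de by rewrite divr_ge0 ?sqr_ge0.
have lA : de * \sum_(i < K.+2) rinner (l i) (l i) <= A.
  apply: le_trans en; rewrite lerDr.
  by apply: sumr_ge0 => k _; apply: sumr_ge0 => b _; exact: cell_energy_ge0.
have s0 : 0 < Num.sqrt del by rewrite sqrtr_gt0.
have young (i : 'I_K.+2) : `|rinner (l i) (eta i)| <= 2^-1 * (del^-1 * B + del * rinner (l i) (l i)).
  have := rinner_young (eta i) (l i) s0; rewrite sqr_sqrtr ?(ltW del0)//.
  have ik : (i <= K.+1)%N by rewrite -ltnS.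
  have : del^-1 * rinner (eta i) (eta i) <= del^-1 * B.
    by rewrite ler_wpM2l ?invr_ge0 ?(ltW del0)//; exact: hB.
  rewrite (rinnerC (l i) (eta i)).
  by move: (del^-1 * _) (del^-1 * _) (del * _) (`|_|) => a b c d; lra.
rewrite normrM (ger0_norm de0).
apply: (@le_trans _ _ (de * \sum_(i < K.+2) 2^-1 * (del^-1 * B + del * rinner (l i) (l i)))).
  rewrite ler_wpM2l//; apply: le_trans (ler_norm_sum _ _ _) _.
  by apply: ler_sum => i _; exact: young.
rewrite -mulr_sumr big_split sumr_const card_ord /= -[X in _ + X]mulr_sumr.
move: lA; move: (\sum_(i < K.+2) _) => S lA.
have -> : de * (2^-1 * ((del^-1 * B) *+ K.+2 + del * S)) = 2^-1 * del * (de * S + B).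
  have hring (d z x y : R) : d != 0 -> z != 0 ->
      d ^+ 2 / z * (2^-1 * (z * (d^-1 * x) + d * y)) = 2^-1 * d * (d ^+ 2 / z * y + x).
    by move=> d0 z0; field; rewrite z0 d0.
  by rewrite /de -(mulr_natl (del^-1 * B)); apply: hring; rewrite ?gt_eqF// ltr0n.
by rewrite ler_wpM2l ?lerD2r// mulr_ge0 ?(ltW del0).
Qed.

(** Kr is the inverse of the length of a cell: the multipliers are integrals
    over cells, and rho_k and m_k the corresponding densities. *)
Definition rho_k (k : 'I_K.+1) : 'M[C]_n := Kr%:C *: \sum_(b : bool) r k b.
Definition m_k (k : 'I_K.+1) : blockcol R n N :=
  Kr%:C *: \sum_(b : bool) nabla L (l (k + b)%N) *m r k b.
Definition e_k (k : 'I_K.+1) : R := Kr * \sum_(b : bool) cell_energy L l r k b.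

Lemma rho_k_psd k : Hpsd (rho_k k).
Proof. by apply: psdZ; [exact: ler0n|apply: psd_sum => b _; exact: hr]. Qed.

Lemma m_k_energy k : energy_bound (rho_k k) (m_k k) (e_k k).
Proof.
apply: energy_boundZ => //; rewrite !big_bool.
by apply: energy_boundD; exact: energy_bound_mul.
Qed.

Lemma rinner_rho_k E k : rinner E (rho_k k) = Kr * \sum_(b : bool) rinner E (r k b).
Proof. by rewrite /rho_k (rinnerZr _ E (\sum_b _)) rinner_sumr. Qed.

Lemma rinner_m_k E k : rinner E (m_k k) =
  Kr * \sum_(b : bool) rinner E (nabla L (l (k + b)%N) *m r k b).
Proof. by rewrite /m_k (rinnerZr _ E (\sum_b _)) rinner_sumr. Qed.

(** The discrete continuity equation tested with the identity up to the node k
    and 0 afterwards. *)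
Lemma trace_error k : `|rtr (rho_k k) - 1| <= 2^-1 * del * (A + n%:R).
Proof.
pose w (i : nat) : R := (i <= k)%N%:R.
pose eta (i : nat) : 'M[C]_n := (w i)%:C *: 1%:M.
have heta i : Herm (eta i) by apply: HermZ; exact: Herm1.
have etaE X i : rinner X (eta i) = w i * rtr X.
  by rewrite /eta (rinnerZr _ X 1%:M) rinnerC.
have neta i Y : rinner (nabla L (eta i)) Y = 0.
  have -> : nabla L (eta i) = 0 by rewrite /eta linearZ /= nabla1 scaler0.
  exact: rinner0l.
have bd : forall i : nat, (i <= K.+1)%N -> rinner (eta i) (eta i) <= n%:R.
  move=> i _; rewrite etaE /eta /rtr (rinnerZr _ 1%:M 1%:M) -/(rtr 1%:M) rtr1 mulrA.
  by rewrite /w; case: (_ <= _)%N; rewrite ?mul1r ?mul0r.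
suff -> : rtr (rho_k k) - 1 = de * \sum_(i < K.+2) rinner (l i) (eta i).
  exact: regularisation_error bd.
have wK : w K.+1 = 0 by rewrite /w leqNgt ltn_ord.
have w0 : w 0%N = 1 by rewrite /w leq0n.
pose T (i : 'I_K.+1) (b : bool) := Kr * (rinner (r i b) (eta i.+1) - rinner (r i b) (eta i)) +
    rinner (nabla L (eta (i + b)%N)) (nabla L (l (i + b)%N) *m r i b).
have tE i b : T i b = (i == k)%:R * - (Kr * rtr (r i b)).
  rewrite /T neta !etaE addr0 -mulrBl.
  have -> : w i.+1 - w i = - (i == k)%:R.
    by rewrite /w -val_eqE /=; case: (ltngtP i k); rewrite ?subrr ?subr0 ?sub0r ?oppr0.
  by move: (rtr _) (_%:R) (Kr) => x y z; ring.
have e := el heta; rewrite !etaE tr0 tr1 wK w0 !mulr1 sub0r in e.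
have eS : \sum_(i < K.+1) \sum_(b : bool) T i b = - rtr (rho_k k).
  rewrite (eq_bigr (fun i => (i == k)%:R * \sum_(b : bool) - (Kr * rtr (r i b)))); last first.
    by move=> i _; rewrite mulr_sumr; apply: eq_bigr => b _; exact: tE.
  have zero (i : 'I_K.+1) : i != k -> (i == k)%:R * (\sum_(b : bool) - (Kr * rtr (r i b))) = 0.
    by move=> /negPf ->; rewrite mul0r.
  rewrite (bigD1 k)//= eqxx mul1r [X in _ + X]big1; last exact: zero.
  rewrite addr0.
  by rewrite [in RHS]/rtr rinner_rho_k mulr_sumr -sumrN.
have {}e : - 1 = - rtr (rho_k k) + de * \sum_(i < K.+2) rinner (l i) (eta i).
  by rewrite -eS; exact: e.
by move: e; move: (de * _) (rtr _) => x y; lra.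
Qed.

Definition approximation : (R -> 'M[C]_n) * (R -> blockcol R n N) * (R -> R) :=
  ((fun t => rho_k (cell t), fun t => m_k (cell t)), fun t => e_k (cell t)).

Lemma sum_trace (M : R) : (forall k, rtr (rho_k k) <= M) ->
  \sum_(k < K.+1) \sum_(b : bool) rtr (r k b) <= M.
Proof.
move=> h; have K0' : 0 < Kr by rewrite ltr0n.
rewrite -(ler_pM2l K0') mulr_sumr.
apply: (@le_trans _ _ (\sum_(k < K.+1) M)).
  by apply: ler_sum => k _; have := h k; rewrite /rtr rinner_rho_k.
by rewrite sumr_const card_ord mulr_natl.
Qed.

(** The discrete continuity equation tested with W(t) E at the nodes.  The terms
    with rho agree exactly; in the flux the value of W at a node replaces its
    mean over a cell. *)
Lemma defect_formula E (c : R) (om : R -> R) (W := fun t => c + prim om t) :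
  measurable_fun I01 om -> (forall u, I01 u -> `|om u| <= 1) ->
  constraint_defect L rho0 rho1 approximation.1.1 approximation.1.2 E c om =
  \sum_(k < K.+1) \sum_(b : bool)
    (W (grid (k + b)) - Kr * (prim W (grid k.+1) - prim W (grid k))) *
    rinner (nabla L (hpart E)) (nabla L (l (k + b)%N) *m r k b) +
  de * \sum_(i < K.+2) rinner (l i) ((W (grid i))%:C *: hpart E).
Proof.
move=> mo bo; have lo := L1_bound mo bo.
have [mW [M bW]] := affine_prim_bound c lo; have lW := L1_bound mW bW.
pose eta (i : nat) : 'M[C]_n := (W (grid i))%:C *: hpart E.
have heta i : Herm (eta i) by apply: HermZ; exact: hpart_herm.
have etaE X i : Herm X -> rinner X (eta i) = W (grid i) * rinner E X.
  by move=> hX; rewrite /eta (rinnerZr _ X (hpart E)) rinnerC rinner_hpart.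
have neta i Y : rinner (nabla L (eta i)) Y = W (grid i) * rinner (nabla L (hpart E)) Y.
  by rewrite /eta linearZ /= (rinnerZl _ (nabla L (hpart E))).
have g1 : grid K.+1 = 1 by rewrite /grid divff// pnatr_eq0.
have g0 : grid 0 = 0 by rewrite /grid mul0r.
have W1 : W 1 = c + It om by rewrite /W prim1.
have W0 : W 0 = c by rewrite /W prim0 addr0.
pose T (k : 'I_K.+1) (b : bool) := Kr * (rinner (r k b) (eta k.+1) - rinner (r k b) (eta k)) +
    rinner (nabla L (eta (k + b)%N)) (nabla L (l (k + b)%N) *m r k b).
have e : (c + It om) * rinner E rho1 - c * rinner E rho0 =
    \sum_(k < K.+1) \sum_(b : bool) T k b + de * \sum_(i < K.+2) rinner (l i) (eta i).
  apply: etrans (el heta).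
  by rewrite (etaE rho1 K.+1 h1) (etaE rho0 0%N h0) g1 g0 W1 W0.
pose hr1 (k : 'I_K.+1) := rinner E (rho_k k).
pose hm1 (k : 'I_K.+1) := rinner E (flux L (m_k k)).
have eI : constraint_integral L approximation.1.1 approximation.1.2 E c om =
   \sum_(k < K.+1) hr1 k * (prim om (grid k.+1) - prim om (grid k)) +
   \sum_(k < K.+1) hm1 k * (prim W (grid k.+1) - prim W (grid k)).
  rewrite -(It_step hr1 lo) -(It_step hm1 lW) -(ItD (step_L1M hr1 lo) (step_L1M hm1 lW)).
  by apply: eq_It => t _; congr (_ + _); exact: mulrC.
rewrite /constraint_defect eI e addrAC; apply: (congr2 +%R); last by [].
rewrite -big_split -sumrB; apply: eq_bigr => k _ /=.
pose X (b : bool) := rinner E (r k b).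
pose Y (b : bool) := rinner (nabla L (hpart E)) (nabla L (l (k + b)%N) *m r k b).
have hX : hr1 k = Kr * (X true + X false).
  by rewrite -(sum_bool X true); exact: rinner_rho_k.
have hY : hm1 k = Kr * (Y true + Y false).
  rewrite -(sum_bool Y true); apply: etrans (rinner_flux hL E (m_k k)) _; exact: rinner_m_k.
have tE b : T k b = Kr * (X b * (prim om (grid k.+1) - prim om (grid k))) + W (grid (k + b)) * Y b.
  have hrb := psd_herm (hr k b).
  apply: (congr2 +%R); last exact: neta.
  apply: (congr1 ( *%R Kr)); rewrite (etaE (r k b) k.+1 hrb) (etaE (r k b) k hrb) /W.
  have hring (p x y z : R) : (p + x) * z - (p + y) * z = z * (x - y) by ring.
  exact: hring.
have hring (z x1 x2 y1 y2 w1 w2 p v : R) :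
    (z * (x1 * p) + w1 * y1) + (z * (x2 * p) + w2 * y2) -
    (z * (x1 + x2) * p + z * (y1 + y2) * v) = (w1 - z * v) * y1 + (w2 - z * v) * y2.
  by ring.
pose U (b : bool) := (W (grid (k + b)) - Kr * (prim W (grid k.+1) - prim W (grid k))) * Y b.
apply: etrans (esym (sum_bool U true)).
by rewrite (sum_bool (T k) true) tE (tE false) hX hY; exact: hring.
Qed.

Lemma defect_bound (B : R) E (c : R) (om : R -> R) : 0 <= B ->
  (forall X, rinner (nabla L X) (nabla L X) <= B * rinner X X) ->
  (forall k, rtr (rho_k k) <= 2) ->
  measurable_fun I01 om -> (forall u, I01 u -> `|om u| <= 1) -> `|c| <= 1 ->
  `|constraint_defect L rho0 rho1 approximation.1.1 approximation.1.2 E c om| <=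
  Kr^-1 * (A + B * rinner E E) + 2^-1 * del * (A + 4 * rinner E E).
Proof.
move=> B0 hB hM mo bo bc; rewrite (defect_formula E c mo bo).
have lo := L1_bound mo bo; have K0' : 0 < Kr by rewrite ltr0n.
apply: le_trans (ler_normD _ _) _; apply: lerD; last first.
  apply: (@regularisation_error (fun i => (c + prim om (grid i))%:C *: hpart E) _) => k kK.
  rewrite (rinnerZr _ _ (hpart E)) (rinnerZl _ (hpart E)) mulrA -expr2.
  apply: ler_pM; rewrite ?sqr_ge0 ?rinner_ge0 ?hpart_norm//.
  have p1 : `|prim om (grid k)| <= 1.
    apply: le_trans (prim_le lo (grid01 R kK)) _; rewrite -[leRHS](@It_cst R).
    by apply: It_le; [exact: L1_norm|exact: L1_cst|].
  have : `|c + prim om (grid k)| <= 2 by apply: le_trans (ler_normD _ _) _; lra.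
  by move: (c + _) => w; rewrite ler_norml => /andP[w1 w2]; nra.
have term (k : 'I_K.+1) (b : bool) :
    `|(c + prim om (grid (k + b)) - Kr * (prim (fun t => c + prim om t) (grid k.+1) -
       prim (fun t => c + prim om t) (grid k))) *
      rinner (nabla L (hpart E)) (nabla L (l (k + b)%N) *m r k b)| <=
    Kr^-1 * (cell_energy L l r k b + 2^-1 * (B * rinner E E) * rtr (r k b)).
  rewrite normrM; apply: ler_pM => //.
    have kb : (k <= k + b <= k.+1)%N.
      by rewrite leq_addr -(addn1 (nat_of_ord k)) leq_add2l; case: (b).
    have := cell_mean c mo bo kb; move: (prim _ _ - prim _ _) (c + _) => x y h.
    have -> : y - Kr * x = - Kr * (x - y / Kr) by field; rewrite gt_eqF.
    rewrite normrM normrN (gtr0_norm K0').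
    by have := ler_wpM2l (ltW K0') h; rewrite mulrCA divff ?mulr1// gt_eqF.
  apply: le_trans (energy_bound_abs (nabla L (hpart E)) (hr k b) (energy_bound_mul _ (hr k b))) _.
  rewrite lerD2l -mulrA ler_wpM2l// ler_wpM2r ?rtr_ge0//.
  by apply: le_trans (hB _) _; rewrite ler_wpM2l// hpart_norm.
apply: le_trans (ler_norm_sum _ _ _) _.
apply: (@le_trans _ _ (\sum_(k < K.+1) \sum_(b : bool)
    Kr^-1 * (cell_energy L l r k b + 2^-1 * (B * rinner E E) * rtr (r k b)))).
  apply: ler_sum => k _; apply: le_trans (ler_norm_sum _ _ _) _.
  by apply: ler_sum => b _; exact: term.
have -> : \sum_(k < K.+1) \sum_(b : bool)
    Kr^-1 * (cell_energy L l r k b + 2^-1 * (B * rinner E E) * rtr (r k b)) =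
  Kr^-1 * (\sum_(k < K.+1) \sum_(b : bool) cell_energy L l r k b +
     2^-1 * (B * rinner E E) * \sum_(k < K.+1) \sum_(b : bool) rtr (r k b)).
  rewrite !mulr_sumr -big_split mulr_sumr; apply: eq_bigr => k _ /=.
  by rewrite !mulr_sumr -big_split mulr_sumr.
rewrite ler_wpM2l ?invr_ge0//; apply: lerD; first exact: sum_energy_le.
have := sum_trace hM; have : 0 <= B * rinner E E by rewrite mulr_ge0// rinner_ge0.
by move: (B * _) (\sum_(k < K.+1) _) => x y x0 y2; nra.
Qed.

(** The hypotheses can be met in this order: A, then del, then the mesh, which
    depends on the bound B for nabla. *)
Lemma primal_approximation (B D kap : R) : 0 <= B -> 0 <= A ->
  (forall X, rinner (nabla L X) (nabla L X) <= B * rinner X X) ->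
  A <= D + kap -> del * (A + n%:R) <= 2 * kap -> kap <= 1 ->
  del * (A + 4) <= kap -> Kr^-1 * (A + B) <= 2^-1 * kap ->
  approx_solution L rho0 rho1 D kap approximation.
Proof.
move=> B0 A0 hB AD dn k1 d4 KB.
have tre k : `|rtr (rho_k k) - 1| <= kap.
  by apply: le_trans (trace_error k) _; rewrite -mulrA; lra.
have trM k : rtr (rho_k k) <= 2.
  by have := tre k; rewrite ler_norml => /andP[_]; lra.
split.
- by move=> t; exact: rho_k_psd.
- by move=> t; exact: tre.
- by move=> t; exact: m_k_energy.
- by move=> E; exact: (step_mfun (fun k => rinner E (rho_k k))).
- by move=> E; exact: (step_mfun (fun k => rinner E (m_k k))).
- exact: (step_L1 e_k).
- rewrite (It_step_cst e_k); apply: le_trans _ AD; apply: le_trans _ sum_energy_le.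
  by apply: ler_sum => k _; rewrite /e_k mulrAC divff ?mul1r// pnatr_eq0.
- move=> E c om mo bo bc; apply: le_trans (@defect_bound B E c om B0 hB trM mo bo bc) _.
  have E0 := rinner_ge0 E; move: E0; move: (rinner E E) => x x0.
  have Ki : 0 <= Kr^-1 by rewrite invr_ge0 ler0n.
  have h1' : Kr^-1 * (A + B * x) <= Kr^-1 * (A + B) * (1 + x).
    by rewrite -mulrA ler_wpM2l//; nra.
  have h2' : del * (A + 4 * x) <= del * (A + 4) * (1 + x).
    by rewrite -mulrA ler_wpM2l// ?(ltW del0)//; nra.
  have x1 : 0 <= 1 + x by rewrite addr_ge0.
  have h3' := ler_wpM2r x1 KB; have h4' := ler_wpM2r x1 d4.
  move: h1' h2' h3' h4'; rewrite -[2^-1 * del * _]mulrA.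
  by move: (Kr^-1 * _) (del * _) (Kr^-1 * _ * _) (del * _ * _) => a1 a2 a3 a4; lra.
Qed.

End PrimalCandidate.

(** * Equality of the two values *)

Section Existence.
Variable R : realType.
Local Notation C := R[i].
Variables (n N : nat) (L : 'I_N -> 'M[C]_n).
Hypothesis hL : forall k, Herm (L k).
Variables (rho0 rho1 : 'M[C]_n).
Hypotheses (h0 : Dpd rho0) (h1 : Dpd rho1).

Lemma Dpd_rtr (r : 'M[C]_n) : Dpd r -> Herm r /\ rtr r = 1.
Proof.
by move=> [p t]; split; [exact/psd_herm/pd_psd|rewrite rtrE t].
Qed.

(** The potential 0 on a grid of one cell. *)
Lemma zero_dual : dual_values L rho0 rho1 0%E.
Proof.
have [_ t1] := Dpd_rtr h1.
have := @dual_candidate _ _ _ L rho0 rho1 0 t1 (fun=> 0) (fun=> 0) (fun=> Herm0 _ _) _.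
rewrite big1 => [|k _]; last by rewrite mul0r.
rewrite !rinner0r !subr0; apply => k b.
rewrite /grid_hjb subrr !scaler0 add0r scale0r.
have -> : gram L 0 = 0 by rewrite /gram linear0 mulmx0.
by rewrite scaler0 subrr; exact: psd0.
Qed.

Lemma approximations_exist (D : R) : 0 <= D ->
  (forall x, dual_values L rho0 rho1 x -> (x <= D%:E)%E) ->
  forall kap, 0 < kap -> exists x, approx_solution L rho0 rho1 D kap x.
Proof.
move=> D0 ub kap0 kap0_gt0.
have [k0 t0] := Dpd_rtr h0; have [k1 t1] := Dpd_rtr h1.
pose kap := Num.min kap0 1.
have kpos : 0 < kap by rewrite lt_min kap0_gt0 ltr01.
have kle : kap <= kap0 by rewrite ge_min lexx.
have kle1 : kap <= 1 by rewrite ge_min lexx orbT.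
have [B B0 hB] := nabla_bound L.
pose A := D + kap; have A0 : 0 <= A by rewrite addr_ge0// ltW.
have nn : 0 <= n%:R :> R by rewrite ler0n.
(* The penalty costs at most 2 eps n <= kap; del controls the trace and the
   regularisation, and the mesh 1 / K.+1 the passage from means over cells to
   values at nodes. *)
pose eps : R := kap / (2 * (n%:R + 1)).
have eps0 : 0 < eps by rewrite divr_gt0// mulr_gt0// ltr_wpDl.
pose K := Num.trunc (2 * (A + B) / kap).
have hK : 2 * (A + B) / kap < K.+1%:R.
  have := Num.Theory.truncn_itv (_ : 0 <= 2 * (A + B) / kap).
  by rewrite divr_ge0 ?mulr_ge0 ?addr_ge0 ?(ltW kpos)// => /(_ isT)/andP[].
pose del := kap / (A + n%:R + 4).
have den0 : 0 < A + n%:R + 4 by rewrite ltr_wpDl// addr_ge0.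
have del0 : 0 < del by rewrite divr_gt0.
have delE : del * (A + n%:R + 4) = kap by rewrite /del divfK// gt_eqF.
pose de := del ^+ 2 / K.+2%:R.
have de0 : 0 < de by rewrite divr_gt0 ?exprn_gt0 ?ltr0n.
have q0 : 0 < 2 * K.+1%:R * eps by rewrite !mulr_gt0 ?ltr0n.
have [l [r [e1 e2 e3 e4 e5]]] := grid_duality hL rho0 rho1 K q0 de0.
have en := discrete_energy t1 eps0 ub e1 e2 e3 e4 e5.
have enA : \sum_(k < K.+1) \sum_(b : bool) cell_energy L l r k b +
    de * \sum_(i < K.+2) rinner (l i) (l i) <= A.
  apply: le_trans en _; rewrite lerD2l /eps.
  have n1 : 0 < n%:R + 1 :> R by rewrite ltr_wpDl.
  have -> : 2 * (kap / (2 * (n%:R + 1))) * n%:R = kap * (n%:R / (n%:R + 1)).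
    by move: (n%:R : R) n1 => z /gt_eqF z0; field; rewrite z0.
  by rewrite ler_piMr ?(ltW kpos)// ler_pdivrMr// mul1r lerDl.
exists (approximation L l r); apply: (approxW kle).
have dA : 0 <= del * A by rewrite mulr_ge0// ltW.
have dn : 0 <= del * n%:R by rewrite mulr_ge0// ltW.
apply: (primal_approximation hL k0 k1 t0 t1 del0 e2 e5 enA B0 A0 hB) => //.
- by move: delE; rewrite !mulrDr; lra.
- by move: delE; rewrite !mulrDr; lra.
- move: hK; rewrite ltr_pdivrMr// mulrC => h.
  by rewrite ler_pdivrMl ?ltr0n//; move: h; move: (K.+1%:R : R) (A + B) => z w; lra.
Qed.

End Existence.

Theorem theorem22 (R : realType) (n N : nat) (hn : (1 <= n)%N) (hN : (1 <= N)%N)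
    (L : 'I_N -> 'M[R[i]]_n) (hL : forall k, Herm (L k))
    (rho0 rho1 : 'M[R[i]]_n) (h0 : Dpd rho0) (h1 : Dpd rho1)
    (h01 : ker_nabla_perp L (rho0 - rho1)) :
  exists (rho : R -> 'M[R[i]]_n) (m : R -> 'M[R[i]]_(\sum_(k < N) n, n)),
    [/\ admissible L rho0 rho1 rho m,
        forall (rho' : R -> 'M[R[i]]_n)
               (m' : R -> 'M[R[i]]_(\sum_(k < N) n, n)),
          admissible L rho0 rho1 rho' m' ->
          (action rho m <= action rho' m')%E &
        action rho m = ereal_sup (dual_values L rho0 rho1)].
Proof.
set De := ereal_sup _.
have weak rho m : admissible L rho0 rho1 rho m -> (De <= action rho m)%E.
  move=> adm; apply: ge_ereal_sup => x [lam [dlam [l0 [l1 [w bv hj ->]]]]].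
  exact: (weak_duality hL adm w bv hj).
have De0 : (0 <= De)%E by apply: ereal_sup_ubound; exact: zero_dual.
have [rr [mr [admr fin]]] := reference_path hL h0 h1 h01.
have Dfin : De \is a fin_num.
  by rewrite ge0_fin_numE//; apply: le_lt_trans fin; exact: weak.
have ub x : dual_values L rho0 rho1 x -> (x <= (fine De)%:E)%E.
  by move=> hx; rewrite fineK//; exact: ereal_sup_ubound.
have D0 : 0 <= fine De by rewrite fine_ge0.
have [rho [m [adm le]]] :=
  approximate_to_exact hn hL (approximations_exist hL h0 h1 D0 ub) D0.
rewrite fineK// in le.
exists rho, m; split; first exact: adm.
- by move=> rho' m' /weak; exact: le_trans.
- by apply: le_anti; apply/andP; split; [exact: le|exact: weak].
Qed.
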